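(* Let $D\subset\mathbb{C}^n$ be a pseudoconvex bounded domain with smooth ($C^\infty$) boundary $S=\partial D$, and let $1\le q\le n-1$ be an integer. Assume that for every boundary point $p\in S$ the tower multitype $\mathcal{T}(p)=(t_1,\ldots,t_{n-1})$ of $S$ at $p$ satisfies $$\#\{k: t_k=\infty\}<q .$$ Then $S$ satisfies property $(P_q)$.
   Context: Let $S\subset\mathbb{C}^n$, $n\ge2$, be a smooth real hypersurface. $HS$ is its complex tangent bundle, $\mathbb{C}HS=H^{10}S\oplus\overline{H^{10}S}$ the complexification, $H^{10}S$ the bundle of $(1,0)$ tangent vectors (of rank $n-1$). A complex contact form $\theta$ on $S$ (defined locally) is a nowhere zero $\mathbb{C}$-valued $1$-form on $S$ vanishing on $\mathbb{C}HS$. For an ordered list $L^t,\ldots,L^1\in\Gamma(H^{10}S)\cup\Gamma(\overline{H^{10}S})$ of local vector fields, $t\ge1$, the $\theta$-dual form is the complex $1$-form $\omega_{L^t,\ldots,L^1;\theta}$ on $H^{10}S$ defined, for $L\in\Gamma(H^{10}S)$, by $\omega_{L^1;\theta}(L_p)=\theta([L,L^1])(p)$ if $t=1$, and $\omega_{L^t,\ldots,L^1;\theta}(L_p)=(Lf)(p)$ with $f=\mathrm{Re}\,(L^t\cdots L^3\,\theta([L^2,L^1]))$ if $t\ge2$. For a complex subbundle $E\subset H^{10}S$, a complex $1$-form on $H^{10}S$ is called $E$-dual of order $t\in\mathbb{N}_{\ge2}$ if it is the $\theta$-dual form of a list of $t-1$ vector fields $L^{t-1},\ldots,L^1\in\Gamma(E)\cup\Gamma(\overline{E})$.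 A tower of multi-order $(t_1,\ldots,t_{n-1})\in(\mathbb{N}_{\ge2}\cup\{\infty\})^{n-1}$ on (an open subset of) $S$ is a nested sequence of complex subbundles $H^{10}S=E_0\supset\cdots\supset E_m$, $0\le m\le n-1$, such that $t_{m+1}=\cdots=t_{n-1}=\infty$ and for each $k=1,\ldots,m$ one has $t_k\in\mathbb{N}_{\ge2}$ and there is an $E_{k-1}$-dual form $\omega_k$ of order $t_k$ that does not vanish on (each fiber of) $E_{k-1}$ and $E_k=E_{k-1}\cap\{\omega_k=0\}$. The tower multitype $\mathcal{T}(p)\in(\mathbb{N}_{\ge2}\cup\{\infty\})^{n-1}$ at $p\in S$ is the lexicographically minimum multi-order of a tower on a neighborhood of $p$ in $S$. It does not depend on $\theta$. Property $(P_q)$: a compact $K\subset\mathbb{C}^n$ satisfies $(P_q)$ if for every $C>0$ there exist an open neighborhood $U$ of $K$ in $\mathbb{C}^n$ and a real $C^2$ function $\lambda\colon U\to\mathbb{R}$ with $0\le\lambda\le1$ such that the sum of any $q$ eigenvalues of the complex Hessian $(\lambda_{z_j\bar z_k})_{j,k=1}^n$ is greater than $C$ on $U$. *)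

(* Defs.v *)
From HB Require Import structures.
From mathcomp Require Import all_boot all_order all_algebra.
From mathcomp Require Import all_classical all_reals all_analysis.
From mathcomp Require Import complex.

Set Implicit Arguments.
Unset Strict Implicit.
Unset Printing Implicit Defensive.

Import Order.TTheory GRing.Theory Num.Theory.
Import numFieldNormedType.Exports.

Local Open Scope classical_set_scope.
Local Open Scope ring_scope.

(* C^n is identified with R^n x R^n: the pair (x, y) is the point z = x + i y,
   so that C^n carries the topology and the real differential calculus of a
   normed space over R. *)
Notation cspace R n := ('rV[R]_n * 'rV[R]_n)%type.

(* Both a complexified tangent vector
     X = sum_j X.1_j d/dz_j + X.2_j d/dzbar_j
   and a C-valued 1-form
     w = sum_j w.1_j dz_j + w.2_j dzbar_j
   at a point are given by their pair of rows of coefficients. The vector X is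
   of type (1,0) when X.2 = 0, and of type (0,1) when X.1 = 0. *)
Notation covec R n := ('rV[R[i]]_n * 'rV[R[i]]_n)%type.

Notation conjv := (map_mx (@conjc _)).

Section Calculus.
Variables (R : realType) (n : nat).
Implicit Types (U : set (cspace R n)) (p : cspace R n) (j : 'I_n).

Definition iter_derive (vs : seq (cspace R n)) (f : cspace R n -> R) :
  cspace R n -> R := foldr (fun v g => 'D_v g) f vs.

Definition Ck (k : nat) U (f : cspace R n -> R) : Prop :=
  forall vs, (size vs <= k)%N -> forall p, U p ->
    {for p, continuous (iter_derive vs f)} /\
    ((size vs < k)%N -> forall v, derivable (iter_derive vs f) p v).

Definition smooth U (f : cspace R n -> R) : Prop := forall k, Ck k U f.

Definition csmooth U (f : cspace R n -> R[i]) : Prop :=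
  smooth U (fun x => complex.Re (f x)) /\ smooth U (fun x => complex.Im (f x)).

Definition mxsmooth r m U (A : cspace R n -> 'M[R[i]]_(r, m)) : Prop :=
  forall k l, csmooth U (fun x => A x k l).

Definition smooth_field U (X : cspace R n -> covec R n) : Prop :=
  mxsmooth U (fun x => (X x).1) /\ mxsmooth U (fun x => (X x).2).

Definition cderive (v : cspace R n) (f : cspace R n -> R[i]) p : R[i] :=
  ('D_v (fun x => complex.Re (f x)) p +i* 'D_v (fun x => complex.Im (f x)) p)%C.

Definition d_dx j := cderive (delta_mx 0 j, 0).
Definition d_dy j := cderive (0, delta_mx 0 j).

Definition d_dz j (f : cspace R n -> R[i]) p : R[i] :=
  (d_dx j f p - 'i%C * d_dy j f p) / 2.

Definition d_dzbar j (f : cspace R n -> R[i]) p : R[i] :=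
  (d_dx j f p + 'i%C * d_dy j f p) / 2.

Definition cplx (f : cspace R n -> R) : cspace R n -> R[i] :=
  fun x => (f x)%:C%C.

Definition complex_hessian (f : cspace R n -> R) p : 'M[R[i]]_n :=
  \matrix_(j, k) d_dz j (d_dzbar k (cplx f)) p.

Definition vapply (X : covec R n) (f : cspace R n -> R[i]) p : R[i] :=
  \sum_j (X.1 0 j * d_dz j f p + X.2 0 j * d_dzbar j f p).

Definition fapply (X : cspace R n -> covec R n) (f : cspace R n -> R[i]) :
  cspace R n -> R[i] := fun p => vapply (X p) f p.

Definition pairing (w X : covec R n) : R[i] :=
  \sum_j (w.1 0 j * X.1 0 j + w.2 0 j * X.2 0 j).

Definition bracket (X Y : cspace R n -> covec R n) : cspace R n -> covec R n :=
  fun p =>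
    (\row_j (fapply X (fun x => (Y x).1 0 j) p -
             fapply Y (fun x => (X x).1 0 j) p),
     \row_j (fapply X (fun x => (Y x).2 0 j) p -
             fapply Y (fun x => (X x).2 0 j) p)).

End Calculus.

(* Sections over an open subset of the hypersurface S (functions, vector
   fields, forms) are represented by smooth objects on an open subset U of C^n,
   of which only the restriction to S matters: S is closed in U, so every
   section over the intersection of S and U extends smoothly to U, and both X f
   and [X, Y] on S depend only on the restrictions to S of f, X and Y, as X and
   Y are tangent to S along S. *)
Section Hypersurface.
Variables (R : realType) (n : nat).
Implicit Types (S U : set (cspace R n)) (p : cspace R n) (rho : cspace R n -> R)
  (E : cspace R n -> set 'rV[R[i]]_n) (X L theta : cspace R n -> covec R n).

Definition defining_function S U rho : Prop :=
  [/\ open U, smooth U rho,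
      forall p, U p -> (S p <-> rho p = 0) &
      forall p, U p -> S p -> exists v, 'D_v rho p != 0].

(* The complexified tangent space of S at p is the kernel of d rho_p; it does
   not depend on the defining function rho. *)
Definition ctangent S p : set (covec R n) :=
  [set X | forall U rho, defining_function S U rho -> U p ->
           vapply X (cplx rho) p = 0].

Definition H10 S p : set 'rV[R[i]]_n := [set v | ctangent S p (v, 0)].

Definition contact_form S U theta : Prop :=
  smooth_field U theta /\
  forall p, S p -> U p ->
    (exists2 X, ctangent S p X & pairing (theta p) X != 0) /\
    (forall v, H10 S p v ->
       pairing (theta p) (v, 0) = 0 /\ pairing (theta p) (0, conjv v) = 0).

Definition complex_subbundle S U E : Prop :=
  forall p, S p -> U p ->
    exists (V : set (cspace R n)) (r : nat)
           (e : cspace R n -> 'M[R[i]]_(r, n)),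
      [/\ open V, V p, V `<=` U, mxsmooth V e &
          forall x, S x -> V x ->
            [/\ E x `<=` H10 S x, row_free (e x) &
                E x = [set v | (v <= e x)%MS]]].

(* X belongs to Gamma(E), respectively to Gamma(Ebar), over S and U. *)
Definition section10 S U E X : Prop :=
  smooth_field U X /\
  forall p, S p -> U p -> (X p).2 = 0 /\ E p (X p).1.

Definition section01 S U E X : Prop :=
  smooth_field U X /\
  forall p, S p -> U p -> (X p).1 = 0 /\ E p (conjv (X p).2).

(* For Ls = [:: L^t; ...; L^1] with t >= 2, this is the function
   L^t ... L^3 (theta [L^2, L^1]). *)
Fixpoint iter_contact theta (Ls : seq (cspace R n -> covec R n)) :
    cspace R n -> R[i] :=
  match Ls with
  | [:: L2; L1] => fun p => pairing (theta p) (bracket L2 L1 p)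
  | X :: Ls' => fapply X (iter_contact theta Ls')
  | [::] => fun=> 0
  end.

(* The value prescribed for omega_{L^t, ..., L^1; theta} (L_p). *)
Definition dual_value theta (Ls : seq (cspace R n -> covec R n)) L :
    cspace R n -> R[i] :=
  match Ls with
  | [::] => fun=> 0
  | [:: L1] => fun p => pairing (theta p) (bracket L L1 p)
  | _ => fapply L (cplx (fun x => complex.Re (iter_contact theta Ls x)))
  end.

(* omega is a form on H10 S: its values outside H10 S are irrelevant. The
   sections L are local in U, so that the condition determines omega on H10 S. *)
Definition is_dual_form S U theta (Ls : seq (cspace R n -> covec R n))
    (omega : cspace R n -> 'rV[R[i]]_n -> R[i]) : Prop :=
  forall V L, open V -> V `<=` U -> section10 S V (H10 S) L ->
    forall p, S p -> V p -> omega p (L p).1 = dual_value theta Ls L p.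

Definition dual_of_order S U theta E (t : nat)
    (omega : cspace R n -> 'rV[R[i]]_n -> R[i]) : Prop :=
  (2 <= t)%N /\
  exists Ls : seq (cspace R n -> covec R n),
    [/\ size Ls = t.-1,
        forall k, (k < size Ls)%N ->
          section10 S U E (nth (fun=> 0) Ls k) \/
          section01 S U E (nth (fun=> 0) Ls k) &
        is_dual_form S U theta Ls omega].

(* Multi-orders: None stands for infinity, and the entry t_k has index k.-1. *)
Definition tower S U theta (t : n.-1.-tuple (option nat)) : Prop :=
  exists (m : nat) (E : nat -> cspace R n -> set 'rV[R[i]]_n)
         (omega : nat -> cspace R n -> 'rV[R[i]]_n -> R[i]),
    [/\ (m <= n.-1)%N,
        forall k, (k <= m)%N -> complex_subbundle S U (E k),
        forall p, S p -> U p -> E 0%N p = H10 S p,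
        forall k, (m <= k < n.-1)%N -> nth None t k = None &
        forall k, (k < m)%N ->
          (exists2 s, nth None t k = Some s &
             dual_of_order S U theta (E k) s (omega k)) /\
          (forall p, S p -> U p ->
             (exists2 v, E k p v & omega k p v != 0) /\
             E k.+1 p = E k p `&` [set v | omega k p v = 0])].

(* The choice of theta is immaterial: the dual form of L^t, ..., L^2, L^1 with
   respect to g * theta is the dual form of L^t, ..., L^3, g L^2, L^1 with
   respect to theta (of g L^1 if t = 1). *)
Definition tower_multiorder S p (t : n.-1.-tuple (option nat)) : Prop :=
  exists U theta,
    [/\ open U, U p, contact_form S U theta & tower S U theta t].

Definition order_lt (a b : option nat) : bool :=
  match a, b with
  | Some k, Some l => (k < l)%N
  | Some _, None => true
  | None, _ => false
  end.

Definition lex_lt (s t : seq (option nat)) : Prop :=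
  exists2 k, forall j, (j < k)%N -> nth None s j = nth None t j &
             order_lt (nth None s k) (nth None t k).

Definition is_tower_multitype S p (t : n.-1.-tuple (option nat)) : Prop :=
  tower_multiorder S p t /\
  forall t', tower_multiorder S p t' -> t = t' \/ lex_lt t t'.

End Hypersurface.

Section Domains.
Variables (R : realType) (n : nat).
Implicit Types (D K : set (cspace R n)).

Definition boundary D : set (cspace R n) := closure D `\` interior D.

Definition bounded_domain D : Prop :=
  [/\ open D, connected D, D !=set0 & bounded_set D].

Definition domain_defining_function D (U : set (cspace R n))
    (rho : cspace R n -> R) : Prop :=
  defining_function (boundary D) U rho /\
  forall p, U p -> (D p <-> rho p < 0).

Definition smooth_boundary D : Prop :=
  forall p, boundary D p ->
    exists U rho, domain_defining_function D U rho /\ U p.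

(* Levi pseudoconvexity of a domain with smooth boundary. *)
Definition pseudoconvex D : Prop :=
  forall p, boundary D p ->
  forall U rho, domain_defining_function D U rho -> U p ->
  forall v, H10 (boundary D) p v ->
    0 <= \sum_j \sum_k complex_hessian rho p j k * v 0 j * (v 0 k)^*%C.

(* The n eigenvalues are taken with multiplicity, as the roots of the
   characteristic polynomial; a <= or < relation in R[i] entails that the
   difference of both sides is real. *)
Definition property_P (q : nat) K : Prop :=
  forall C : R, 0 < C ->
    exists U (lambda : cspace R n -> R),
      [/\ open U, K `<=` U, Ck 2 U lambda,
          forall p, U p -> 0 <= lambda p <= 1 &
          forall p, U p -> forall e : n.-tuple R[i],
            char_poly (complex_hessian lambda p) =
              \prod_(j < n) ('X - (tnth e j)%:P) ->
            forall A : {set 'I_n}, #|A| = q ->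
              C%:C%C < \sum_(j in A) tnth e j].

End Domains.

(* Main.v *)
(* By the spectral theorem, (P_q) only needs functions with values in [0, 1] whose Hessian has
   large trace over any q orthonormal vectors; this condition is local, and regularised
   maxima glue it from a compact subset and its complement. One then argues by
   well-founded induction on the multitype. Near a point p of multitype t, with tower
   E_0, ..., E_m and defining function rho, let f_k be the function whose derivative is
   the dual form of order t_k >= 3. Where some f_k is nonzero, a dual form of lower order
   is nonzero, which gives a tower of smaller multi-order, so those points are covered by
   the induction hypothesis. On the common zero set of rho and the f_k the potential
   A (rho + B rho^2 + sum f_k^2) + 1/2 does the job: a null vector of the Levi form at p
   that kills every df_k lies in E_m, whose rank is the number of infinite entries of t
   and hence less than q. *)

Require Import Defs.
From mathcomp Require Import all_boot all_order all_algebra.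
From mathcomp Require Import all_classical all_reals all_analysis.
From mathcomp Require Import complex.
From mathcomp Require Import perm sesquilinear spectral.
From mathcomp Require Import ring lra.

Set Implicit Arguments.
Unset Strict Implicit.
Unset Printing Implicit Defensive.

Import Order.TTheory GRing.Theory Num.Theory.
Import numFieldNormedType.Exports.

Local Open Scope classical_set_scope.
Local Open Scope ring_scope.

(** * Derivatives along directions *)

(** [Ck] only speaks of iterated directional derivatives, so linearity in the direction, symmetry of
    second derivatives and the fact that vectors tangent to S kill functions vanishing on S are
    extracted from continuity by mean value and intermediate value arguments. The potential can be
    made arbitrarily large because it is a multiple of a function vanishing on the set in question,
    shifted by 1/2: only the neighbourhood shrinks with the constant, while the values stay in
    [0, 1]. Semipositivity is known only on tangent vectors, so the term in rho^2 has to penalise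
    normal components uniformly over all q-frames; compactness of the set of frames provides this.
    Dual forms of order 2 contribute no function: they are values of the Levi form, whose null
    vectors lie in its kernel. The lowering of orders is used twice: at p, minimality turns it into
    the vanishing of every f_k, and at nearby points it gives access to the induction hypothesis.
    Those nearby points do not form a compact set, hence a gluing lemma that asks for the property
    only on compact sets disjoint from the zero set. *)

Section Directional.
Variables (R : realType) (V : normedModType R).
Implicit Types (f g : V -> R) (p u v w x : V).

Lemma is_derive_line f p v (s : R) : derivable f (p + s *: v) v ->
  is_derive s 1 (fun t : R => f (p + t *: v)) ('D_v f (p + s *: v)).
Proof.
move=> df.
have E : (fun h : R => h^-1 *: (((fun t : R => f (p + t *: v)) \o shift s) (h *: 1)
    - f (p + s *: v))) =
  (fun h => h^-1 *: ((f \o shift (p + s *: v)) (h *: v) - f (p + s *: v))).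
  apply/funext => h /=; congr (_ *: (f _ - _)).
  by rewrite [h *: 1]mulr1 scalerDl addrCA.
apply: DeriveDef; first by rewrite /derivable E.
by rewrite /derive E.
Qed.

(** The estimate allows [h = 0] and involves no division, unlike the difference quotient; the
    estimates below are carried out in this form. *)
Lemma is_derive_increment f p v (l : R) :
  (forall e : R, 0 < e -> exists2 d, 0 < d & forall h : R, `|h| < d ->
     `|f (p + h *: v) - f p - h * l| <= e * `|h|) ->
  is_derive p v f l.
Proof.
move=> H.
have L : (fun h : R => h^-1 *: ((f \o shift p) (h *: v) - f p)) @ 0^' --> l.
  apply/cvgrPdist_le => e e0; have [d d0 Hd] := H _ e0.
  near=> h.
  have h0 : h != 0 by near: h; exact: nbhs_dnbhs_neq.
  have hd : `|h| < d by near: h; apply: dnbhs0_lt.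
  have := Hd _ hd; rewrite /= [h *: v + p]addrC => le.
  have hp : 0 < `|h| by rewrite normr_gt0.
  rewrite -(ler_pM2r hp) -normrM (le_trans _ le)// -normrN.
  by rewrite [h^-1 *: _]mulrC mulrBl divfK// opprB [l * h]mulrC.
by apply: DeriveDef; [apply/cvg_ex; exists l|apply: cvg_lim].
Unshelve. all: by end_near. Qed.

Lemma derive_increment f p v : derivable f p v ->
  forall e : R, 0 < e -> exists2 d, 0 < d & forall h : R, `|h| < d ->
     `|f (p + h *: v) - f p - h * 'D_v f p| <= e * `|h|.
Proof.
move=> df e e0.
have L : (fun h : R => h^-1 *: ((f \o shift p) (h *: v) - f p)) @ 0^' --> 'D_v f p.
  exact: df.
move/cvgrPdist_le: L => /(_ _ e0) [d /= d0 Hd]; exists d => // h hd.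
have [->|h0] := eqVneq h 0.
  by rewrite scale0r addr0 subrr mul0r subr0 !normr0 mulr0.
have := Hd h; rewrite /= sub0r normrN => /(_ hd h0) le.
have hp : 0 < `|h| by rewrite normr_gt0.
move: le; rewrite [h *: v + p]addrC -(ler_pM2r hp) -normrM => le.
rewrite (le_trans _ le)// -normrN opprB.
by rewrite [h^-1 *: _]mulrC mulrBl divfK// mulrC.
Qed.

Lemma derive_dirZ f p v (a : R) : derivable f p v ->
  is_derive p (a *: v) f (a * 'D_v f p).
Proof.
move=> df; have [->|a0] := eqVneq a 0.
  by rewrite scale0r mul0r -(derive0 f p); apply: derivableP; exact: derivable0.
have a1 : 0 < `|a| by rewrite normr_gt0.
apply: is_derive_increment => e e0.
have [d d0 Hd] := derive_increment df (divr_gt0 e0 a1).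
exists (d / `|a|); first by rewrite divr_gt0.
move=> h; rewrite ltr_pdivlMr// -normrM => /Hd.
rewrite scalerA mulrA => le; rewrite (le_trans le)// normrM.
by rewrite [`|h| * _]mulrC mulrA divfK ?gt_eqF.
Qed.

Lemma MVT_line f p v :
  (forall s : R, 0 <= s <= 1 -> derivable f (p + s *: v) v) ->
  exists2 s : R, 0 <= s <= 1 & f (p + v) - f p = 'D_v f (p + s *: v).
Proof.
move=> df; pose g s := f (p + s *: v).
have dg (s : R) : 0 <= s <= 1 -> is_derive s 1 g ('D_v f (p + s *: v)).
  by move=> /df/is_derive_line.
have [||c] := @MVT_segment R g (fun s => 'D_v f (p + s *: v)) 0 1 ler01.
- by move=> x; rewrite in_itv /= => /andP[x0 x1]; apply: dg; rewrite !ltW.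
- apply: derivable_within_continuous => x; rewrite in_itv /= => /dg dx.
  exact: ex_derive.
rewrite in_itv /= => c01; rewrite /g scale1r scale0r addr0 subr0 mulr1 => E.
by exists c.
Qed.

(* The strict derivative: the difference quotients converge uniformly in the
   base point. *)
Lemma C1_increment f p v :
  (\forall x \near p, derivable f x v) -> {for p, continuous ('D_v f)} ->
  forall e : R, 0 < e -> exists2 d, 0 < d & forall x (h : R),
     `|x - p| < d -> `|h| < d ->
     `|f (x + h *: v) - f x - h * 'D_v f p| <= e * `|h|.
Proof.
move=> df cf e e0.
have : \forall x \near p, derivable f x v /\ `|'D_v f p - 'D_v f x| <= e.
  near=> x; split; first by near: x; exact: df.
  by near: x; move/cvgrPdist_le : cf; apply.
case/nbhs_normP => d /= d0 Hd; have v1 : 0 < 1 + `|v| by rewrite ltr_wpDr.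
exists (d / 2 / (1 + `|v|)); first by rewrite !divr_gt0.
move=> x h xd; rewrite ltr_pdivlMr// => hd.
have xd2 : `|x - p| < d / 2.
  apply: lt_le_trans xd _; rewrite ler_pdivrMr// ler_peMr ?lerDl//.
  by rewrite divr_ge0// ltW.
have near_line s : 0 <= s <= 1 -> ball_ Num.norm p d (x + s *: (h *: v)).
  move=> /andP[s0 s1]; rewrite /= -normrN opprB addrAC.
  rewrite [d]splitr (le_lt_trans (ler_normD _ _))// ltrD//.
  rewrite (le_lt_trans _ hd)// !normrZ (ger0_norm s0) mulrDr mulr1.
  by rewrite ler_wpDl// ler_piMl// mulr_ge0.
have [|s s01] := @MVT_line f x (h *: v).
  move=> s /near_line/Hd[dx _].
  exact: (@ex_derive _ _ _ _ _ _ _ (derive_dirZ h dx)).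
have [dx le] := Hd _ (near_line _ s01).
have /@derive_val -> := derive_dirZ h dx => ->.
by rewrite -mulrBr normrM mulrC ler_wpM2r// distrC.
Unshelve. all: by end_near. Qed.

(** The increment along [u + v] is split at [p + h u]. The second leg starts from a moving base
    point, hence the strict derivative along [v]; the first leg starts from [p] itself. *)
Lemma derive_dirD f p u v :
  (\forall x \near p, derivable f x v) -> {for p, continuous ('D_v f)} ->
  derivable f p u -> is_derive p (u + v) f ('D_u f p + 'D_v f p).
Proof.
move=> dv cv du; apply: is_derive_increment => e e0.
have e2 : 0 < e / 2 by rewrite divr_gt0.
have [d d0 Hd] := C1_increment dv cv e2.
have [d' d'0 Hd'] := derive_increment du e2.
have u1 : 0 < 1 + `|u| by rewrite ltr_wpDr.
exists (Num.min d' (Num.min d (d / (1 + `|u|)))).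
  by rewrite !lt_min d0 d'0 divr_gt0.
move=> h; rewrite !lt_min => /and3P[hd' hd]; rewrite ltr_pdivlMr// => hdu.
have := Hd' _ hd'; have := Hd (p + h *: u) h.
rewrite [p + _ - p]addrAC subrr add0r => /(_ _ hd).
have -> : `|h *: u| < d.
  rewrite (le_lt_trans _ hdu)// normrZ ler_wpM2l// ler_wpDl//.
move=> /(_ isT) l1 l2; rewrite [e]splitr mulrDl (le_trans _ (lerD l1 l2))//.
rewrite (le_trans _ (ler_normD _ _))// scalerDr addrA mulrDr.
rewrite le_eqVlt; apply/orP; left; apply/eqP; congr `|_|.
by ring.
Qed.

Lemma derive_sym f p u v :
  (\forall x \near p, derivable f x u /\ derivable f x v) ->
  (\forall x \near p, derivable ('D_u f) x v /\ derivable ('D_v f) x u) ->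
  {for p, continuous ('D_v ('D_u f))} -> {for p, continuous ('D_u ('D_v f))} ->
  'D_v ('D_u f) p = 'D_u ('D_v f) p.
Proof.
move=> d1 d2 c1 c2; apply/eqP; rewrite -subr_eq0 -normr_le0;
apply/ler_addgt0Pr => e e0; rewrite add0r.
have e2 : 0 < e / 2 by rewrite divr_gt0.
have : \forall x \near p, [/\ derivable f x u /\ derivable f x v,
   derivable ('D_u f) x v /\ derivable ('D_v f) x u,
   `|'D_v ('D_u f) p - 'D_v ('D_u f) x| <= e / 2 &
   `|'D_u ('D_v f) p - 'D_u ('D_v f) x| <= e / 2].
  have n1 : \forall x \near p, `|'D_v ('D_u f) p - 'D_v ('D_u f) x| <= e / 2.
    by move/cvgrPdist_le : c1; apply.
  have n2 : \forall x \near p, `|'D_u ('D_v f) p - 'D_u ('D_v f) x| <= e / 2.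
    by move/cvgrPdist_le : c2; apply.
  by apply: filterS (filterI (filterI d1 d2) (filterI n1 n2)) => x [[? ?] [? ?]].
case/nbhs_normP => d /= d0 Hd.
have uv1 : 0 < 1 + `|u| + `|v| by rewrite !ltr_wpDr.
have [h h0 hd] : exists2 h : R, 0 < h & h * (1 + `|u| + `|v|) < d.
  exists (d / 2 / (1 + `|u| + `|v|)); first by rewrite !divr_gt0.
  by rewrite divfK ?gt_eqF// ltr_pdivrMr// ltr_pMr// ltr1n.
have near_box (s t : R) : 0 <= s <= 1 -> 0 <= t <= 1 ->
    ball_ Num.norm p d (p + s *: (h *: u) + t *: (h *: v)).
  move=> /andP[s0 s1] /andP[t0 t1].
  rewrite /= -addrA opprD addNKr normrN.
  rewrite (le_lt_trans (ler_normD _ _))// !normrZ (ger0_norm s0) (ger0_norm t0).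
  rewrite (gtr0_norm h0) (le_lt_trans _ hd)//.
  rewrite mulrDr mulrDr mulr1 -addrA ler_wpDl ?(ltW h0)//.
  by rewrite lerD// ler_piMl// mulr_ge0// ltW.
have I0 : (0 <= 0 :> R) && (0 <= 1 :> R) by rewrite lexx ler01.
have I1 : (0 <= 1 :> R) && (1 <= 1 :> R) by rewrite ler01 lexx.
have swap (a b c d' : R) : a - b - (c - d') = a - c - (b - d') by ring.
have close (a b c : R) : `|a - c| <= e / 2 -> `|b - c| <= e / 2 -> `|a - b| <= e.
  by rewrite [`|b - c|]distrC [e in _ -> _ -> _ <= e]splitr => l1 l2;
    rewrite (le_trans (ler_distD c _ _))// lerD.
(* Apply the mean value theorem twice, in both orders, to the second
   difference over the parallelogram spanned by hu and hv. *)
have key w z :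
   (forall s t : R, 0 <= s <= 1 -> 0 <= t <= 1 ->
      let x := p + s *: (h *: w) + t *: (h *: z) in
      derivable f x w /\ derivable ('D_w f) x z) ->
   exists s t : R, [/\ 0 <= s <= 1, 0 <= t <= 1 &
     f (p + h *: w + h *: z) - f (p + h *: w) - (f (p + h *: z) - f p) =
     h * (h * 'D_z ('D_w f) (p + s *: (h *: w) + t *: (h *: z)))].
  move=> Hwz.
  pose g x := f (x + h *: z) - f x.
  have dg s : 0 <= s <= 1 -> is_derive (p + s *: (h *: w)) (h *: w) g
     (h * ('D_w f (p + s *: (h *: w) + h *: z) - 'D_w f (p + s *: (h *: w)))).
    move=> s01.
    have [a1 _] := Hwz s 1 s01 I1; have [a2 _] := Hwz s 0 s01 I0.
    rewrite scale1r in a1; rewrite scale0r addr0 in a2.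
    rewrite mulrBr.
    apply: (@is_deriveB _ _ _ (fun x => f (x + h *: z)) f).
      have := derive_dirZ h a1; set q := p + _; move=> [b1 b2].
      have E : (fun k : R => k^-1 *: (((fun x => f (x + h *: z)) \o shift q) (k *: (h *: w))
          - f (q + h *: z))) =
          (fun k => k^-1 *: ((f \o shift (q + h *: z)) (k *: (h *: w)) - f (q + h *: z))).
        by apply/funext => k /=; congr (_ *: (f _ - _)); exact/esym/addrA.
      by apply: DeriveDef; rewrite /derivable /derive E.
    exact: derive_dirZ.
  have [|s s01] := @MVT_line g p (h *: w).
    by move=> s /dg ds; exact: ex_derive.
  have /@derive_val -> := dg _ s01.
  rewrite /g => ->.
  have [|t t01] := @MVT_line ('D_w f) (p + s *: (h *: w)) (h *: z).
    move=> t t01; have [_ a] := Hwz s t s01 t01.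
    exact: (@ex_derive _ _ _ _ _ _ _ (derive_dirZ h a)).
  have [_ a] := Hwz s t s01 t01.
  have /@derive_val -> := derive_dirZ h a => ->.
  by exists s, t.
have [|s [t [s01 t01 E1]]] := key u v.
  move=> a b a01 b01 x; have [[A _] [B _] _ _] := Hd _ (near_box _ _ a01 b01).
  exact: (conj A B).
have [|s' [t' [s'01 t'01 E2]]] := key v u.
  move=> a b a01 b01 x.
  have [[_ A] [_ B] _ _] := Hd _ (near_box _ _ b01 a01).
  rewrite /x addrAC; exact: (conj A B).
have [_ _ l1 _] := Hd _ (near_box _ _ s01 t01).
have [_ _ _ l2] := Hd _ (near_box _ _ t'01 s'01).
have E : h * (h * 'D_v ('D_u f) (p + s *: (h *: u) + t *: (h *: v))) =
   h * (h * 'D_u ('D_v f) (p + s' *: (h *: v) + t' *: (h *: u))).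
  apply: etrans (esym E1) _; apply: etrans _ E2.
  rewrite [p + h *: v + h *: u]addrAC; exact: swap.
move/(mulfI (lt0r_neq0 h0))/(mulfI (lt0r_neq0 h0)): E => E.
rewrite [p + s' *: _ + _]addrAC in E; rewrite -E in l2.
exact: close l1 l2.
Qed.

(** No curve in the level set is built. From [p + h v], where [g] is o(h), the intermediate value
    theorem finds a correction [s w] with s = o(h) that returns to the zero set of [g]. There [f]
    vanishes, and comparing increments shows that [h] times the derivative of [f] along [v] is
    o(h). *)
Lemma level_set_derive f g p v w :
  (\forall x \near p, [/\ derivable f x v, derivable f x w, derivable g x v &
      derivable g x w]) ->
  {for p, continuous ('D_v f)} -> {for p, continuous ('D_w f)} ->
  {for p, continuous ('D_v g)} -> {for p, continuous ('D_w g)} ->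
  g p = 0 -> 'D_w g p != 0 -> 'D_v g p = 0 ->
  (\forall x \near p, g x = 0 -> f x = 0) -> 'D_v f p = 0.
Proof.
move=> df cfv cfw cgv cgw gp gw gv fg.
(* Rescaling [w] so that [g] has derivative 1 along it makes the increment of [g] along [s w] equal
   to [s] up to an error. *)
wlog gw1 : w df cfw cgw gw / 'D_w g p = 1 => [hw|].
  pose c := ('D_w g p)^-1.
  have dz : \forall x \near p, derivable f x w /\ derivable g x w.
    by apply: filterS df => x [].
  have scale_cont (k : V -> R) : (\forall x \near p, derivable k x w) ->
      {for p, continuous ('D_w k)} -> {for p, continuous ('D_(c *: w) k)}.
    move=> dk ck.
    have e : \forall x \near p, c * 'D_w k x = 'D_(c *: w) k x.
      by near=> x; apply/esym; apply: derive_val; apply: derive_dirZ; near: x.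
    rewrite /prop_for /continuous_at -(nbhs_singleton e).
    apply: cvg_trans; first by apply: near_eq_cvg; exact: e.
    by apply: cvgM; [exact: cvg_cst|exact: ck].
  apply: (hw (c *: w)).
  - apply: filterS df => x [a b cc d].
    have [b' _] := derive_dirZ c b; have [d' _] := derive_dirZ c d.
    by split; [exact: a|exact: b'|exact: cc|exact: d'].
  - by apply: scale_cont => //; apply: filterS dz => x [].
  - by apply: scale_cont => //; apply: filterS dz => x [].
  - have [_ dgp] := nbhs_singleton dz.
    by have /@derive_val -> := derive_dirZ c dgp; rewrite mulf_neq0// invr_eq0.
  - have [_ dgp] := nbhs_singleton dz.
    by have /@derive_val -> := derive_dirZ c dgp; rewrite mulVf.
have dfv : \forall x \near p, derivable f x v by apply: filterS df => x [].
have dfw : \forall x \near p, derivable f x w by apply: filterS df => x [].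
have dgv : \forall x \near p, derivable g x v by apply: filterS df => x [].
have dgw : \forall x \near p, derivable g x w by apply: filterS df => x [].
(* The total error is [e h] from the step along [v] plus [s1 (|D_w f p| + 1)] from the correction,
   with [s1 = 2 e h]; this is [h e C]. *)
pose C := 2 * (`|'D_w f p| + 1) + 1.
have C0 : 0 < C by rewrite ltr_wpDl// mulr_ge0// ltr_wpDl.
apply/eqP; rewrite -normr_le0; apply/ler_addgt0Pr => e' e'0; rewrite add0r.
pose e := Num.min (e' / C) (1 / 4).
have e0 : 0 < e by rewrite lt_min !divr_gt0.
have e4 : e <= 1 / 4 by rewrite ge_min lexx orbT.
have eC : e * C <= e' by rewrite -ler_pdivlMr// ge_min lexx.
have [d1 d10 H1] := C1_increment dfv cfv e0.
have [d2 d20 H2] := C1_increment dfw cfw e0.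
have [d3 d30 H3] := C1_increment dgv cgv e0.
have [d4 d40 H4] := C1_increment dgw cgw e0.
have /nbhs_normP[d5 /= d50 H5] : \forall x \near p, derivable g x w /\ (g x = 0 -> f x = 0).
  by near=> x; split; near: x; [exact: dgw|exact: fg].
pose d := Num.min d1 (Num.min d2 (Num.min d3 (Num.min d4 d5))).
have d0 : 0 < d by rewrite !lt_min d10 d20 d30 d40.
have [dd1 dd2 dd3 dd4 dd5] : [/\ d <= d1, d <= d2, d <= d3, d <= d4 & d <= d5].
  by split; rewrite !ge_min lexx ?orbT.
have vw1 : 0 < 1 + `|v| + `|w| by rewrite !ltr_wpDr.
have [h h0 hd] : exists2 h : R, 0 < h & h * (1 + `|v| + `|w|) < d.
  exists (d / 2 / (1 + `|v| + `|w|)); first by rewrite !divr_gt0.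
  by rewrite divfK ?gt_eqF// ltr_pdivrMr// ltr_pMr// ltr1n.
have hd1 : h < d.
  by rewrite (le_lt_trans _ hd)// ler_peMr ?(ltW h0)// -addrA lerDl addr_ge0.
have nr s : `|s| <= h -> ball_ Num.norm p d (p + h *: v + s *: w).
  move=> sh; rewrite /= -addrA opprD addNKr normrN (le_lt_trans _ hd)//.
  rewrite (le_trans (ler_normD _ _))// !normrZ (gtr0_norm h0) -addrA mulrDr mulrDr.
  by rewrite mulr1 ler_wpDl ?(ltW h0)// lerD// ler_wpM2r.
pose x0 := p + h *: v.
have x0d : `|x0 - p| < d.
  by have := nr 0; rewrite normr0 scale0r addr0 => /(_ (ltW h0)); rewrite /= distrC.
have g0 : `|g x0| <= e * h.
  have := H3 p h; rewrite subrr normr0 => /(_ d30).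
  by rewrite (gtr0_norm h0) gp gv mulr0 !subr0; apply; exact: lt_le_trans hd1 dd3.
(* Twice the bound on [g x0]: as [e <= 1/4], moving by [s1] or [- s1] along [w] outweighs both
   [g x0] and the error [e s1], so [g] changes sign. *)
pose s1 := 2 * (e * h).
have s10 : 0 < s1 by rewrite !mulr_gt0.
have s1h : s1 <= h.
  by rewrite /s1 mulrA -[X in _ <= X]mul1r ler_wpM2r ?(ltW h0)//; lra.
have G s : `|s| <= s1 -> `|g (x0 + s *: w) - g x0 - s| <= e * `|s|.
  move=> ss; have := H4 x0 s; rewrite gw1 mulr1; apply.
    exact: lt_le_trans x0d dd4.
  by apply: le_lt_trans ss _; apply: le_lt_trans s1h _; exact: lt_le_trans hd1 dd4.
have [||s] := @IVT _ (fun s : R => g (x0 + s *: w)) (- s1) s1 0 (ltW (gtrN s10)).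
- apply: derivable_within_continuous => s; rewrite in_itv /= -ler_norml => ss.
  have [dx _] := H5 _ (lt_le_trans (nr s (le_trans ss s1h)) dd5).
  by have [] := is_derive_line dx.
- have := G s1; rewrite (gtr0_norm s10) lexx => /(_ isT).
  have := G (- s1); rewrite normrN (gtr0_norm s10) lexx => /(_ isT).
  move: g0; rewrite !ler_norml => /andP[a1 a2] /andP[b1 b2] /andP[c1 c2].
  have es : e * s1 <= (1 / 4) * s1 by rewrite ler_wpM2r// ltW.
  have es1 : e * h = s1 / 2 by rewrite /s1 [2 * _]mulrC mulfK// pnatr_eq0.
  by rewrite ge_min le_max; apply/andP; split; apply/orP; [left|right]; lra.
rewrite in_itv /= -ler_norml => ss gs.
have [_ /(_ gs) fs] := H5 _ (lt_le_trans (nr s (le_trans ss s1h)) dd5).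
have F1 := H1 p h; rewrite subrr normr0 (gtr0_norm h0) in F1.
have {}F1 := F1 d10 (lt_le_trans hd1 dd1).
rewrite (nbhs_singleton fg gp) subr0 -/x0 in F1.
have := H2 x0 s (lt_le_trans x0d dd2).
have sd2 : `|s| < d2.
  by apply: le_lt_trans ss _; apply: le_lt_trans s1h _; exact: lt_le_trans hd1 dd2.
move=> /(_ sd2); rewrite fs sub0r => F2.
have hC : h * `|'D_v f p| <= h * (e * C).
  rewrite -[X in X * _ <= _](gtr0_norm h0) -normrM.
  have -> : h * 'D_v f p = (- (f x0 - h * 'D_v f p)) + (- (- f x0 - s * 'D_w f p)) - s * 'D_w f p.
    by ring.
  rewrite (le_trans (ler_normB _ _))//.
  have -> : h * (e * C) = e * h + s1 * (`|'D_w f p| + 1) by rewrite /s1 /C; ring.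
  rewrite normrM mulrDr mulr1 [s1 * _ + _]addrC addrA lerD//; last first.
    by rewrite ler_wpM2r.
  rewrite (le_trans (ler_normD _ _))// !normrN lerD// (le_trans F2)//.
  rewrite (le_trans (ler_wpM2l (ltW e0) ss))// ler_piMl ?(ltW s10)//.
  by rewrite (le_trans e4)//; lra.
by rewrite (le_trans _ eC)// -(ler_pM2l h0).
Unshelve. all: by end_near. Qed.
End Directional.

(** * Functions of class C^k and the chain rule *)

Section CkCalculus.
Variables (R : realType) (n : nat).
Implicit Types (U V : set (cspace R n)) (f g : cspace R n -> R) (k : nat)
  (p u v w : cspace R n).

(** Peels off the derivative that is taken first, which is the last entry of the list of directions,
    so that inductions on [k] can apply their hypothesis to ['D_v f]. *)
Lemma CkP k U f : Ck k.+1 U f <->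
  [/\ forall p, U p -> {for p, continuous f},
      forall p v, U p -> derivable f p v &
      forall v, Ck k U ('D_v f)].
Proof.
split=> [H|[cf df Df] vs].
  split=> [p Up|p v Up|v vs svs p Up].
  - by have [] := H [::] isT p Up.
  - by have [_] := H [::] isT p Up; apply.
  have := H (rcons vs v); rewrite size_rcons ltnS => /(_ svs p Up).
  by rewrite /iter_derive foldr_rcons ltnS.
case/lastP: vs => [_ p Up|vs v]; first by split; [exact: cf|move=> _ v; exact: df].
rewrite size_rcons !ltnS => svs p Up.
by have := Df v vs svs p Up; rewrite /iter_derive foldr_rcons.
Qed.

Lemma Ck0P U f : Ck 0 U f <-> forall p, U p -> {for p, continuous f}.
Proof.
split=> [H p Up|H [|//] _ p Up]; first by have [] := H [::] isT p Up.
by split; first exact: H.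
Qed.

Lemma Ck_le k l U f : (k <= l)%N -> Ck l U f -> Ck k U f.
Proof.
move=> kl H vs svs p Up.
have [c d] := H vs (leq_trans svs kl) p Up; split=> // s.
exact/d/(leq_trans s).
Qed.

Lemma Ck_continuous k U f p : Ck k U f -> U p -> {for p, continuous f}.
Proof. by move=> H Up; have [] := H [::] isT p Up. Qed.

Lemma Ck_derivable k U f p v : Ck k.+1 U f -> U p -> derivable f p v.
Proof. by move=> /CkP[_ H _] Up; exact: H. Qed.

Lemma Ck_derive k U f v : Ck k.+1 U f -> Ck k U ('D_v f).
Proof. by move=> /CkP[_ _]; apply. Qed.

Lemma Ck_sub k U V f : V `<=` U -> Ck k U f -> Ck k V f.
Proof. by move=> VU H vs svs p /VU; exact: H. Qed.

Lemma Ck_local k U f : (forall p, U p -> exists2 V, V p & Ck k V f) -> Ck k U f.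
Proof. by move=> H vs svs p /H[V Vp]; exact. Qed.

Lemma near_ext U f g p : open U -> U p -> (forall x, U x -> f x = g x) ->
  \forall x \near p, f x = g x.
Proof. by move=> oU Up e; apply: filterS (open_nbhs_nbhs (conj oU Up)). Qed.

Lemma derive_ext U f g p v : open U -> U p -> (forall x, U x -> f x = g x) ->
  'D_v f p = 'D_v g p.
Proof. by move=> oU Up e; apply: near_eq_derive; exact: near_ext e. Qed.

Lemma continuous_ext U f g p : open U -> U p -> (forall x, U x -> f x = g x) ->
  {for p, continuous f} -> {for p, continuous g}.
Proof.
move=> oU Up e cf; rewrite /prop_for /continuous_at -(e _ Up).
by apply: cvg_trans cf; apply: near_eq_cvg; exact: near_ext e.
Qed.

Lemma Ck_ext k U f g : open U -> (forall x, U x -> f x = g x) ->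
  Ck k U f -> Ck k U g.
Proof.
move=> oU; elim: k f g => [|k IH] f g e.
  by move=> /Ck0P H; apply/Ck0P => p Up; apply: continuous_ext e (H p Up).
move=> /CkP[cf df Df]; apply/CkP; split=> [p Up|p v Up|v].
- exact: continuous_ext e (cf p Up).
- apply: near_eq_derivable (df p v Up); exact: near_ext e.
- by apply: IH (Df v) => x Ux; exact: (@derive_ext U).
Qed.

Lemma Ck_cst k U (c : R) : Ck k U (fun=> c).
Proof.
elim: k c => [|k IH] c; first by apply/Ck0P => p _; exact: cst_continuous.
apply/CkP; split=> [p _|p v _|v]; [exact: cst_continuous|exact: derivable_cst|].
have -> : 'D_v (fun=> c) = (fun=> 0) :> (cspace R n -> R); last exact: IH.
by apply/funext => x; exact: derive_cst.
Qed.

Lemma CkD k U f g : open U -> Ck k U f -> Ck k U g -> Ck k U (fun x => f x + g x).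
Proof.
move=> oU; elim: k f g => [|k IH] f g.
  move=> /Ck0P cf /Ck0P cg; apply/Ck0P => p Up.
  by apply: continuousD; [exact: cf|exact: cg].
move=> /CkP[cf df Df] /CkP[cg dg Dg]; apply/CkP; split=> [p Up|p v Up|v].
- by apply: continuousD; [exact: cf|exact: cg].
- by apply: derivableD; [exact: df|exact: dg].
- apply: (Ck_ext oU _ (IH _ _ (Df v) (Dg v))) => x Ux.
  by rewrite (@deriveD _ _ _ f g); [|exact: df|exact: dg].
Qed.

Lemma CkM k U f g : open U -> Ck k U f -> Ck k U g -> Ck k U (fun x => f x * g x).
Proof.
move=> oU; elim: k f g => [|k IH] f g.
  move=> /Ck0P cf /Ck0P cg; apply/Ck0P => p Up.
  by apply: continuousM; [exact: cf|exact: cg].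
move=> Hf Hg; have lf := Ck_le (leqnSn k) Hf; have lg := Ck_le (leqnSn k) Hg.
move: Hf Hg => /CkP[cf df Df] /CkP[cg dg Dg]; apply/CkP; split=> [p Up|p v Up|v].
- by apply: continuousM; [exact: cf|exact: cg].
- by apply: derivableM; [exact: df|exact: dg].
- apply: (Ck_ext oU _ (CkD oU (IH _ _ lf (Dg v)) (IH _ _ lg (Df v)))) => x Ux.
  by rewrite (@deriveM _ _ f g); [|exact: df|exact: dg].
Qed.

Lemma CkZ k U (a : R) f : open U -> Ck k U f -> Ck k U (fun x => a * f x).
Proof. by move=> oU; apply: CkM => //; exact: Ck_cst. Qed.

Lemma CkN k U f : open U -> Ck k U f -> Ck k U (fun x => - f x).
Proof.
by move=> oU Hf; apply: (Ck_ext oU _ (CkZ (-1) oU Hf)) => x _; rewrite mulN1r.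
Qed.

Lemma CkB k U f g : open U -> Ck k U f -> Ck k U g -> Ck k U (fun x => f x - g x).
Proof. by move=> oU Hf Hg; apply: CkD; [exact: oU|exact: Hf|exact: CkN]. Qed.

Lemma Ck_sum k U I (r : seq I) (P : pred I) (F : I -> cspace R n -> R) :
  open U -> (forall i, P i -> Ck k U (F i)) -> Ck k U (fun x => \sum_(i <- r | P i) F i x).
Proof.
move=> oU H; elim: r => [|i r IH].
  by apply: (Ck_ext oU _ (@Ck_cst k U 0)) => x _; rewrite big_nil.
case Pi : (P i).
  by apply: (Ck_ext oU _ (CkD oU (H i Pi) IH)) => x _; rewrite big_cons Pi.
by apply: (Ck_ext oU _ IH) => x _; rewrite big_cons Pi.
Qed.

Lemma is_derive_affine f p v (l : R) : (forall h, f (p + h *: v) = f p + h * l) ->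
  is_derive p v f l.
Proof.
move=> E; apply: is_derive_increment => e e0; exists 1 => // h _.
by rewrite E addrAC addrK subrr normr0 mulr_ge0// ltW.
Qed.

Lemma Ck_affine k U f (l : cspace R n -> R) : open U -> continuous f ->
  (forall p v h, f (p + h *: v) = f p + h * l v) -> Ck k U f.
Proof.
move=> oU cf E; case: k => [|k]; first by apply/Ck0P => p _; exact: cf.
have dE p v := is_derive_affine (E p v).
apply/CkP; split=> [p _|p v _|v]; [exact: cf|by have [] := dE p v|].
by apply: (Ck_ext oU _ (@Ck_cst k U (l v))) => x _; have [_ <-] := dE x v.
Qed.

Lemma continuous_coord1 j : continuous (fun x : cspace R n => x.1 0 j).
Proof.
move=> p; apply: (@continuous_comp _ _ _ fst (fun y : 'rV[R]_n => y 0 j)).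
  exact: cvg_fst.
exact: coord_continuous.
Qed.

Lemma continuous_coord2 j : continuous (fun x : cspace R n => x.2 0 j).
Proof.
move=> p; apply: (@continuous_comp _ _ _ snd (fun y : 'rV[R]_n => y 0 j)).
  exact: cvg_snd.
exact: coord_continuous.
Qed.

Lemma Ck_coord1 k U j : open U -> Ck k U (fun x => x.1 0 j).
Proof.
move=> oU; apply: (@Ck_affine _ _ _ (fun v => v.1 0 j)) => //.
  exact: continuous_coord1.
by move=> p v h; rewrite /= !mxE.
Qed.

Lemma Ck_coord2 k U j : open U -> Ck k U (fun x => x.2 0 j).
Proof.
move=> oU; apply: (@Ck_affine _ _ _ (fun v => v.2 0 j)) => //.
  exact: continuous_coord2.
by move=> p v h; rewrite /= !mxE.
Qed.

Lemma Ck1_deriveD U f p u v : open U -> Ck 1 U f -> U p ->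
  'D_(u + v) f p = 'D_u f p + 'D_v f p.
Proof.
move=> oU /CkP[cf df Df] Up; apply: derive_val; apply: derive_dirD.
- by apply: filterS (open_nbhs_nbhs (conj oU Up)) => x; exact: df.
- by move: (Df v) => /Ck0P; exact.
- exact: df.
Qed.

Lemma Ck1_deriveZ U f p v (a : R) : Ck 1 U f -> U p ->
  'D_(a *: v) f p = a * 'D_v f p.
Proof.
move=> /CkP[cf df Df] Up; apply: derive_val; apply: derive_dirZ.
exact: df.
Qed.

Lemma Ck1_derive_sum U f p I (r : seq I) (P : pred I) (v : I -> cspace R n) :
  open U -> Ck 1 U f -> U p ->
  'D_(\sum_(i <- r | P i) v i) f p = \sum_(i <- r | P i) 'D_(v i) f p.
Proof.
move=> oU Hf Up; apply: (big_morph (fun v => 'D_v f p)).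
  by move=> x y; exact: Ck1_deriveD Hf Up.
exact: derive0.
Qed.

Lemma Ck2_derive_sym U f p u v : open U -> Ck 2 U f -> U p ->
  'D_v ('D_u f) p = 'D_u ('D_v f) p.
Proof.
move=> oU Hf Up; have Ux := open_nbhs_nbhs (conj oU Up).
have [cf df Df] := (CkP _ _ _).1 Hf.
have D2 w : forall x z, U x -> derivable ('D_w f) x z.
  by move=> x z; apply: Ck_derivable (Df w).
have C2 w z : {for p, continuous ('D_z ('D_w f))}.
  by apply: Ck_continuous Up; exact: Ck_derive (Df w).
apply: derive_sym; [| |exact: C2|exact: C2].
  by apply: filterS Ux => x Ux; split; exact: df.
by apply: filterS Ux => x Ux; split; exact: D2.
Qed.

Lemma Ck1_level_set_derive U f g p v : open U -> Ck 1 U f -> Ck 1 U g -> U p ->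
  g p = 0 -> (exists w, 'D_w g p != 0) -> 'D_v g p = 0 ->
  (forall x, U x -> g x = 0 -> f x = 0) -> 'D_v f p = 0.
Proof.
move=> oU Hf Hg Up gp [w gw] gv fg; have Ux := open_nbhs_nbhs (conj oU Up).
have [_ df Df] := (CkP _ _ _).1 Hf; have [_ dg Dg] := (CkP _ _ _).1 Hg.
apply: (level_set_derive _ _ _ _ _ gp gw gv).
- by apply: filterS Ux => x Ux; split; [exact: df|exact: df|exact: dg|exact: dg].
- by move: (Df v) => /Ck0P; exact.
- by move: (Df w) => /Ck0P; exact.
- by move: (Dg v) => /Ck0P; exact.
- by move: (Dg w) => /Ck0P; exact.
- by apply: filterS Ux.
Qed.

Lemma is_derive_of_line f p v (l : R) :
  is_derive (0 : R) 1 (fun t : R => f (p + t *: v)) l -> is_derive p v f l.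
Proof.
move=> [dg <-]; apply: is_derive_increment => e e0.
have [d d0 Hd] := derive_increment dg e0; exists d => // h hd.
have := Hd h hd; rewrite add0r.
by rewrite [h *: (1 : R)]mulr1 scale0r addr0.
Qed.

Lemma is_derive_compR (c : R -> R) f p v (l : R) :
  derivable f p v -> is_derive (f p) 1 c l ->
  is_derive p v (fun x => c (f x)) (l * 'D_v f p).
Proof.
move=> df dc.
have df' : derivable f (p + 0 *: v) v by rewrite scale0r addr0.
have := is_derive_line df'; rewrite scale0r addr0 => -[g1 g2].
have c1 : derivable c (f (p + 0 *: v)) 1 by rewrite scale0r addr0; case: dc.
apply: is_derive_of_line; apply: (@DeriveDef _ _ _ (0 : R) 1 (c \o (fun t : R => f (p + t *: v)))).
  apply/derivable1_diffP/differentiable_comp; first exact/derivable1_diffP.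
  exact/derivable1_diffP.
rewrite -derive1E (derive1_comp g1 c1) !derive1E g2 scale0r addr0.
by case: dc => _ ->.
Qed.

Lemma derive_compR (c c1 : R -> R) U f p v : (forall s : R, is_derive s 1 c (c1 s)) ->
  Ck 1 U f -> U p -> 'D_v (fun x => c (f x)) p = c1 (f p) * 'D_v f p.
Proof.
move=> dc Hf Up; have df := Ck_derivable (v := v) Hf Up.
by have [_] := is_derive_compR df (dc (f p)).
Qed.

Lemma Ck0_comp (c : R -> R) U f : continuous c -> Ck 0 U f -> Ck 0 U (fun x => c (f x)).
Proof.
move=> cc Hf; apply/Ck0P => p Up; apply: (@continuous_comp _ _ _ f c); last exact: cc.
exact: Ck_continuous Hf Up.
Qed.

Lemma CkS_comp k (c c1 : R -> R) U f : open U -> (forall s : R, is_derive s 1 c (c1 s)) ->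
  Ck k.+1 U f -> Ck k U (fun x => c1 (f x)) -> Ck k.+1 U (fun x => c (f x)).
Proof.
move=> oU dc Hf H1; have Hf1 : Ck 1 U f by exact: Ck_le Hf.
have cc : continuous c.
  move=> s; apply: differentiable_continuous; apply/derivable1_diffP.
  by case: (dc s).
apply/CkP; split=> [p Up|p w Up|w].
- by have /Ck0P := Ck0_comp cc (Ck_le (leq0n _) Hf); apply.
- by have [] := is_derive_compR (Ck_derivable (v := w) Hf1 Up) (dc (f p)).
- apply: (Ck_ext oU _ (CkM oU H1 (Ck_derive w Hf))) => x Ux.
  by rewrite (derive_compR _ dc Hf1 Ux).
Qed.

Lemma Ck1_comp (c c1 : R -> R) U f : open U -> (forall s : R, is_derive s 1 c (c1 s)) ->
  continuous c1 -> Ck 1 U f -> Ck 1 U (fun x => c (f x)).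
Proof.
move=> oU dc cc1 Hf; apply: (CkS_comp oU dc Hf).
exact: Ck0_comp cc1 (Ck_le (leq0n _) Hf).
Qed.

Lemma Ck2_comp (c c1 c2 : R -> R) U f : open U -> (forall s : R, is_derive s 1 c (c1 s)) ->
  (forall s : R, is_derive s 1 c1 (c2 s)) -> continuous c2 ->
  Ck 2 U f -> Ck 2 U (fun x => c (f x)).
Proof.
move=> oU dc dc1 cc2 Hf; apply: (CkS_comp oU dc Hf).
exact: Ck1_comp oU dc1 cc2 (Ck_le (leqnSn 1) Hf).
Qed.

End CkCalculus.

(** * A C^2 regularisation of the positive part *)

Section PositivePart.
Variable R : realType.
Implicit Types s h : R.

Definition pos_part s : R := Num.max 0 s.

Lemma pos_part_ge0 s : 0 <= pos_part s.
Proof. by rewrite /pos_part le_max lexx. Qed.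

Lemma pos_part_id s : 0 <= s -> pos_part s = s.
Proof. by move=> s0; rewrite /pos_part max_r. Qed.

Lemma pos_part_eq0 s : s <= 0 -> pos_part s = 0.
Proof. by move=> s0; rewrite /pos_part max_l. Qed.

Lemma continuous_pos_part : continuous pos_part.
Proof.
move=> s; apply: (@continuous_max _ _ (fun=> 0) id) => //; exact: cst_continuous.
Qed.

Lemma is_derive_pos_part2 s : is_derive s 1 (fun s => pos_part s ^+ 2) (2 * pos_part s).
Proof.
apply: is_derive_increment => e e0; exists e => // h he.
rewrite [h *: (1 : R)]mulr1.
apply: (@le_trans _ _ (`|h| * `|h|)); last by rewrite ler_wpM2r// ltW.
rewrite -normrM [X in _ <= X]ger0_norm ?sqr_ge0// ler_norml.
have [s0|s0] := leP 0 s; have [t0|t0] := leP 0 (s + h);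
  rewrite ?(pos_part_id s0) ?(pos_part_id t0) ?(pos_part_eq0 (ltW s0))
    ?(pos_part_eq0 (ltW t0)); apply/andP; split; nra.
Qed.

(** The cube of [pos_part], written with a factor [s] so that the product rule meets two
    differentiable factors. *)
Definition pos_cube s : R := s * pos_part s ^+ 2.

Lemma pos_cubeE s : pos_cube s = pos_part s ^+ 3.
Proof.
rewrite /pos_cube; have [s0|s0] := leP 0 s.
  by rewrite pos_part_id// exprS.
by rewrite pos_part_eq0 ?ltW// !expr0n mulr0.
Qed.

Lemma is_derive_pos_cube s : is_derive s 1 pos_cube (3 * pos_part s ^+ 2).
Proof.
have dp := is_derive_pos_part2 s.
apply: (@is_derive_eq _ _ _ _ _ _ _ _ (is_deriveM (is_derive_id s 1) dp)).
rewrite /GRing.scale /=; have [s0|s0] := leP 0 s.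
  by rewrite pos_part_id//; ring.
by rewrite pos_part_eq0 ?ltW//; ring.
Qed.

Lemma is_derive_pos_cube1 s : is_derive s 1 (fun s => 3 * pos_part s ^+ 2) (6 * pos_part s).
Proof.
have dp := is_derive_pos_part2 s.
apply: (@is_derive_eq _ _ _ _ _ _ _ _ (is_deriveZ 3 dp)).
by rewrite /GRing.scale /=; ring.
Qed.

(* A C^2 regularisation of [pos_part]: its second derivative is a hat function
   supported in [-1, 1]. *)
Definition smooth_pos s : R := (pos_cube (s + 1) - 2 * pos_cube s + pos_cube (s - 1)) / 6.

Definition smooth_pos1 s : R :=
  (pos_part (s + 1) ^+ 2 - 2 * pos_part s ^+ 2 + pos_part (s - 1) ^+ 2) / 2.

Definition smooth_pos2 s : R :=
  pos_part (s + 1) - 2 * pos_part s + pos_part (s - 1).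

Lemma is_derive_shift1 (f : R -> R) s a l :
  is_derive (s + a) 1 f l -> is_derive s 1 (fun s => f (s + a)) l.
Proof.
move=> [d <-]; apply: is_derive_increment => e e0.
have [b b0 Hb] := derive_increment d e0; exists b => // h /Hb.
by rewrite [s + a + _]addrAC.
Qed.

Lemma is_derive_smooth_pos s : is_derive s 1 smooth_pos (smooth_pos1 s).
Proof.
have d1 := is_derive_shift1 (is_derive_pos_cube (s + 1)).
have d2 := is_derive_pos_cube s.
have d3 := is_derive_shift1 (is_derive_pos_cube (s - 1)).
have -> : smooth_pos = (6^-1 *: ((fun s => pos_cube (s + 1)) - 2 *: pos_cube +
    (fun s => pos_cube (s - 1)))).
  by apply/funext => x; rewrite /smooth_pos mulrC.
apply: (@is_derive_eq _ _ _ _ _ _ _ _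
  (is_deriveZ 6^-1 (is_deriveD (is_deriveB d1 (is_deriveZ 2 d2)) d3))).
by rewrite /GRing.scale /= /smooth_pos1; field.
Qed.

Lemma is_derive_smooth_pos1 s : is_derive s 1 smooth_pos1 (smooth_pos2 s).
Proof.
have d1 := is_derive_shift1 (is_derive_pos_part2 (s + 1)).
have d2 := is_derive_pos_part2 s.
have d3 := is_derive_shift1 (is_derive_pos_part2 (s - 1)).
have -> : smooth_pos1 = (2^-1 *: ((fun s => pos_part (s + 1) ^+ 2) -
    2 *: (fun s => pos_part s ^+ 2) + (fun s => pos_part (s - 1) ^+ 2))).
  by apply/funext => x; rewrite /smooth_pos1 mulrC.
apply: (@is_derive_eq _ _ _ _ _ _ _ _
  (is_deriveZ 2^-1 (is_deriveD (is_deriveB d1 (is_deriveZ 2 d2)) d3))).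
by rewrite /GRing.scale /= /smooth_pos2; field.
Qed.

Lemma continuous_smooth_pos2 : continuous smooth_pos2.
Proof.
have sh (a : R) : continuous (fun s => pos_part (s + a)).
  move=> s; apply: (@continuous_comp _ _ _ (fun s => s + a) pos_part).
    by apply: continuousD => //; exact: cst_continuous.
  exact: continuous_pos_part.
have s2 : continuous (fun s => 2 * pos_part s).
  move=> s; apply: (@continuousM _ _ (fun=> 2) pos_part); first exact: cst_continuous.
  exact: continuous_pos_part.
move=> s; apply: (@continuousD _ _ _ (fun s => pos_part (s + 1) - 2 * pos_part s)
  (fun s => pos_part (s - 1))); last exact: sh.
by apply: (@continuousB _ _ _ (fun s => pos_part (s + 1))); [exact: sh|exact: s2].
Qed.

(** These facts make [f + smooth_pos (g - f)] a regularised maximum: it is the larger of [f] and [g]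
    where they differ by at least 1, and its Hessian is a convex combination of theirs plus a
    nonnegative term. *)
Lemma smooth_pos_bounds s :
  [/\ 0 <= smooth_pos s <= pos_part s + 1, 0 <= smooth_pos1 s <= 1,
      0 <= smooth_pos2 s, s <= -1 -> smooth_pos s = 0 & 1 <= s -> smooth_pos s = s].
Proof.
rewrite /smooth_pos /smooth_pos1 /smooth_pos2 !pos_cubeE.
have [a|a] := leP s (-1).
  rewrite !pos_part_eq0 ?expr0n /=; [|lra..].
  by split=> //; try (apply/andP; split); lra.
have [b|b] := leP s 0.
  rewrite (@pos_part_id (s + 1)) ?(@pos_part_eq0 s) ?(@pos_part_eq0 (s - 1)) ?expr0n /=;
    [|lra..].
  have t0 : 0 < s + 1 by lra.
  have t1 : s + 1 <= 1 by lra.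
  have := exprn_ge0 3 (ltW t0); have := exprn_ge0 2 (ltW t0).
  have := exprn_ile1 3 (ltW t0) t1; have := exprn_ile1 2 (ltW t0) t1.
  set t2 := _ ^+ 2; set t3 := _ ^+ 3 => *.
  by split=> //; try (apply/andP; split); lra.
have [c|c] := leP s 1.
  rewrite (@pos_part_id (s + 1)) ?(@pos_part_id s) ?(@pos_part_eq0 (s - 1)) ?expr0n /=;
    [|lra..].
  have := exprn_ge0 3 (ltW b); have := exprn_ge0 2 (ltW b).
  have := exprn_ile1 3 (ltW b) c; have := exprn_ile1 2 (ltW b) c.
  have -> : (s + 1) ^+ 3 = s ^+ 3 + 3 * s ^+ 2 + 3 * s + 1 by ring.
  have -> : (s + 1) ^+ 2 = s ^+ 2 + 2 * s + 1 by ring.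
  have := sqr_ge0 (1 - s); have -> : (1 - s) ^+ 2 = s ^+ 2 - 2 * s + 1 by ring.
  have E : 1 <= s -> s ^+ 3 = 1 by move=> s1; rewrite (_ : s = 1) ?expr1n//; lra.
  move: E; set t2 := s ^+ 2; set t3 := s ^+ 3 => E *.
  by split=> //; try (apply/andP; split); try lra; move=> s1; have := E s1; lra.
rewrite !pos_part_id; [|lra..].
have -> : ((s + 1) ^+ 3 - 2 * s ^+ 3 + (s - 1) ^+ 3) / 6 = s by field.
have -> : ((s + 1) ^+ 2 - 2 * s ^+ 2 + (s - 1) ^+ 2) / 2 = 1 by field.
by split=> //; try (apply/andP; split); lra.
Qed.

End PositivePart.

(** * Wirtinger calculus *)

Section ComplexNumbers.
Variable R : realType.
Implicit Types x y : R[i].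

Lemma ReD x y : complex.Re (x + y) = complex.Re x + complex.Re y.
Proof. by case: x; case: y. Qed.

Lemma ImD x y : complex.Im (x + y) = complex.Im x + complex.Im y.
Proof. by case: x; case: y. Qed.

Lemma ReM x y :
  complex.Re (x * y) = complex.Re x * complex.Re y - complex.Im x * complex.Im y.
Proof. by case: x; case: y. Qed.

Lemma ImM x y :
  complex.Im (x * y) = complex.Re x * complex.Im y + complex.Im x * complex.Re y.
Proof. by case: x => a b; case: y. Qed.

Lemma eq_complexP x y :
  complex.Re x = complex.Re y -> complex.Im x = complex.Im y -> x = y.
Proof. by case: x => a b; case: y => c d /= -> ->. Qed.

Lemma conjcD x y : (x + y)^*%C = x^*%C + y^*%C.
Proof. by case: x => a b; case: y => c d; apply: eq_complexP => //=; rewrite opprD. Qed.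

Lemma conjcM x y : (x * y)^*%C = x^*%C * y^*%C.
Proof.
by case: x => a b; case: y => c d; apply: eq_complexP => /=;
  rewrite ?mulrNN// mulrN mulNr opprD.
Qed.

Lemma conjc_sum I (r : seq I) (P : pred I) (F : I -> R[i]) :
  (\sum_(i <- r | P i) F i)^*%C = \sum_(i <- r | P i) (F i)^*%C.
Proof. by apply: (big_morph _ conjcD); rewrite conjc0. Qed.

Lemma conjc_half : (2^-1 : R[i])^*%C = 2^-1.
Proof. by rewrite conjc_inv conjc_nat. Qed.

End ComplexNumbers.

Section ComplexCalculus.
Variables (R : realType) (n : nat).
Local Notation C := R[i].
Implicit Types (U : set (cspace R n)) (p u v : cspace R n) (F G : cspace R n -> C)
  (f g : cspace R n -> R) (X Y : cspace R n -> covec R n) (k : nat).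

Definition cCk k U F : Prop :=
  Ck k U (fun x => complex.Re (F x)) /\ Ck k U (fun x => complex.Im (F x)).

Lemma csmoothP U F : csmooth U F <-> forall k, cCk k U F.
Proof.
split=> [[a b] k|H]; first by split; [exact: a|exact: b].
by split=> k; have [a b] := H k; [exact: a|exact: b].
Qed.

Lemma derive_add U f g p v : Ck 1 U f -> Ck 1 U g -> U p ->
  'D_v (fun x => f x + g x) p = 'D_v f p + 'D_v g p.
Proof.
move=> Hf Hg Up; apply: (@deriveD _ _ _ f g).
  exact: (Ck_derivable Hf Up).
exact: (Ck_derivable Hg Up).
Qed.

Lemma derive_opp U f p v : Ck 1 U f -> U p -> 'D_v (fun x => - f x) p = - 'D_v f p.
Proof. by move=> Hf Up; apply: (@deriveN _ _ _ f); exact: (Ck_derivable Hf Up). Qed.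

Lemma derive_mul U f g p v : Ck 1 U f -> Ck 1 U g -> U p ->
  'D_v (fun x => f x * g x) p = f p * 'D_v g p + g p * 'D_v f p.
Proof.
move=> Hf Hg Up; apply: (@deriveM _ _ f g).
  exact: (Ck_derivable Hf Up).
exact: (Ck_derivable Hg Up).
Qed.

Lemma cCk_le k l U F : (k <= l)%N -> cCk l U F -> cCk k U F.
Proof. by move=> kl [a b]; split; exact: Ck_le kl _. Qed.

Lemma cCk_sub k U V F : V `<=` U -> cCk k U F -> cCk k V F.
Proof. by move=> VU [a b]; split; exact: Ck_sub VU _. Qed.

Lemma cCk_ext k U F G : open U -> (forall x, U x -> F x = G x) -> cCk k U F -> cCk k U G.
Proof.
move=> oU e [a b].
by split; [apply: (Ck_ext oU _ a)|apply: (Ck_ext oU _ b)] => x Ux; rewrite e.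
Qed.

Lemma cCk_cst k U (c : C) : cCk k U (fun=> c).
Proof. by split; exact: Ck_cst. Qed.

Lemma cCk_cplx k U f : Ck k U f -> cCk k U (cplx f).
Proof. by move=> H; split; [exact: H|exact: Ck_cst]. Qed.

Lemma cplx_conj f x : (cplx f x)^*%C = cplx f x.
Proof. by apply: eq_complexP => //=; rewrite oppr0. Qed.

Lemma cCkD k U F G : open U -> cCk k U F -> cCk k U G -> cCk k U (fun x => F x + G x).
Proof.
move=> oU [a b] [c d]; split.
  by apply: (Ck_ext oU _ (CkD oU a c)) => x _; rewrite ReD.
by apply: (Ck_ext oU _ (CkD oU b d)) => x _; rewrite ImD.
Qed.

Lemma cCkM k U F G : open U -> cCk k U F -> cCk k U G -> cCk k U (fun x => F x * G x).
Proof.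
move=> oU [a b] [c d]; split.
  by apply: (Ck_ext oU _ (CkB oU (CkM oU a c) (CkM oU b d))) => x _; rewrite ReM.
by apply: (Ck_ext oU _ (CkD oU (CkM oU a d) (CkM oU b c))) => x _; rewrite ImM.
Qed.

Lemma cCkZ k U (c : C) F : open U -> cCk k U F -> cCk k U (fun x => c * F x).
Proof. by move=> oU; apply: cCkM => //; exact: cCk_cst. Qed.

Lemma cCkB k U F G : open U -> cCk k U F -> cCk k U G -> cCk k U (fun x => F x - G x).
Proof.
move=> oU HF HG; apply: (cCk_ext oU _ (cCkD oU HF (cCkZ (-1) oU HG))) => x _.
by rewrite mulN1r.
Qed.

Lemma cCk_conj k U F : open U -> cCk k U F -> cCk k U (fun x => (F x)^*%C).
Proof.
move=> oU [a b]; split.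
  by apply: (Ck_ext oU _ a) => x _; case: (F x).
by apply: (Ck_ext oU _ (CkN oU b)) => x _; case: (F x).
Qed.

Lemma cCk_sum k U I (r : seq I) (P : pred I) (F : I -> cspace R n -> C) : open U ->
  (forall i, P i -> cCk k U (F i)) -> cCk k U (fun x => \sum_(i <- r | P i) F i x).
Proof.
move=> oU H; elim: r => [|i r IH].
  by apply: (cCk_ext oU _ (@cCk_cst k U 0)) => x _; rewrite big_nil.
case Pi : (P i).
  by apply: (cCk_ext oU _ (cCkD oU (H i Pi) IH)) => x _; rewrite big_cons Pi.
by apply: (cCk_ext oU _ IH) => x _; rewrite big_cons Pi.
Qed.

Lemma cCk_cderive k U F v : cCk k.+1 U F -> cCk k U (cderive v F).
Proof. by move=> [a b]; split; [exact: (Ck_derive v a)|exact: (Ck_derive v b)]. Qed.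

Lemma cderive_ext U F G p v : open U -> U p -> (forall x, U x -> F x = G x) ->
  cderive v F p = cderive v G p.
Proof.
by move=> oU Up e; apply: eq_complexP => /=; apply: derive_ext oU Up _ => x Ux;
  rewrite e.
Qed.

Lemma cderive_cst p v (c : C) : cderive v (fun=> c) p = 0.
Proof. by apply: eq_complexP; exact: derive_cst. Qed.

Lemma cderive_cplx p v f : cderive v (cplx f) p = ('D_v f p)%:C%C.
Proof. by apply: eq_complexP => //=; exact: derive_cst. Qed.

Lemma cderiveD U F G p v : open U -> cCk 1 U F -> cCk 1 U G -> U p ->
  cderive v (fun x => F x + G x) p = cderive v F p + cderive v G p.
Proof.
move=> oU [a b] [c d] Up; apply: eq_complexP; rewrite ?ReD ?ImD /=.
  rewrite -(derive_add v a c Up).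
  by apply: derive_ext oU Up _ => x _; rewrite ReD.
rewrite -(derive_add v b d Up).
by apply: derive_ext oU Up _ => x _; rewrite ImD.
Qed.

Lemma cderiveM U F G p v : open U -> cCk 1 U F -> cCk 1 U G -> U p ->
  cderive v (fun x => F x * G x) p = F p * cderive v G p + cderive v F p * G p.
Proof.
move=> oU [a b] [c d] Up.
apply: eq_complexP; rewrite ?ReD ?ImD ?ReM ?ImM /=.
  rewrite (derive_ext v oU Up (fun x _ => ReM (F x) (G x))).
  rewrite (derive_add v (CkM oU a c) (CkN oU (CkM oU b d)) Up).
  rewrite (derive_opp v (CkM oU b d) Up) (derive_mul v a c Up) (derive_mul v b d Up).
  by ring.
rewrite (derive_ext v oU Up (fun x _ => ImM (F x) (G x))).
rewrite (derive_add v (CkM oU a d) (CkM oU b c) Up).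
rewrite (derive_mul v a d Up) (derive_mul v b c Up).
by ring.
Qed.

Lemma cderiveZ U (c : C) F p v : open U -> cCk 1 U F -> U p ->
  cderive v (fun x => c * F x) p = c * cderive v F p.
Proof.
move=> oU HF Up; rewrite (cderiveM v oU (cCk_cst _ _ c) HF Up).
by rewrite cderive_cst mul0r addr0.
Qed.

Lemma cderive_conj U F p v : open U -> cCk 1 U F -> U p ->
  cderive v (fun x => (F x)^*%C) p = (cderive v F p)^*%C.
Proof.
move=> oU [a b] Up; apply: eq_complexP => /=.
  by apply: derive_ext oU Up _ => x _; case: (F x).
rewrite -(derive_opp v b Up).
by apply: derive_ext oU Up _ => x _; case: (F x).
Qed.

Lemma cderive_sym U F p u v : open U -> cCk 2 U F -> U p ->
  cderive v (cderive u F) p = cderive u (cderive v F) p.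
Proof.
by move=> oU [a b] Up; apply: eq_complexP; apply: Ck2_derive_sym oU _ Up.
Qed.

(* The Wirtinger derivatives: [(true, j)] stands for d/dz_j and [(false, j)] for
   d/dzbar_j. *)
Definition wirtinger (a : bool * 'I_n) F p : C :=
  if a.1 then d_dz a.2 F p else d_dzbar a.2 F p.

Definition coef (X : covec R n) (a : bool * 'I_n) : C :=
  if a.1 then X.1 0 a.2 else X.2 0 a.2.

Lemma wirtingerE a F p : wirtinger a F p =
  2^-1 * (d_dx a.2 F p + (if a.1 then - 'i%C else 'i%C) * d_dy a.2 F p).
Proof.
by case: a => [[] j]; rewrite /wirtinger /d_dz /d_dzbar /= mulrC ?mulNr.
Qed.

Lemma vapplyE (X : covec R n) F p : vapply X F p = \sum_a coef X a * wirtinger a F p.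
Proof.
rewrite /vapply -(pair_bigA _ (fun b j => coef X (b, j) * wirtinger (b, j) F p)) /=.
by rewrite big_bool /= big_split.
Qed.

Lemma pairingE (w X : covec R n) : pairing w X = \sum_a coef w a * coef X a.
Proof.
rewrite /pairing -(pair_bigA _ (fun b j => coef w (b, j) * coef X (b, j))) /=.
by rewrite big_bool /= big_split.
Qed.

Lemma coef_bracket X Y p a : coef (bracket X Y p) a =
  fapply X (fun x => coef (Y x) a) p - fapply Y (fun x => coef (X x) a) p.
Proof. by case: a => [[] j]; rewrite /coef /= mxE. Qed.

Lemma cCk_wirtinger k U a F : open U -> cCk k.+1 U F -> cCk k U (wirtinger a F).
Proof.
move=> oU HF; apply: (cCk_ext oU _ (cCkZ (2^-1) oU (cCkD oU
  (cCk_cderive (delta_mx 0 a.2, 0) HF)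
  (cCkZ (if a.1 then - 'i%C else 'i%C) oU (cCk_cderive (0, delta_mx 0 a.2) HF))))).
by move=> x _; rewrite wirtingerE.
Qed.

Lemma wirtinger_ext U a F G p : open U -> U p -> (forall x, U x -> F x = G x) ->
  wirtinger a F p = wirtinger a G p.
Proof.
by move=> oU Up e; rewrite !wirtingerE; congr (_ * (_ + _ * _));
  exact: cderive_ext oU Up e.
Qed.

Lemma wirtingerD U a F G p : open U -> cCk 1 U F -> cCk 1 U G -> U p ->
  wirtinger a (fun x => F x + G x) p = wirtinger a F p + wirtinger a G p.
Proof.
move=> oU HF HG Up; rewrite !wirtingerE /d_dx /d_dy !(cderiveD _ oU HF HG Up).
have aux (h s x y z t : C) : h * (x + y + s * (z + t)) = h * (x + s * z) + h * (y + s * t).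
  by ring.
exact: aux.
Qed.

Lemma wirtingerM U a F G p : open U -> cCk 1 U F -> cCk 1 U G -> U p ->
  wirtinger a (fun x => F x * G x) p = F p * wirtinger a G p + wirtinger a F p * G p.
Proof.
move=> oU HF HG Up; rewrite !wirtingerE /d_dx /d_dy !(cderiveM _ oU HF HG Up).
have aux (h s b c x y z t : C) : h * (b * x + y * c + s * (b * z + t * c)) =
  b * (h * (x + s * z)) + h * (y + s * t) * c by ring.
exact: aux.
Qed.

Lemma wirtinger_cst a p (c : C) : wirtinger a (fun=> c) p = 0.
Proof. by rewrite wirtingerE /d_dx /d_dy !cderive_cst mulr0 addr0 mulr0. Qed.

Lemma wirtingerZ U a (c : C) F p : open U -> cCk 1 U F -> U p ->
  wirtinger a (fun x => c * F x) p = c * wirtinger a F p.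
Proof.
move=> oU HF Up; rewrite (wirtingerM a oU (cCk_cst _ _ c) HF Up).
by rewrite wirtinger_cst mul0r addr0.
Qed.

Lemma wirtinger_conj U a F p : open U -> cCk 1 U F -> U p ->
  wirtinger a (fun x => (F x)^*%C) p = (wirtinger (~~ a.1, a.2) F p)^*%C.
Proof.
move=> oU HF Up; rewrite !wirtingerE /d_dx /d_dy !(cderive_conj _ oU HF Up).
rewrite conjcM conjcD conjcM conjc_half; congr (_ * (_ + _ * _)).
by case: a.1; apply: eq_complexP => /=; rewrite ?opprK ?oppr0.
Qed.

Lemma wirtinger_cplx_conj U a f p : open U -> Ck 1 U f -> U p ->
  (wirtinger a (cplx f) p)^*%C = wirtinger (~~ a.1, a.2) (cplx f) p.
Proof.
case: a => b j oU Hf Up.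
have := @wirtinger_conj U (~~ b, j) (cplx f) p oU (cCk_cplx Hf) Up.
rewrite [(_, _).1]/= [(_, _).2]/= negbK => <-.
by apply: (wirtinger_ext _ oU Up) => x _; rewrite cplx_conj.
Qed.

Lemma wirtinger_sym U a b F p : open U -> cCk 2 U F -> U p ->
  wirtinger a (wirtinger b F) p = wirtinger b (wirtinger a F) p.
Proof.
move=> oU HF Up; have HF1 v : cCk 1 U (cderive v F) by exact: cCk_cderive.
have E u c : cderive u (wirtinger c F) p = 2^-1 * (cderive u (d_dx c.2 F) p +
    (if c.1 then - 'i%C else 'i%C) * cderive u (d_dy c.2 F) p).
  rewrite (@cderive_ext U _ _ _ _ oU Up (fun x _ => wirtingerE c F x)).
  have Hy : cCk 1 U (fun x => (if c.1 then - 'i%C else 'i%C) * d_dy c.2 F x).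
    by apply: cCkZ => //; exact: HF1.
  rewrite (cderiveZ _ _ oU (cCkD oU (HF1 _) Hy) Up).
  by rewrite (cderiveD _ oU (HF1 _) Hy Up) (cderiveZ _ _ oU (HF1 _) Up).
rewrite (wirtingerE a (wirtinger b F)) (wirtingerE b (wirtinger a F)).
rewrite /d_dx /d_dy !E /d_dx /d_dy.
rewrite (cderive_sym (delta_mx 0 b.2, 0) (delta_mx 0 a.2, 0) oU HF Up).
rewrite (cderive_sym (0, delta_mx 0 b.2) (delta_mx 0 a.2, 0) oU HF Up).
rewrite (cderive_sym (delta_mx 0 b.2, 0) (0, delta_mx 0 a.2) oU HF Up).
rewrite (cderive_sym (0, delta_mx 0 b.2) (0, delta_mx 0 a.2) oU HF Up).
have aux (h s t x y z w : C) : h * (h * (x + s * y) + t * (h * (z + s * w))) =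
  h * (h * (x + t * z) + s * (h * (y + t * w))) by ring.
exact: aux.
Qed.

Lemma vapply_ext U (X : covec R n) F G p : open U -> U p -> (forall x, U x -> F x = G x) ->
  vapply X F p = vapply X G p.
Proof.
by move=> oU Up e; rewrite !vapplyE; apply: eq_bigr => a _;
  rewrite (wirtinger_ext a oU Up e).
Qed.

Lemma cCk_vapply k U X F : open U -> (forall a, cCk k U (fun x => coef (X x) a)) ->
  cCk k.+1 U F -> cCk k U (fapply X F).
Proof.
move=> oU HX HF; apply: (cCk_ext oU) (_ : cCk k U (fun x =>
  \sum_a coef (X x) a * wirtinger a F x)) => [x _|].
  by rewrite /fapply vapplyE.
by apply: cCk_sum => // a _; apply: cCkM => //; exact: cCk_wirtinger.
Qed.

Lemma vapplyD U (X : covec R n) F G p : open U -> cCk 1 U F -> cCk 1 U G -> U p ->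
  vapply X (fun x => F x + G x) p = vapply X F p + vapply X G p.
Proof.
move=> oU HF HG Up; rewrite !vapplyE -big_split; apply: eq_bigr => a _ /=.
by rewrite (wirtingerD a oU HF HG Up) mulrDr.
Qed.

Lemma vapplyM U (X : covec R n) F G p : open U -> cCk 1 U F -> cCk 1 U G -> U p ->
  vapply X (fun x => F x * G x) p = F p * vapply X G p + vapply X F p * G p.
Proof.
move=> oU HF HG Up; rewrite !vapplyE mulr_sumr mulr_suml -big_split.
apply: eq_bigr => a _ /=; rewrite (wirtingerM a oU HF HG Up) mulrDr.
by congr (_ + _); [exact: mulrCA|exact: mulrA].
Qed.

Lemma vapply_cst (X : covec R n) p (c : C) : vapply X (fun=> c) p = 0.
Proof. by rewrite vapplyE big1 // => a _; rewrite wirtinger_cst mulr0. Qed.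

Lemma vapplyZ U (X : covec R n) (c : C) F p : open U -> cCk 1 U F -> U p ->
  vapply X (fun x => c * F x) p = c * vapply X F p.
Proof.
move=> oU HF Up; rewrite (vapplyM X oU (cCk_cst _ _ c) HF Up).
by rewrite vapply_cst mul0r addr0.
Qed.

Lemma vapply_sum U (X : covec R n) I (r : seq I) (P : pred I) (F : I -> cspace R n -> C) p :
  open U -> (forall i, cCk 1 U (F i)) -> U p ->
  vapply X (fun x => \sum_(i <- r | P i) F i x) p = \sum_(i <- r | P i) vapply X (F i) p.
Proof.
move=> oU HF Up; elim: r => [|i r IH].
  rewrite big_nil; apply: etrans (vapply_cst X p 0).
  apply: (vapply_ext _ oU Up) => x _.
  by rewrite big_nil.
rewrite big_cons -IH; case: ifP => Pi.
  rewrite -(vapplyD X oU (HF i) (cCk_sum r oU (fun j (_ : P j) => HF j)) Up).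
  by apply: (vapply_ext _ oU Up) => x _; rewrite big_cons Pi.
by apply: (vapply_ext _ oU Up) => x _; rewrite big_cons Pi.
Qed.

Definition conj_vec (X : covec R n) : covec R n := (conjv X.2, conjv X.1).

Lemma coef_conj_vec (X : covec R n) a : coef (conj_vec X) a = (coef X (~~ a.1, a.2))^*%C.
Proof. by case: a => [[] j]; rewrite /coef /= mxE. Qed.

Lemma sum_flip (F : bool * 'I_n -> C) : \sum_a F (~~ a.1, a.2) = \sum_a F a.
Proof.
have inj : injective (fun a : bool * 'I_n => (~~ a.1, a.2)).
  by move=> [b i] [c j] [/negb_inj-> ->].
by rewrite [RHS](reindex_inj inj).
Qed.

Lemma vapply_conj U (X : covec R n) F p : open U -> cCk 1 U F -> U p ->
  vapply (conj_vec X) (fun x => (F x)^*%C) p = (vapply X F p)^*%C.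
Proof.
move=> oU HF Up; rewrite !vapplyE conjc_sum.
rewrite -(sum_flip (fun a => (coef X a * wirtinger a F p)^*%C)).
by apply: eq_bigr => a _; rewrite coef_conj_vec (wirtinger_conj a oU HF Up) conjcM.
Qed.

Lemma vapply_cplx_conj U (X : covec R n) f p : open U -> Ck 1 U f -> U p ->
  vapply (conj_vec X) (cplx f) p = (vapply X (cplx f) p)^*%C.
Proof.
move=> oU Hf Up; rewrite -(vapply_conj X oU (cCk_cplx Hf) Up).
by apply: (vapply_ext _ oU Up) => x _; rewrite cplx_conj.
Qed.

Lemma vapply_Re_Im U (X : covec R n) F p : open U -> cCk 1 U F -> U p ->
  vapply X F p = vapply X (cplx (fun x => complex.Re (F x))) p +
    'i%C * vapply X (cplx (fun x => complex.Im (F x))) p.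
Proof.
move=> oU [a b] Up.
rewrite -(vapplyZ X 'i%C oU (cCk_cplx b) Up).
rewrite -(vapplyD X oU (cCk_cplx a) (cCkZ 'i%C oU (cCk_cplx b)) Up).
by apply: (vapply_ext _ oU Up) => x _; rewrite /cplx -complexE.
Qed.

(* The real and imaginary parts of a complexified tangent vector, as directions
   of R^n x R^n. *)
Definition dirRe (X : covec R n) : cspace R n :=
  (\row_j (complex.Re (X.1 0 j + X.2 0 j) / 2), \row_j (complex.Im (X.1 0 j - X.2 0 j) / 2)).

Definition dirIm (X : covec R n) : cspace R n :=
  (\row_j (complex.Im (X.1 0 j + X.2 0 j) / 2), \row_j (complex.Re (X.2 0 j - X.1 0 j) / 2)).

Lemma cspace_sum_delta (v : cspace R n) :
  v = \sum_j (v.1 0 j *: ((delta_mx 0 j, 0) : cspace R n) +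
              v.2 0 j *: ((0, delta_mx 0 j) : cspace R n)).
Proof.
have f1 (u w : cspace R n) : (u + w).1 = u.1 + w.1 by [].
have f2 (u w : cspace R n) : (u + w).2 = u.2 + w.2 by [].
rewrite [LHS]surjective_pairing [RHS]surjective_pairing; congr (_, _).
  rewrite (big_morph _ f1 erefl) [LHS]row_sum_delta.
  by apply: eq_bigr => j _; rewrite /= scaler0 addr0.
rewrite (big_morph _ f2 erefl) [LHS]row_sum_delta.
by apply: eq_bigr => j _; rewrite /= scaler0 add0r.
Qed.

Lemma Ck1_derive_dir U f p v : open U -> Ck 1 U f -> U p ->
  'D_v f p = \sum_j (v.1 0 j * 'D_(delta_mx 0 j, 0) f p + v.2 0 j * 'D_(0, delta_mx 0 j) f p).
Proof.
move=> oU Hf Up; rewrite {1}(cspace_sum_delta v) (Ck1_derive_sum _ _ _ oU Hf Up).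
apply: eq_bigr => j _; rewrite (Ck1_deriveD _ _ oU Hf Up).
by rewrite !(Ck1_deriveZ _ _ Hf Up).
Qed.

(** Reduces a complexified vector acting on a real function to two real derivatives, which carries
    the level set argument over to such vectors. *)
Lemma vapply_dir U (X : covec R n) f p : open U -> Ck 1 U f -> U p ->
  vapply X (cplx f) p = ('D_(dirRe X) f p +i* 'D_(dirIm X) f p)%C.
Proof.
move=> oU Hf Up; rewrite !(Ck1_derive_dir _ oU Hf Up).
have -> : forall (F G : 'I_n -> R),
    ((\sum_j F j) +i* (\sum_j G j))%C = \sum_j (F j +i* G j)%C.
  move=> F G; apply: eq_complexP => /=.
    by rewrite (big_morph (@complex.Re R) (@ReD R) erefl).
  by rewrite (big_morph (@complex.Im R) (@ImD R) erefl).
apply: eq_bigr => j _; rewrite !mxE /d_dz /d_dzbar /d_dx /d_dy !cderive_cplx.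
set a := 'D_(_, 0) f p; set b := 'D_(0, _) f p.
have h2 : (2^-1 : C) = (2^-1)%:C%C by rewrite fmorphV rmorph_nat.
rewrite h2; case: (X.1 0 j) => x1 y1; case: (X.2 0 j) => x2 y2.
by apply: eq_complexP => /=; field.
Qed.

(** The second-order terms of [X (Y F)] and [Y (X F)] cancel by symmetry of the mixed Wirtinger
    derivatives; the first-order terms make up the bracket. *)
Lemma bracketE U X Y F p : open U -> (forall a, cCk 1 U (fun x => coef (X x) a)) ->
  (forall a, cCk 1 U (fun x => coef (Y x) a)) -> cCk 2 U F -> U p ->
  vapply (bracket X Y p) F p = fapply X (fapply Y F) p - fapply Y (fapply X F) p.
Proof.
move=> oU HX HY HF Up.
have HF1 a : cCk 1 U (wirtinger a F) by exact: cCk_wirtinger.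
have E Z W : (forall a, cCk 1 U (fun x => coef (W x) a)) ->
    fapply Z (fapply W F) p =
    \sum_a fapply Z (fun x => coef (W x) a) p * wirtinger a F p +
    \sum_a \sum_b coef (W p) a * coef (Z p) b * wirtinger b (wirtinger a F) p.
  move=> HW; rewrite {1}/fapply (vapply_ext _ oU Up (fun x _ => vapplyE (W x) F x)).
  rewrite (vapply_sum _ _ _ oU (fun a : bool * 'I_n => cCkM oU (HW a) (HF1 a)) Up).
  rewrite -big_split; apply: eq_bigr => a _ /=.
  rewrite (vapplyM _ oU (HW a) (HF1 a) Up) addrC; congr (_ + _).
  by rewrite vapplyE mulr_sumr; apply: eq_bigr => b _; rewrite mulrA.
rewrite !E // vapplyE opprD addrACA -sumrB [X in _ = _ + X](_ : _ = 0) ?addr0.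
  by apply: eq_bigr => a _; rewrite coef_bracket mulrBl.
apply/eqP; rewrite subr_eq0; apply/eqP; rewrite [RHS]exchange_big.
apply: eq_bigr => a _; apply: eq_bigr => b _ /=.
by rewrite (wirtinger_sym _ _ oU HF Up) [coef (X p) b * _]mulrC.
Qed.
End ComplexCalculus.

(** * Traces of Hermitian forms over frames *)

Section HermitianTrace.
Variables (R : realType) (n : nat).
Local Notation C := R[i].
Implicit Types (H : 'M[C]_n) (w : 'rV[C]_n).

Definition normsq (z : C) : R := complex.Re z ^+ 2 + complex.Im z ^+ 2.

Lemma normsq_ge0 z : 0 <= normsq z.
Proof. by rewrite addr_ge0// sqr_ge0. Qed.

Lemma mulc_conj (z : C) : z * z^*%C = (normsq z)%:C%C.
Proof. by case: z => a b; apply: eq_complexP; rewrite /normsq /=; ring. Qed.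

Lemma normsq_eq0 z : (normsq z == 0) = (z == 0).
Proof.
rewrite /normsq paddr_eq0 ?sqr_ge0// !sqrf_eq0.
by case: z => a b /=; rewrite eq_complex.
Qed.

Definition sesq H (u v : 'rV[C]_n) : C := \sum_j \sum_k H j k * u 0 j * (v 0 k)^*%C.

Lemma sesq_linear H (c : C) (u v w : 'rV[C]_n) :
  sesq H (c *: u + v) w = c * sesq H u w + sesq H v w.
Proof.
rewrite /sesq mulr_sumr -big_split; apply: eq_bigr => j _ /=.
rewrite mulr_sumr -big_split; apply: eq_bigr => k _ /=.
have -> : (c *: u + v) 0 j = c * u 0 j + v 0 j by rewrite !mxE.
have aux (h s t b : C) : h * (c * s + t) * b = c * (h * s * b) + h * t * b by ring.
exact: aux.
Qed.

Definition hform H w : R := complex.Re (sesq H w w).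

Definition hermitian H := forall j k, H k j = (H j k)^*%C.

Lemma hermitian_sesq_conj H u w : hermitian H -> (sesq H u w)^*%C = sesq H w u.
Proof.
move=> hH; rewrite /sesq conjc_sum; under eq_bigr do rewrite conjc_sum.
rewrite exchange_big; apply: eq_bigr => j _; apply: eq_bigr => k _ /=.
by rewrite !conjcM conjcK -hH mulrAC.
Qed.

Lemma hermitian_sesq_real H w : hermitian H -> sesq H w w = (hform H w)%:C%C.
Proof.
move=> hH; have E := hermitian_sesq_conj w w hH.
apply: eq_complexP => //=; move: E; case: (sesq H w w) => a b [] /= /eqP.
by rewrite -subr_eq0 -opprD oppr_eq0 -mulr2n mulrn_eq0 /= => /eqP.
Qed.

(** Otherwise a large multiple of [v], with the right phase, makes the form negative at [c v + w]:
    the term quadratic in [c] is absent because [v] is null. *)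
Lemma semipositive_null H (T : set 'rV[C]_n) v w : hermitian H ->
  (forall c u1 u2, T u1 -> T u2 -> T (c *: u1 + u2)) ->
  (forall u, T u -> 0 <= hform H u) -> T v -> hform H v = 0 -> T w -> sesq H v w = 0.
Proof.
move=> hH lT pos Tv v0 Tw; apply/eqP; rewrite -normsq_eq0; apply/negP => /negP zN.
set z := sesq H v w in zN.
have nz : 0 < normsq z by rewrite lt_def zN normsq_ge0.
pose l := (hform H w + 1) / (2 * normsq z).
pose c : C := (- l)%:C%C * z^*%C.
have cz : c * z = (- l * normsq z)%:C%C.
  by rewrite /c -mulrA [_^*%C * z]mulrC mulc_conj -rmorphM.
have := pos _ (lT c v w Tv Tw); rewrite /hform sesq_linear.
rewrite -(hermitian_sesq_conj (c *: v + w) v hH) sesq_linear.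
rewrite -(hermitian_sesq_conj (c *: v + w) w hH) sesq_linear.
rewrite (hermitian_sesq_real v hH) v0 mulr0 add0r (hermitian_sesq_conj w v hH) -/z.
rewrite cz (hermitian_sesq_real w hH) -rmorphD /= /l.
have -> : - ((hform H w + 1) / (2 * normsq z)) * normsq z = - (hform H w + 1) / 2.
  by field; rewrite gt_eqF.
by move: (hform H w) => y; lra.
Qed.

Lemma hformD H1 H2 w : hform (H1 + H2) w = hform H1 w + hform H2 w.
Proof.
rewrite /hform -ReD; congr complex.Re; rewrite /sesq -big_split; apply: eq_bigr => j _ /=.
by rewrite -big_split; apply: eq_bigr => k _ /=; rewrite !mxE !mulrDl.
Qed.

Lemma hformZ (a : R) H w : hform (a%:C%C *: H) w = a * hform H w.
Proof.
rewrite /hform (_ : sesq _ _ _ = a%:C%C * sesq H w w); last first.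
  rewrite /sesq mulr_sumr; apply: eq_bigr => j _; rewrite mulr_sumr.
  by apply: eq_bigr => k _; rewrite !mxE !mulrA.
by case: (sesq _ _ _) => x y /=; rewrite mul0r subr0.
Qed.

Definition rank1 (l : 'rV[C]_n) : 'M[C]_n := \matrix_(j, k) (l 0 j * (l 0 k)^*%C).

Lemma hform_rank1 l w : hform (rank1 l) w = normsq (\sum_j w 0 j * l 0 j).
Proof.
rewrite /hform (_ : sesq _ _ _ = (normsq (\sum_j w 0 j * l 0 j))%:C%C)//.
rewrite -mulc_conj /sesq conjc_sum mulr_suml; apply: eq_bigr => j _.
rewrite mulr_sumr; apply: eq_bigr => k _; rewrite mxE conjcM.
have aux (a b c d : C) : a * b * c * d = c * a * (d * b) by ring.
exact: aux.
Qed.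

Section Frames.
Variable q : nat.
Implicit Types W : 'M[C]_(q, n).

Definition frame W := forall i k, \sum_j W i j * (W k j)^*%C = (i == k)%:R.

Definition qtrace H W : R := \sum_i hform H (row i W).

Lemma qtraceD H1 H2 W : qtrace (H1 + H2) W = qtrace H1 W + qtrace H2 W.
Proof. by rewrite -big_split; apply: eq_bigr => i _; rewrite hformD. Qed.

Lemma qtraceZ (a : R) H W : qtrace (a%:C%C *: H) W = a * qtrace H W.
Proof. by rewrite /qtrace mulr_sumr; apply: eq_bigr => i _; rewrite hformZ. Qed.

Lemma qtrace_rank1_ge0 l W : 0 <= qtrace (rank1 l) W.
Proof. by apply: sumr_ge0 => i _; rewrite hform_rank1 normsq_ge0. Qed.

Lemma frame_normsq W i : frame W -> \sum_j normsq (W i j) = 1.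
Proof.
move=> fW; have E : \sum_j W i j * (W i j)^*%C = 1 by rewrite fW eqxx.
apply: etrans (congr1 (@complex.Re R) E); rewrite (big_morph _ (@ReD R) erefl).
by apply: eq_bigr => j _; rewrite mulc_conj.
Qed.

Lemma frame_entry W i j : frame W -> normsq (W i j) <= 1.
Proof.
move=> /(frame_normsq i) <-; rewrite (bigD1 j)//= lerDl.
by apply: sumr_ge0 => k _; exact: normsq_ge0.
Qed.

Definition mxsize H : R := \sum_j \sum_k (`|complex.Re (H j k)| + `|complex.Im (H j k)|).

(** Entries of a frame have modulus at most 1, so each of the q rows contributes at most [mxsize H].
    The bound is crude but uniform over all frames. *)
Lemma qtrace_le H W : frame W -> `|qtrace H W| <= q%:R * mxsize H.
Proof.
move=> fW; rewrite /qtrace (le_trans (ler_norm_sum _ _ _))//.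
rewrite (_ : q%:R * mxsize H = \sum_(i < q) mxsize H); last first.
  by rewrite sumr_const card_ord mulr_natl.
apply: ler_sum => i _; rewrite /hform /sesq (big_morph _ (@ReD R) erefl).
rewrite (le_trans (ler_norm_sum _ _ _))//; apply: ler_sum => j _.
rewrite (big_morph _ (@ReD R) erefl).
rewrite (le_trans (ler_norm_sum _ _ _))//; apply: ler_sum => k _.
rewrite !mxE; have := frame_entry i j fW; have := frame_entry i k fW.
rewrite /normsq; case: (H j k) => a b; case: (W i j) => c d; case: (W i k) => e f /=.
move=> ef cd.
have -> : (a * c - b * d) * e - (a * d + b * c) * - f =
   a * (c * e + d * f) + b * (c * f - d * e) by ring.
rewrite (le_trans (ler_normD _ _))// !normrM lerD// ler_piMr//.
  have := sqr_ge0 (c + e); have := sqr_ge0 (d + f).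
  have := sqr_ge0 (c - e); have := sqr_ge0 (d - f) => *.
  by rewrite ler_norml; apply/andP; split; nra.
have := sqr_ge0 (c + f); have := sqr_ge0 (d + e).
have := sqr_ge0 (c - f); have := sqr_ge0 (d - e) => *.
by rewrite ler_norml; apply/andP; split; nra.
Qed.

End Frames.

Lemma char_poly_similar (D P : 'M[C]_n) : P \in unitmx ->
  char_poly (invmx P *m D *m P) = char_poly D.
Proof.
move=> Pu; rewrite /char_poly.
have E : char_poly_mx (invmx P *m D *m P) =
  map_mx polyC (invmx P) *m char_poly_mx D *m map_mx polyC P.
  rewrite /char_poly_mx mulmxBr mulmxBl !map_mxM; congr (_ - _).
  by rewrite scalar_mxC -mulmxA -map_mxM mulVmx// map_mx1 mulmx1.
rewrite E !det_mulmx mulrAC -det_mulmx -map_mxM mulVmx// map_mx1 det1 mul1r //.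
Qed.

(** Unique factorisation of the characteristic polynomial matches [e], up to a permutation, with the
    diagonal of a unitary diagonalisation. The eigenvectors selected by [A] form a frame, over which
    the trace is the sum of the selected eigenvalues. *)
Lemma eigenvalue_sum q H (c : R) (e : n.-tuple C) (A : {set 'I_n}) :
  hermitian H -> (forall W : 'M[C]_(q, n), frame W -> c < qtrace H W) ->
  char_poly H = \prod_(j < n) ('X - (tnth e j)%:P) -> #|A| = q ->
  c%:C%C < \sum_(j in A) tnth e j.
Proof.
move=> hH Hc Ee Aq; subst q.
have hsym : H \is hermsymmx.
  by apply/is_hermitianmxP; rewrite expr0 scale1r; apply/matrixP => j k; rewrite !mxE;
    exact: hH.
have /orthomx_spectralP HE := hermitian_normalmx hsym.
set P := spectralmx H in HE; set d := spectral_diag H in HE.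
have Pun : P \is unitarymx := spectral_unitarymx H.
have Pu : P \in unitmx := spectral_unit H.
have PP i k : \sum_j P i j * (P k j)^*%C = (i == k)%:R.
  have /unitarymxP/matrixP/(_ i k) := Pun; rewrite !mxE => <-.
  by apply: eq_bigr => j _; rewrite !mxE.
have [s Es] : exists s : 'S_n, forall j, tnth e j = d 0 (s j).
  have : perm_eq e [tuple d 0 j | j < n].
    apply: prod_XsubC_eq; rewrite !big_tuple -Ee HE char_poly_similar//.
    rewrite char_poly_trig; last exact: diag_mx_is_trig.
    by apply: eq_bigr => j _; rewrite !mxE eqxx mulr1n tnth_mktuple.
  case/tuple_permP => s es; exists s => j.
  have /eqP/val_inj -> : val e == [tuple tnth [tuple d 0 j | j < n] (s i) | i < n].
    exact/eqP.
  by rewrite !tnth_mktuple.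
have diagE k : sesq H (row k P) (row k P) = d 0 k.
  transitivity ((P *m H *m map_mx Num.conj P^T) k k).
    rewrite /sesq !mxE exchange_big; apply: eq_bigr => j _; rewrite !mxE mulr_suml.
    by apply: eq_bigr => l _; rewrite !mxE [H l j * _]mulrC.
  rewrite HE -invmx_unitary// !mulmxA mulmxV// mul1mx -mulmxA mulmxV// mulmx1.
  by rewrite !mxE eqxx mulr1n.
pose W : 'M[C]_(#|A|, n) := \matrix_(i, j) P (s (enum_val i)) j.
have fW : frame W.
  move=> i k; under eq_bigr do rewrite !mxE.
  by rewrite PP (inj_eq perm_inj) (inj_eq enum_val_inj).
have rowW i : row i W = row (s (enum_val i)) P by apply/rowP => j; rewrite !mxE.
rewrite big_enum_val /=.
have -> : \sum_(i < #|A|) tnth e (enum_val i) = (qtrace H W)%:C%C.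
  rewrite /qtrace rmorph_sum; apply: eq_bigr => i _ /=.
  by rewrite Es -hermitian_sesq_real// rowW diagE.
by rewrite ltcR; exact: Hc.
Qed.

End HermitianTrace.

(** * Potentials with large traces *)

Lemma compact_finite_cover (T : topologicalType) (I : eqType) (A : set T) (D : set I)
    (f : I -> set T) : compact A -> (forall i, D i -> open (f i)) ->
  (forall x, A x -> exists2 i, D i & f i x) ->
  exists s : seq I, (forall i, i \in s -> D i) /\
    forall x, A x -> exists2 i, i \in s & f i x.
Proof.
move=> /compact_near_coveringP cA fo Af.
(* The filter generated by the finite lists of admissible indices, directed by inclusion;
   compactness, as a near-covering property along [F], yields one list serving all points. *)
pose F : set_system (seq I) := fun S => exists2 s0 : seq I, (forall i, i \in s0 -> D i) &
  forall s : seq I, {subset s0 <= s} -> S s.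
have FF : Filter F.
  split; first by exists [::].
    move=> P Q [s Ds sP] [t Dt tQ]; exists (s ++ t).
      by move=> i; rewrite mem_cat => /orP[/Ds|/Dt].
    by move=> u su; split; [apply: sP|apply: tQ] => i iu; apply: su;
      rewrite mem_cat iu ?orbT.
  by move=> P Q PQ [s Ds sP]; exists s => // t /sP/PQ.
pose P (s : seq I) x := exists2 i, i \in s & f i x.
have [x /Af[i Di fx]|s Ds sP] := cA _ F P FF.
  exists (f i, [set s : seq I | i \in s]) => /=.
    split; first by apply: open_nbhs_nbhs; split => //; exact: fo.
    by exists [:: i] => [j|s]; [rewrite inE => /eqP->|apply; rewrite inE].
  by move=> [y s] /= [fy si]; exists i.
exists s; split=> //; exact: sP.
Qed.

(** * The complex Hessian *)

Section Hessian.
Variables (R : realType) (n : nat).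
Local Notation C := R[i].
Implicit Types (U : set (cspace R n)) (p : cspace R n) (f g : cspace R n -> R).

Lemma hessian_wirtinger f p j k :
  complex_hessian f p j k = wirtinger (true, j) (wirtinger (false, k) (cplx f)) p.
Proof. by rewrite mxE. Qed.

Lemma hessian_ext U f g p : open U -> U p -> (forall x, U x -> f x = g x) ->
  complex_hessian f p = complex_hessian g p.
Proof.
move=> oU Up e; apply/matrixP => j k.
rewrite [LHS]hessian_wirtinger [RHS]hessian_wirtinger.
apply: (wirtinger_ext _ oU Up) => x Ux; apply: (wirtinger_ext _ oU Ux) => y Uy.
by rewrite /cplx e.
Qed.

Lemma hessian_hermitian U f p : open U -> Ck 2 U f -> U p ->
  hermitian (complex_hessian f p).
Proof.
move=> oU Hf Up j k; rewrite [LHS]hessian_wirtinger [X in X^*%C]hessian_wirtinger.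
have cf := cCk_cplx Hf; have Hf1 := Ck_le (leqnSn 1) Hf.
have c1 a : cCk 1 U (wirtinger a (cplx f)) by exact: cCk_wirtinger.
apply: etrans (wirtinger_conj (false, j) oU (c1 (false, k)) Up).
apply: etrans (wirtinger_sym _ _ oU cf Up) _.
apply: (wirtinger_ext _ oU Up) => x Ux.
exact/esym/(wirtinger_cplx_conj (false, k) oU Hf1 Ux).
Qed.

Lemma hessianD U f g p : open U -> Ck 2 U f -> Ck 2 U g -> U p ->
  complex_hessian (fun x => f x + g x) p = complex_hessian f p + complex_hessian g p.
Proof.
move=> oU Hf Hg Up; apply/matrixP => j k; rewrite [RHS]mxE [LHS]hessian_wirtinger.
rewrite [X in _ = X + _]hessian_wirtinger [X in _ = _ + X]hessian_wirtinger.
have cf := cCk_cplx Hf; have cg := cCk_cplx Hg.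
rewrite -(wirtingerD (true, j) oU (cCk_wirtinger (false, k) oU cf)
  (cCk_wirtinger (false, k) oU cg) Up).
apply: (wirtinger_ext _ oU Up) => x Ux.
rewrite -(wirtingerD (false, k) oU (cCk_le (leqnSn 1) cf) (cCk_le (leqnSn 1) cg) Ux).
apply: (wirtinger_ext _ oU Ux) => y Uy.
by rewrite /cplx; apply: eq_complexP => //=; rewrite addr0.
Qed.

Lemma hessianZ U (a : R) f p : open U -> Ck 2 U f -> U p ->
  complex_hessian (fun x => a * f x) p = a%:C%C *: complex_hessian f p.
Proof.
move=> oU Hf Up; apply/matrixP => j k; rewrite [RHS]mxE [LHS]hessian_wirtinger.
rewrite [X in _ = _ * X]hessian_wirtinger.
have cf := cCk_cplx Hf.
rewrite -(wirtingerZ (true, j) a%:C%C oU (cCk_wirtinger (false, k) oU cf) Up).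
apply: (wirtinger_ext _ oU Up) => x Ux.
rewrite -(wirtingerZ (false, k) a%:C%C oU (cCk_le (leqnSn 1) cf) Ux).
apply: (wirtinger_ext _ oU Ux) => y Uy.
by rewrite /cplx; apply: eq_complexP => /=; ring.
Qed.

Lemma hessian_cst p (a : R) : complex_hessian (fun=> a) p = 0 :> 'M[C]_n.
Proof.
apply/matrixP => j k; rewrite [LHS]hessian_wirtinger [RHS]mxE.
rewrite (@wirtinger_ext _ _ setT _ _ (fun=> 0))//; first exact: wirtinger_cst.
  exact: openT.
by move=> x _; exact: wirtinger_cst.
Qed.

Definition gradz f p : 'rV[C]_n := \row_j wirtinger (true, j) (cplx f) p.

Lemma vapply_gradz f p (w : 'rV[C]_n) :
  vapply (w, 0) (cplx f) p = \sum_j w 0 j * gradz f p 0 j.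
Proof.
by apply: eq_bigr => j _; rewrite !mxE mul0r addr0.
Qed.

(** For convex [c] the rank one term is nonnegative. For squares it is the source of positivity in
    the directions along which [f] varies; for the regularised maximum it can be discarded. *)
Lemma hessian_comp (c c1 c2 : R -> R) U f p : open U ->
  (forall s : R, is_derive s 1 c (c1 s)) -> (forall s : R, is_derive s 1 c1 (c2 s)) ->
  continuous c2 -> Ck 2 U f -> U p ->
  complex_hessian (fun x => c (f x)) p =
    (c2 (f p))%:C%C *: rank1 (gradz f p) + (c1 (f p))%:C%C *: complex_hessian f p.
Proof.
move=> oU dc dc1 cc2 Hf Up; have Hf1 : Ck 1 U f := Ck_le (leqnSn 1) Hf.
have chain (h h1 : R -> R) a x : (forall s : R, is_derive s 1 h (h1 s)) -> U x ->
    wirtinger a (cplx (fun x => h (f x))) x = (h1 (f x))%:C%C * wirtinger a (cplx f) x.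
  move=> dh Ux; rewrite !wirtingerE /d_dx /d_dy !cderive_cplx.
  rewrite !(derive_compR _ dh Hf1 Ux) !rmorphM /=.
  have aux (m i b y z : C) : m * (b * y + i * (b * z)) = b * (m * (y + i * z)) by ring.
  exact: aux.
apply/matrixP => j k; rewrite [RHS]mxE [X in _ = X + _]mxE [X in _ = _ + X]mxE.
rewrite [LHS]hessian_wirtinger [X in _ = _ + _ * X]hessian_wirtinger.
have Hc1 := Ck1_comp oU dc1 cc2 Hf1.
rewrite (wirtinger_ext (true, j) oU Up (fun x Ux => chain _ _ (false, k) x dc Ux)).
rewrite (wirtingerM (true, j) oU (cCk_cplx Hc1) (cCk_wirtinger (false, k) oU (cCk_cplx Hf)) Up).
rewrite (chain _ _ _ _ dc1 Up) !mxE (wirtinger_cplx_conj (true, k) oU Hf1 Up).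
rewrite addrC mulrA; congr (_ + _).
Qed.

Lemma continuous_hessian_dist U f p (M : 'M[C]_n) : open U -> Ck 2 U f -> U p ->
  {for p, continuous (fun x => mxsize (complex_hessian f x - M))}.
Proof.
move=> oU Hf Up.
suff : Ck 0 U (fun x => mxsize (complex_hessian f x - M)).
  by move=> /Ck0P; exact.
have H j k : cCk 0 U (fun x => (complex_hessian f x - M) j k).
  apply: (cCk_ext oU _ (cCkB oU (cCk_wirtinger (true, j) oU
    (cCk_wirtinger (false, k) oU (cCk_cplx Hf))) (cCk_cst _ _ (M j k)))) => x _.
  by rewrite [RHS]mxE [X in _ = _ + X]mxE [X in _ = X + _]hessian_wirtinger.
have ab g : Ck 0 U g -> Ck 0 U (fun x => `|g x|).
  by apply: Ck0_comp; exact: norm_continuous.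
apply: Ck_sum => // j _; apply: Ck_sum => // k _; have [a b] := H j k.
by apply: CkD; [exact: oU|exact: ab|exact: ab].
Qed.

Lemma continuous_hessian_size U f p : open U -> Ck 2 U f -> U p ->
  {for p, continuous (fun x => mxsize (complex_hessian f x))}.
Proof.
move=> oU Hf Up; have := continuous_hessian_dist (M := 0) oU Hf Up.
by under [X in {for p, continuous X}]funext do rewrite subr0.
Qed.

End Hessian.

(** * The trace form of the property, and cutoff functions *)

Section TraceProperty.
Variables (R : realType) (n q : nat).
Local Notation C := R[i].
Implicit Types (U K : set (cspace R n)) (p x a : cspace R n) (f g : cspace R n -> R)
  (W : 'M[C]_(q, n)).

(** Unlike sums of eigenvalues, traces over a fixed frame are linear in the Hessian, so they pass
    through sums and convex combinations. *)
Definition trace_property K : Prop :=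
  forall c : R, 0 < c -> exists U (l : cspace R n -> R),
    [/\ open U, K `<=` U, Ck 2 U l, forall x, U x -> 0 <= l x <= 1 &
        forall x, U x -> forall W, frame W -> c < qtrace (complex_hessian l x) W].

Lemma trace_property_P K : trace_property K -> property_P q K.
Proof.
move=> H c c0; have [U [l [oU KU Hl l01 Hc]]] := H c c0.
exists U, l; split=> // x Ux e Ee A Aq.
apply: (eigenvalue_sum _ (Hc x Ux) Ee Aq).
exact: hessian_hermitian Hl Ux.
Qed.

Lemma trace_property_sub K K' : K `<=` K' -> trace_property K' -> trace_property K.
Proof.
move=> KK H c c0; have [U [l [oU KU Hl l01 Hc]]] := H c c0.
by exists U, l; split=> //; exact: subset_trans KU.
Qed.

Lemma trace_property0 : trace_property set0.
Proof.
move=> c c0; exists set0, (fun=> 0).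
by split; [exact: open0|by []|exact: Ck_cst|move=> x []|move=> x []].
Qed.

Lemma bump_exists U a : open U -> U a -> exists b : cspace R n -> R,
  [/\ Ck 2 setT b, forall x, 0 <= b x, 1 < b a & forall x, 0 < b x -> U x].
Proof.
move=> oU Ua; have /nbhs_ballP[e /= e0 He] := open_nbhs_nbhs (conj oU Ua).
(* Equal to 2 at [a], where its cube is 8, and positive only in the Euclidean ball of radius [e],
   which lies in the ball of the sup norm. *)
pose s x := 2 - 2 / e ^+ 2 *
  \sum_j ((x.1 0 j - a.1 0 j) * (x.1 0 j - a.1 0 j) +
          (x.2 0 j - a.2 0 j) * (x.2 0 j - a.2 0 j)).
have Hs : Ck 2 setT s.
  have oT : open [set: cspace R n] by exact: openT.
  apply: CkB; [exact: oT|exact: Ck_cst|].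
  apply: CkZ => //; apply: Ck_sum => // j _.
  have H1 : Ck 2 setT (fun x : cspace R n => x.1 0 j - a.1 0 j).
    by apply: CkB; [exact: oT|exact: Ck_coord1|exact: Ck_cst].
  have H2 : Ck 2 setT (fun x : cspace R n => x.2 0 j - a.2 0 j).
    by apply: CkB; [exact: oT|exact: Ck_coord2|exact: Ck_cst].
  by apply: CkD; [exact: oT|exact: (CkM oT H1 H1)|exact: (CkM oT H2 H2)].
have c6 : continuous (fun s : R => 6 * pos_part s).
  move=> y; apply: (@continuousM _ _ (fun=> 6) (@pos_part R)); first exact: cst_continuous.
  exact: continuous_pos_part.
exists (fun x => pos_cube (s x)); split.
- exact: Ck2_comp openT (@is_derive_pos_cube R) (@is_derive_pos_cube1 R) c6 Hs.
- by move=> x; rewrite pos_cubeE exprn_ge0// pos_part_ge0.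
- rewrite /s big1 => [|j _]; last by rewrite !subrr !mulr0 addr0.
  rewrite mulr0 subr0 pos_cubeE pos_part_id//.
  by rewrite -natrX ltr1n.
- move=> x; rewrite pos_cubeE => sx.
  have {}sx : 0 < s x.
    by rewrite ltNge; apply/negP => s0; move: sx; rewrite (pos_part_eq0 s0) expr0n ltxx.
  have e2 : 0 < e ^+ 2 by rewrite exprn_gt0.
  have lt_e2 : \sum_j ((x.1 0 j - a.1 0 j) * (x.1 0 j - a.1 0 j) +
          (x.2 0 j - a.2 0 j) * (x.2 0 j - a.2 0 j)) < e ^+ 2.
    move: sx; rewrite /s subr_gt0 mulrAC ltr_pdivrMr// ltr_pM2l//.
  have small j : (x.1 0 j - a.1 0 j) ^+ 2 < e ^+ 2 /\ (x.2 0 j - a.2 0 j) ^+ 2 < e ^+ 2.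
    have le : (x.1 0 j - a.1 0 j) ^+ 2 + (x.2 0 j - a.2 0 j) ^+ 2 < e ^+ 2.
      apply: le_lt_trans lt_e2; rewrite !expr2 (bigD1 j)//= lerDl.
      by apply: sumr_ge0 => k _; rewrite -!expr2 addr_ge0// sqr_ge0.
    have := sqr_ge0 (x.1 0 j - a.1 0 j); have := sqr_ge0 (x.2 0 j - a.2 0 j).
    by move=> *; split; lra.
  have abs (t : R) : t ^+ 2 < e ^+ 2 -> `|t| < e.
    by rewrite -(real_normK (num_real t)) ltr_pXn2r// nnegrE ltW.
  apply: He; split; split=> // i j; rewrite ord1 /= /ball /= distrC; apply: abs.
    by have [] := small j.
  by have [] := small j.
Qed.

Lemma cutoff_exists K U : compact K -> open U -> K `<=` U ->
  exists h : cspace R n -> R, [/\ Ck 2 setT h, forall x, 0 <= h x <= 1,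
    forall x, K x -> h x = 1 & forall x, 0 < h x -> U x].
Proof.
move=> cK oU KU; have oT : open [set: cspace R n] by exact: openT.
have /choice[b Hb] a : exists b : cspace R n -> R, K a ->
    [/\ Ck 2 setT b, forall x, 0 <= b x, 1 < b a & forall x, 0 < b x -> U x].
  have [Ka|nKa] := pselect (K a); last by exists (fun=> 0).
  by have [ba Hba] := bump_exists oU (KU _ Ka); exists ba.
have [a Ka|x Kx|D [DK KD]] := @compact_finite_cover _ _ K K (fun a => [set x | 1 < b a x]) cK.
- have [Hba _ _ _] := Hb a Ka.
  apply: (@open_comp _ _ (b a) [set y | 1 < y]); last exact: open_gt.
  by move=> x _; exact: Ck_continuous Hba I.
- by exists x => //=; have [] := Hb x Kx.
(* [undup] lets a single term be isolated, and the filter [a \in D] recovers [K a] for each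
   summand. *)
pose s x := \sum_(a <- undup D | a \in D) b a x.
have s0 x : 0 <= s x.
  by apply: sumr_ge0 => a /DK Ka; have [_ + _ _] := Hb a Ka; exact.
have c6 : continuous (fun s : R => 6 * pos_part s).
  move=> y; apply: (@continuousM _ _ (fun=> 6) (@pos_part R)); first exact: cst_continuous.
  exact: continuous_pos_part.
(* A C^2 step function of [s]: it is 1 for [s >= 1], as on [K], and 0 for [s = 0], as off [U]. *)
exists (fun x => 1 - pos_cube (1 - s x)); split.
- apply: CkB; [exact: openT|exact: (Ck_cst (1 : R))|].
  apply: Ck2_comp openT (@is_derive_pos_cube R) (@is_derive_pos_cube1 R) c6 _.
  apply: CkB; [exact: openT|exact: (Ck_cst (1 : R))|].
  by apply: Ck_sum => // a /DK Ka; have [] := Hb a Ka.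
- move=> x; rewrite pos_cubeE; have p0 := pos_part_ge0 (1 - s x).
  have p1 : pos_part (1 - s x) <= 1 by rewrite /pos_part ge_max ler01 gerBl s0.
  by rewrite subr_ge0 gerBl exprn_ge0// exprn_ile1.
- move=> x /KD[a aD /= ba]; have Ka : K a by apply: DK.
  rewrite pos_cubeE pos_part_eq0 ?expr0n ?subr0// subr_le0.
  apply: le_trans (ltW ba) _; rewrite /s big_mkcond /= (bigD1_seq a) ?mem_undup ?undup_uniq//=.
  rewrite aD lerDl; apply: sumr_ge0 => c _; case: ifP => // /DK Kc.
  by have [_ + _ _] := Hb c Kc; exact.
- move=> x; rewrite pos_cubeE => H.
  have sx : s x != 0.
    apply/eqP => sx; move: H; rewrite sx subr0 pos_part_id// expr1n subrr ltxx//.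
  apply: contrapT => nU; move/eqP: sx; apply; rewrite /s big1// => a /DK Ka.
  have [_ b0 _ bU] := Hb a Ka; apply/eqP; rewrite eq_le b0 andbT leNgt.
  by apply/negP => /bU.
Qed.

End TraceProperty.

(** * Regularised maxima and locality of the property *)

Section Gluing.
Variables (R : realType) (n q : nat).
Local Notation C := R[i].
Implicit Types (U K : set (cspace R n)) (p x a : cspace R n) (f g l : cspace R n -> R)
  (W : 'M[C]_(q, n)).

Lemma hessian_size_bounded K g : compact K -> Ck 2 setT g ->
  exists2 N : R, 0 < N & forall x, K x -> mxsize (complex_hessian g x) < N.
Proof.
move=> cK Hg; have [K0|/set0P K0] := eqVneq K set0.
  by exists 1 => // x; rewrite K0.
have cont : {within K, continuous (fun x => mxsize (complex_hessian g x))}.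
  by apply: continuous_subspaceT => x; exact: continuous_hessian_size openT Hg I.
have [c _ Hc] := compact_EVT_max K0 cK cont.
exists (Num.max 0 (mxsize (complex_hessian g c)) + 1).
  by rewrite ltr_wpDl// le_max lexx.
move=> x Kx; rewrite (le_lt_trans (Hc x (mem_set Kx)))//.
by rewrite -[ltLHS]addr0 ler_ltD ?ltr01// le_max lexx orbT.
Qed.

Lemma convex_lt (A B D s t c : R) : 0 <= t -> t <= 1 -> 0 <= s * D -> c < A -> c < B ->
  c < A + (s * D + t * (B + -1 * A)).
Proof.
move=> t0 t1 sD cA cB; have [->|tn] := eqVneq t 0; first by rewrite mul0r addr0; lra.
have a1 : 0 <= (1 - t) * (A - c) by rewrite mulr_ge0// subr_ge0// ltW.
have a2 : 0 < t * (B - c) by rewrite mulr_gt0 ?subr_gt0// lt_def tn t0.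
have -> : A + (s * D + t * (B + -1 * A)) = (1 - t) * (A - c) + t * (B - c) + s * D + c.
  by ring.
lra.
Qed.

Lemma lt_perturb (A B S N c : R) : c + N + 1 < A -> `|B| <= S -> S <= N -> c < A + B.
Proof. by rewrite ler_norml => ? /andP[? _] ?; lra. Qed.

(** The weights of the convex combination are [1 - smooth_pos1] and [smooth_pos1] at [g - f]; the
    remaining term is [smooth_pos2] times the square of a gradient. *)
Lemma qtrace_smooth_max U f g x W (c : R) : open U -> Ck 2 U f -> Ck 2 U g -> U x ->
  frame W -> c < qtrace (complex_hessian f x) W -> c < qtrace (complex_hessian g x) W ->
  c < qtrace (complex_hessian (fun x => f x + smooth_pos (g x - f x)) x) W.
Proof.
move=> oU Hf Hg Ux fW cf cg.
have Hu : Ck 2 U (fun x => g x - f x) by exact: CkB.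
have [_ /andP[s0 s1] s2 _ _] := smooth_pos_bounds (g x - f x).
rewrite (hessianD oU Hf (Ck2_comp oU (@is_derive_smooth_pos R) (@is_derive_smooth_pos1 R)
  (@continuous_smooth_pos2 R) Hu) Ux).
rewrite (hessian_comp oU (@is_derive_smooth_pos R) (@is_derive_smooth_pos1 R)
  (@continuous_smooth_pos2 R) Hu Ux).
have -> : complex_hessian (fun x => g x - f x) x =
    complex_hessian g x + (-1)%:C%C *: complex_hessian f x.
  rewrite -(hessianZ (-1) oU Hf Ux) -(hessianD oU Hg (CkZ (-1) oU Hf) Ux).
  by apply: (hessian_ext oU Ux) => y _; rewrite mulN1r.
rewrite !(qtraceD, qtraceZ).
have r0 := qtrace_rank1_ge0 (gradz (fun x => g x - f x) x) W.
exact: convex_lt s0 s1 (mulr_ge0 s2 r0) cf cg.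
Qed.

(* Near [K1] take [l1]; elsewhere [l2] plus a fixed function of a cutoff [h] of
   [K1], which makes [l1] dominate where [h] is near 1 and [l2] where [h] is
   near 0; in between take their regularised maximum. The Hessian of [h] is
   absorbed because it is chosen before [l2]. *)
Lemma trace_property_glue K K1 : compact K -> compact K1 -> trace_property q K1 ->
  (forall B, compact B -> B `<=` K -> (forall x, B x -> ~ K1 x) -> trace_property q B) ->
  trace_property q K.
Proof.
move=> cK cK1 P1 PB c c0.
(* The glued function takes values in [0, 6] and is divided by 6 at the end, hence the factor 6. *)
have [U1 [l1 [oU1 KU1 Hl1 l101 C1]]] := P1 (6 * c) (mulr_gt0 (ltr0Sn _ _) c0).
have [h [Hh h01 hK hU]] := cutoff_exists cK1 oU1 KU1.
(* If [h > 1/2] then [g < -3] and [l2 + g] lies more than 1 below [l1]; if [h < 1/12] then [g > 2]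
   and it lies more than 1 above. Moreover [l2 + g <= 4], so the regularised maximum is at most
   6. *)
pose g x : R := 3 - 12 * h x.
have oT : open [set: cspace R n] by exact: openT.
have Hg : Ck 2 setT g.
  by apply: CkB; [exact: openT|exact: (Ck_cst (3 : R))|exact: CkZ].
have [N N0 HN] := hessian_size_bounded cK Hg.
(* Disjoint from [K1], where [h = 1]; on the rest of [K] only [l1] counts. *)
pose B := K `&` [set x | h x <= 1 / 2].
have hc : continuous h by move=> x; exact: Ck_continuous Hh I.
have cB : compact B.
  apply: compact_closedI => //.
  have : closed (h @^-1` [set y | y <= 1 / 2]).
    by apply: preimage_closed => //; exact: closed_le.
  by [].
(* As [N] bounds the Hessian of [g] on [K], traces of [l2] above this value leave those of [l2 + g]
   above [6 c]. *)
have C2pos : 0 < 6 * c + q%:R * N + 1.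
  by rewrite ltr_wpDl// addr_ge0// mulr_ge0// ltW.
have [|U2 [l2 [oU2 BU2 Hl2 l201 C2]]] := PB B cB (@subIsetl _ _ _) _ _ C2pos.
  by move=> x [_ /= hx] /hK h1; move: hx; rewrite h1; lra.
pose O := [set x | mxsize (complex_hessian g x) < N].
have oO : open O.
  apply: (@open_comp _ _ (fun x => mxsize (complex_hessian g x)) [set y | y < N]).
    by move=> x _; exact: continuous_hessian_size oT Hg I.
  exact: open_lt.
have oh (b : R) : open [set x | b < h x].
  by apply: (@open_comp _ _ h [set y | b < y]); [move=> x _; exact: hc|exact: open_gt].
have oh' (b : R) : open [set x | h x < b].
  by apply: (@open_comp _ _ h [set y | y < b]); [move=> x _; exact: hc|exact: open_lt].
pose O1 := U1 `&` [set x | 1 / 2 < h x].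
pose O2 := (U1 `&` U2) `&` O.
pose O3 := (U2 `&` O) `&` [set x | h x < 1 / 12].
have oO1 : open O1 by exact: openI.
have oO2 : open O2 by apply: openI => //; exact: openI.
have oO3 : open O3 by apply: openI => //; exact: openI.
pose m x := l2 x + g x.
(* On each of the open sets [O1], [O2] and [O3] one single formula holds, so regularity and traces
   are computed there without cases. *)
pose l x := 6^-1 * (if 1 / 2 < h x then l1 x else if h x < 1 / 12 then m x
  else l1 x + smooth_pos (m x - l1 x)).
have E1 x : O1 x -> 6^-1 * l1 x = l x by move=> [_ /= hx]; rewrite /l hx.
have E3 x : O3 x -> 6^-1 * m x = l x.
  move=> [_ /= hx]; rewrite /l hx ifF//; apply/negbTE; rewrite -leNgt.
  by apply: ltW; apply: lt_trans hx _; lra.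
have E2 x : O2 x -> 6^-1 * (l1 x + smooth_pos (m x - l1 x)) = l x.
  move=> [[/l101 /andP[a0 a1] /l201 /andP[b0 b1]] _].
  have [_ _ _ sN s1] := smooth_pos_bounds (m x - l1 x).
  rewrite /l; case: ifPn => [hx|_]; last case: ifPn => // hx.
    have le1 : m x - l1 x <= -1 by rewrite /m /g; lra.
    by rewrite (sN le1) addr0.
  have le1 : 1 <= m x - l1 x by rewrite /m /g; lra.
  by rewrite (s1 le1) addrCA subrr addr0.
have Hm V : V `<=` U2 -> open V -> Ck 2 V m.
  by move=> VU oV; apply: CkD => //; [exact: Ck_sub Hl2|exact: Ck_sub Hg].
have Hmax : Ck 2 O2 (fun x => l1 x + smooth_pos (m x - l1 x)).
  have Hl1' : Ck 2 O2 l1 by apply: Ck_sub Hl1 => x [[]].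
  apply: CkD; [exact: oO2|exact: Hl1'|].
  apply: (Ck2_comp oO2 (@is_derive_smooth_pos R)
    (@is_derive_smooth_pos1 R) (@continuous_smooth_pos2 R)).
  by apply: CkB; [exact: oO2|apply: Hm => // x [[]]|exact: Hl1'].
have m_trace x W : U2 x -> O x -> frame W -> 6 * c < qtrace (complex_hessian m x) W.
  move=> U2x Ox fW; rewrite (hessianD oU2 Hl2 (Ck_sub (@subsetT _ _) Hg) U2x) qtraceD.
  apply: lt_perturb (C2 x U2x W fW) (qtrace_le (complex_hessian g x) fW) _.
  by rewrite ler_wpM2l// ltW.
have trace6 V f x W : open V -> Ck 2 V f -> V x -> (forall y, V y -> 6^-1 * f y = l y) ->
    6 * c < qtrace (complex_hessian f x) W -> c < qtrace (complex_hessian l x) W.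
  move=> oV Hf Vx e cf; rewrite -(hessian_ext oV Vx e) (hessianZ _ oV Hf Vx) qtraceZ.
  by rewrite [_^-1 * _]mulrC ltr_pdivlMr// mulrC.
have Cl V f : open V -> Ck 2 V f -> (forall y, V y -> 6^-1 * f y = l y) -> Ck 2 V l.
  by move=> oV Hf e; apply: (Ck_ext oV e); exact: CkZ.
have HO1 : Ck 2 O1 l1 by apply: Ck_sub Hl1 => x [].
have HO3 : Ck 2 O3 m by apply: Hm => // x [[]].
exists (O1 `|` O2 `|` O3), l; split.
- by apply: openU => //; exact: openU.
- move=> x Kx; have Ox : O x by exact: HN.
  have [hx|hx] := ltP (1 / 2) (h x).
    by left; left; split=> //; apply: hU; apply: lt_trans hx; lra.
  have U2x : U2 x by apply: BU2.
  have [hx'|hx'] := ltP (h x) (1 / 12); first by right.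
  by left; right; split => //; split=> //; apply: hU; apply: lt_le_trans hx'; lra.
- apply: Ck_local => x [[ O1x|O2x]|O3x].
  + by exists O1; [by []|exact: Cl HO1 E1].
  + by exists O2; [by []|exact: Cl Hmax E2].
  + by exists O3; [by []|exact: Cl HO3 E3].
- move=> x Ux; have /andP[h0 h1] := h01 x; case: Ux => [[ O1x|O2x]|O3x].
  + have [U1x _] := O1x; have /andP[a0 a1] := l101 x U1x.
    by rewrite -E1//; apply/andP; split; lra.
  + have [[U1x U2x] _] := O2x; have /andP[a0 a1] := l101 x U1x.
    have /andP[b0 b1] := l201 x U2x.
    have [/andP[s0 s1] _ _ _ _] := smooth_pos_bounds (m x - l1 x).
    have : pos_part (m x - l1 x) <= 4.
      by rewrite /pos_part ge_max /m /g; apply/andP; split; lra.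
    by rewrite -E2// => p4; apply/andP; split; lra.
  + have [[U2x _] /= hx] := O3x; have /andP[b0 b1] := l201 x U2x.
    by rewrite -E3// /m /g; apply/andP; split; lra.
- move=> x [[ O1x|O2x]|O3x] W fW.
  + by apply: (trace6 _ _ _ _ oO1 HO1 O1x E1); have [U1x _] := O1x; exact: C1.
  + apply: (trace6 _ _ _ _ oO2 Hmax O2x E2); have [[U1x U2x] Ox] := O2x.
    apply: (qtrace_smooth_max oO2 _ _ O2x fW).
    * by apply: Ck_sub Hl1 => y [[]].
    * by apply: Hm => // y [[]].
    * exact: C1.
    * exact: m_trace.
  + by apply: (trace6 _ _ _ _ oO3 HO3 O3x E3); have [[U2x Ox] _] := O3x; exact: m_trace.
Qed.

Lemma trace_propertyU K1 K2 : compact K1 -> compact K2 ->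
  trace_property q K1 -> trace_property q K2 -> trace_property q (K1 `|` K2).
Proof.
move=> c1 c2 P1 P2; apply: (trace_property_glue _ c1 P1); first exact: compactU.
move=> B _ BK nB; apply: (trace_property_sub _ P2) => x Bx.
by have [/(nB x Bx)|//] := BK x Bx.
Qed.

(** [B] only has to contain [K] near [x], so a set found for a larger compact can be reused for a
    smaller one; finitely many such [B] are united by gluing. *)
Lemma trace_property_local K : compact K ->
  (forall x, K x -> exists2 r : R, 0 < r & exists2 B, compact B & trace_property q B /\
     K `&` ball x r `<=` B) -> trace_property q K.
Proof.
move=> cK H.
have /choice[rB HrB] x : exists rB : R * set (cspace R n), K x ->
    [/\ 0 < rB.1, compact rB.2, trace_property q rB.2 & K `&` ball x rB.1 `<=` rB.2].
  have [Kx|] := pselect (K x); last by exists (0, set0).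
  by have [r r0 [B cB [PB KB]]] := H x Kx; exists (r, B).
have [x Kx|x Kx|s [sK Ks]] :=
    @compact_finite_cover _ _ K K (fun x => interior (ball x (rB x).1)) cK.
- exact: open_interior.
- by exists x => //; have [r0 _ _ _] := HrB x Kx; exact: nbhsx_ballx.
apply: (@trace_property_sub _ _ _ _ (\bigcup_(x in [set` s]) (rB x).2)).
  move=> y Ky; have [x xs /interior_subset bx] := Ks y Ky.
  by exists x => //; have [_ _ _ sub] := HrB x (sK x xs); exact: sub.
suff : compact (\bigcup_(x in [set` s]) (rB x).2) /\
    trace_property q (\bigcup_(x in [set` s]) (rB x).2) by case.
elim: s sK {Ks} => [|x s IH] sK.
  rewrite (_ : [set` [::]] = set0) ?bigcup_set0; last by apply/seteqP; split.
  by split; [exact: compact0|exact: trace_property0].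
have -> : \bigcup_(y in [set` x :: s]) (rB y).2 =
    (rB x).2 `|` \bigcup_(y in [set` s]) (rB y).2.
  apply/seteqP; split=> z.
    by move=> [y /=]; rewrite inE => /predU1P[-> ?|ys ?]; [left|right; exists y].
  move=> [xz|[y ys yz]]; first by exists x => //=; rewrite mem_head.
  by exists y => //=; rewrite inE [y \in s]ys orbT.
have [|cs Ps] := IH; first by move=> y ys; apply: sK; rewrite inE ys orbT.
have [_ cx Px _] := HrB x (sK x (mem_head _ _)).
by split; [exact: compactU|exact: trace_propertyU].
Qed.

End Gluing.

(** * Compactness of the set of frames *)

Section FrameCompactness.
Variables (R : realType) (n q : nat).
Local Notation C := R[i].
Implicit Types (H P : 'M[C]_n) (u : cspace R (q * n)%N).

(** Real coordinates on matrices make [Ck 0] available for continuity, and boxes for compactness. *)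
Definition mx_of_coord u : 'M[C]_(q, n) :=
  \matrix_(i, j) (u.1 0 (mxvec_index i j) +i* u.2 0 (mxvec_index i j))%C.

Definition coord_of_mx (W : 'M[C]_(q, n)) : cspace R (q * n)%N :=
  (mxvec (map_mx (@complex.Re R) W), mxvec (map_mx (@complex.Im R) W)).

Lemma coord_of_mxK W : mx_of_coord (coord_of_mx W) = W.
Proof.
by apply/matrixP => i j; rewrite !mxE !mxvecE !mxE; case: (W i j).
Qed.

Lemma cCk_mx_of_coord i j : cCk 0 setT (fun u => mx_of_coord u i j).
Proof.
have oT : open [set: cspace R (q * n)%N] by exact: openT.
split.
  by apply: (Ck_ext oT _ (Ck_coord1 (mxvec_index i j) oT)) => x _; rewrite mxE.
by apply: (Ck_ext oT _ (Ck_coord2 (mxvec_index i j) oT)) => x _; rewrite mxE.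
Qed.

Lemma continuous_qtrace H : continuous (fun u => qtrace H (mx_of_coord u)).
Proof.
suff : Ck 0 setT (fun u => qtrace H (mx_of_coord u)) by move=> /Ck0P + u; exact.
apply: Ck_sum => [|i _]; first exact: openT.
apply: (proj1 (_ : cCk 0 setT (fun u => sesq H (row i (mx_of_coord u)) (row i (mx_of_coord u))))).
apply: cCk_sum => [|j _]; first exact: openT.
apply: cCk_sum => [|k _]; first exact: openT.
have row_cont l : cCk 0 setT (fun u => row i (mx_of_coord u) 0 l).
  by apply: (cCk_ext openT _ (cCk_mx_of_coord i l)) => x _; rewrite [RHS]mxE.
apply: cCkM; [exact: openT| |apply: cCk_conj; [exact: openT|exact: row_cont]].
by apply: cCkM; [exact: openT|exact: cCk_cst|exact: row_cont].
Qed.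

(** Frames are the zero set of the continuous function [N], the sum of the squared moduli of the
    Gram defects, and their entries have modulus at most 1. *)
Lemma frames_compact : compact [set u | frame (mx_of_coord u)].
Proof.
pose gram u i k := \sum_j mx_of_coord u i j * (mx_of_coord u k j)^*%C - (i == k)%:R.
pose N u := \sum_i \sum_k normsq (gram u i k).
have N0 u : frame (mx_of_coord u) <-> N u = 0.
  split=> [fu|/eqP].
    by rewrite /N big1// => i _; rewrite big1// => k _; apply/eqP;
      rewrite normsq_eq0 /gram fu subrr.
  rewrite psumr_eq0 => [/allP H i k|i _]; last by apply: sumr_ge0 => k _; exact: normsq_ge0.
  have := H i (mem_index_enum _); rewrite psumr_eq0 => [/allP H2|? _]; last exact: normsq_ge0.
  have := H2 k (mem_index_enum _); rewrite normsq_eq0 /gram subr_eq0.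
  by move=> /eqP.
have cN : continuous N.
  suff : Ck 0 setT N by move=> /Ck0P + u; exact.
  have oT : open [set: cspace R (q * n)%N] by exact: openT.
  have cg i k : cCk 0 setT (fun u => gram u i k).
    apply: cCkB => //; last exact: cCk_cst.
    apply: cCk_sum => // j _; apply: cCkM => //; first exact: cCk_mx_of_coord.
    by apply: cCk_conj => //; exact: cCk_mx_of_coord.
  apply: Ck_sum => // i _; apply: Ck_sum => // k _; have [a b] := cg i k.
  apply: (Ck_ext oT _ (CkD oT (CkM oT a a) (CkM oT b b))) => x _.
  by rewrite /normsq !expr2.
have cB := @rV_compact R (q * n)%N (fun=> `[(-1 : R), 1]%classic)
  (fun=> @segment_compact R (-1) 1).
apply: (@subclosed_compact _ _ _ _ (compact_setX cB cB)).
  rewrite (_ : [set u | _] = N @^-1` [set 0]).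
    by apply: preimage_closed => //; exact: closed_eq.
  by apply/seteqP; split=> u /= /N0.
move=> u /= fu.
have aux (z : R) : z ^+ 2 <= 1 -> -1 <= z <= 1.
  by move=> z1; rewrite -ler_norml -(@expr_le1 _ 2 `|z|)// real_normK ?num_real.
have bound (x y : R) : normsq (x +i* y)%C <= 1 -> -1 <= x <= 1 /\ -1 <= y <= 1.
  rewrite /normsq /= => le; have := sqr_ge0 x; have := sqr_ge0 y => y0 x0.
  by split; apply: aux; lra.
split=> l /=; rewrite in_itv /=; case/mxvec_indexP: l => i j;
  have := frame_entry i j fu; rewrite mxE => /bound[].
  by [].
by [].
Qed.

(* The frames are compact, so [qtrace H] is positive near the zero set of
   [qtrace P]; away from it a large [b] wins. *)
Lemma frame_penalty H P :
  (forall W : 'M[C]_(q, n), frame W -> 0 <= qtrace P W) ->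
  (forall W : 'M[C]_(q, n), frame W -> qtrace P W = 0 -> 0 < qtrace H W) ->
  exists b d : R, [/\ 0 < b, 0 < d &
    forall W : 'M[C]_(q, n), frame W -> d <= qtrace H W + b * qtrace P W].
Proof.
move=> P0 PH.
(* One integer plays both parts, [b = k + 1] and [d = 1 / (k + 1)]. As the trace of [P] is
   nonnegative on frames, the condition weakens as [k] grows, and the largest index of a finite
   cover serves all frames. *)
pose O (k : nat) := [set u | k.+1%:R^-1 < qtrace H (mx_of_coord u) +
  k.+1%:R * qtrace P (mx_of_coord u)].
have [k _|u /= fu|s [_ Hs]] := @compact_finite_cover _ _ _ setT O frames_compact.
- apply: (@open_comp _ _ (fun u => qtrace H (mx_of_coord u) +
    k.+1%:R * qtrace P (mx_of_coord u)) [set y | k.+1%:R^-1 < y]); last exact: open_gt.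
  move=> u _; apply: (@continuousD _ _ _ (fun u => qtrace H (mx_of_coord u))).
    exact: continuous_qtrace.
  apply: (@continuousM _ _ (fun=> k.+1%:R) (fun u => qtrace P (mx_of_coord u))).
    exact: cst_continuous.
  exact: continuous_qtrace.
- pose h := qtrace H (mx_of_coord u); pose g := qtrace P (mx_of_coord u).
  have g0 : 0 <= g by exact: P0.
  have [gE|gN] := eqVneq g 0.
    have h0 : 0 < h by exact: PH.
    exists (Num.truncn h^-1) => //; rewrite /O /= -/h -/g gE mulr0 addr0.
    rewrite invf_plt ?posrE ?ltr0Sn//.
    by have /andP[] := truncn_itv (ltW (etrans (invr_gt0 h) h0)).
  have gp : 0 < g by rewrite lt_def gN.
  (* Once [k + 1 > a], the penalty exceeds [1 + |h|] and the sum exceeds 1. *)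
  pose a := (1 + `|h|) / g.
  have a0 : 0 <= a by rewrite divr_ge0// addr_ge0.
  exists (Num.truncn a) => //; rewrite /O /= -/h -/g.
  have /andP[_ lt] := truncn_itv a0.
  have {}lt : 1 + `|h| < (Num.truncn a).+1%:R * g by rewrite -ltr_pdivrMr.
  apply: (@le_lt_trans _ _ 1); first by rewrite invf_le1 ?ltr0Sn// ler1n.
  by have := ler_norm (- h); rewrite normrN => ?; lra.
pose m := \max_(k <- s) k.
exists m.+1%:R, m.+1%:R^-1; split=> [||W fW]; rewrite ?invr_gt0 ?ltr0Sn//.
have [|k ks] := Hs (coord_of_mx W); first by rewrite /= coord_of_mxK.
rewrite /O /= coord_of_mxK => lt.
have km : (k <= m)%N by rewrite /m (big_rem k)//= leq_maxl.
apply: le_trans (le_trans (ltW lt) _).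
  by rewrite lef_pV2 ?posrE ?ltr0Sn// ler_nat.
by rewrite lerD2l ler_wpM2r ?P0// ler_nat.
Qed.

End FrameCompactness.

(** * The potential near a point *)

Section LocalPotential.
Variables (R : realType) (n q : nat).
Local Notation C := R[i].

Lemma Ck_open_preimage k (U : set (cspace R n)) (f : cspace R n -> R) (O : set R) :
  open U -> Ck k U f -> open O -> open (U `&` f @^-1` O).
Proof.
move=> oU Hf oO; rewrite openE => x [Ux Ofx]; apply: filterI.
  exact: open_nbhs_nbhs.
apply: (Ck_continuous Hf Ux); exact: open_nbhs_nbhs.
Qed.

Lemma half_le (d A B : R) : d <= A -> `|B| <= d / 2 -> d / 2 <= A + B.
Proof. by rewrite ler_norml => ? /andP[? _]; lra. Qed.

Lemma frame_rank (W : 'M[C]_(q, n)) : frame W -> \rank W = q.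
Proof.
move=> fW; apply: mxrank_unitary; apply/unitarymxP/matrixP => i k.
rewrite !mxE -[RHS](fW i k); apply: eq_bigr => j _.
by rewrite !mxE.
Qed.

(** Squares of functions vanishing at [p] contribute to the Hessian at [p] only the squares of their
    gradients. The radius [e] is fixed before [K] and [c]; only the open set [V] shrinks with
    [c]. *)
Lemma local_potential (U : set (cspace R n)) (p : cspace R n) (rho : cspace R n -> R)
    (s : seq nat) (f : nat -> cspace R n -> R) r (E : 'M[C]_(r, n)) :
  open U -> U p -> Ck 2 U rho -> (forall k, k \in s -> Ck 2 U (f k)) ->
  rho p = 0 -> (forall k, k \in s -> f k p = 0) ->
  (forall v, vapply (v, 0) (cplx rho) p = 0 -> 0 <= hform (complex_hessian rho p) v) ->
  (forall v, vapply (v, 0) (cplx rho) p = 0 -> hform (complex_hessian rho p) v = 0 ->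
     (forall k, k \in s -> vapply (v, 0) (cplx (f k)) p = 0) -> (v <= E)%MS) ->
  (\rank E < q)%N ->
  exists2 e : R, 0 < e & forall K : set (cspace R n), K `<=` ball p e ->
    (forall x, K x -> rho x = 0 /\ forall k, k \in s -> f k x = 0) -> trace_property q K.
Proof.
move=> oU Up Hrho Hf rho0 f0 pos null rankE.
pose Q0 := complex_hessian rho p + \sum_(k <- s) 2%:C%C *: rank1 (gradz (f k) p).
pose P := rank1 (gradz rho p).
have qtr_sum (I : Type) (t : seq I) (M : I -> 'M[C]_n) (W : 'M[C]_(q, n)) :
    qtrace (\sum_(k <- t) M k) W = \sum_(k <- t) qtrace (M k) W.
  apply: (big_morph (fun M => qtrace M W)) => [A B|]; first exact: qtraceD.
  by rewrite -(scale0r (0 : 'M[C]_n)) (qtraceZ 0) mul0r.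
(* The penalty measures the normal component: a frame with [qtrace P W = 0] is tangent, and if the
   trace of [Q0] also vanished, its q independent rows would all lie in [E], whose rank is less than
   q. *)
have [||b [d [b0 d0 Hbd]]] := @frame_penalty _ _ q Q0 P.
- by move=> W _; exact: qtrace_rank1_ge0.
- move=> W fW PW.
  have tang i : vapply (row i W, 0) (cplx rho) p = 0.
    move/eqP: PW; rewrite /qtrace psumr_eq0 => [/allP/(_ i (mem_index_enum _))|j _].
      by rewrite hform_rank1 normsq_eq0 vapply_gradz => /eqP.
    by rewrite hform_rank1 normsq_ge0.
  have q0 : 0 <= qtrace (complex_hessian rho p) W.
    by apply: sumr_ge0 => i _; exact/pos/tang.
  have f2 k : 0 <= qtrace (2%:C%C *: rank1 (gradz (f k) p)) W.
    by rewrite qtraceZ mulr_ge0// qtrace_rank1_ge0.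
  have s2 : 0 <= \sum_(k <- s) qtrace (2%:C%C *: rank1 (gradz (f k) p)) W.
    by apply: sumr_ge0 => k _.
  rewrite lt_def /Q0 qtraceD qtr_sum addr_ge0// andbT.
  apply/negP; rewrite paddr_eq0// => /andP[/eqP H1 /eqP H2].
  have : (W <= E)%MS.
    apply/row_subP => i; apply: null => [|| k ks]; first exact: tang.
      move/eqP: H1; rewrite /qtrace psumr_eq0 => [/allP/(_ i (mem_index_enum _))|j _].
        by move=> /eqP.
      exact/pos/tang.
    move/eqP: H2; rewrite psumr_eq0// => /allP/(_ k ks)/=.
    rewrite qtraceZ mulf_eq0 pnatr_eq0 /= /qtrace psumr_eq0.
      move=> /allP/(_ i (mem_index_enum _)); rewrite hform_rank1 normsq_eq0.
      by rewrite vapply_gradz => /eqP.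
    by move=> j _; rewrite hform_rank1 normsq_ge0.
  by move=> /mxrankS; rewrite (frame_rank fW) leqNgt rankE.
pose sq (y : R) := y ^+ 2.
have dsq (y : R) : is_derive y 1 sq (2 * y).
  apply: is_derive_increment => e e0; exists e => // h he.
  rewrite [h *: (1 : R)]mulr1 /sq.
  have -> : (y + h) ^+ 2 - y ^+ 2 - h * (2 * y) = h * h by ring.
  by rewrite normrM ler_wpM2r// ltW.
have dsq1 (y : R) : is_derive y 1 (fun y => 2 * y) (2 : R).
  apply: is_derive_increment => e e0; exists e => // h he.
  rewrite [h *: (1 : R)]mulr1.
  have -> : 2 * (y + h) - 2 * y - h * 2 = 0 by ring.
  by rewrite normr0 mulr_ge0// ltW.
have c2 : continuous (fun _ : R => 2 : R) by move=> y; exact: cst_continuous.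
have Csq g : Ck 2 U g -> Ck 2 U (fun x => sq (g x)) := Ck2_comp oU dsq dsq1 c2.
have Hsq g : Ck 2 U g -> g p = 0 ->
    complex_hessian (fun x => sq (g x)) p = 2%:C%C *: rank1 (gradz g p).
  move=> Hg g0; rewrite (hessian_comp oU dsq dsq1 c2 Hg Up) g0 mulr0.
  by rewrite [X in _ + X]scale0r addr0.
pose S x := \sum_(k <- s) sq (f k x).
have [CS HS] : Ck 2 U S /\ complex_hessian S p = \sum_(k <- s) 2%:C%C *: rank1 (gradz (f k) p).
  rewrite /S; elim: (s) Hf f0 => [|k t IH] Hf' f0'.
    split.
      by apply: (Ck_ext oU _ (Ck_cst (0 : R))) => x _; rewrite big_nil.
    rewrite big_nil -[RHS](hessian_cst p 0); apply: (hessian_ext oU Up) => x _.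
    by rewrite big_nil.
  have [i it|i it|CT HT] := IH.
  - by apply: Hf'; rewrite inE it orbT.
  - by apply: f0'; rewrite inE it orbT.
  have Ck' := Hf' k (mem_head _ _).
  have E' x : U x -> sq (f k x) + \sum_(i <- t) sq (f i x) = \sum_(i <- k :: t) sq (f i x).
    by rewrite big_cons.
  split; first exact: Ck_ext oU E' (CkD oU (Csq _ Ck') CT).
  rewrite big_cons -(hessian_ext oU Up E') (hessianD oU (Csq _ Ck') CT Up) HT.
  by rewrite Hsq// f0' ?mem_head.
pose psi x := (rho x + b / 2 * sq (rho x)) + S x.
have Cb : Ck 2 U (fun x => b / 2 * sq (rho x)) by exact: (CkZ (b / 2) oU (Csq _ Hrho)).
have Cr : Ck 2 U (fun x => rho x + b / 2 * sq (rho x)) by exact: CkD oU Hrho Cb.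
have Cpsi : Ck 2 U psi by exact: CkD oU Cr CS.
have HP : complex_hessian psi p = Q0 + b%:C%C *: P.
  rewrite (hessianD oU Cr CS Up) (hessianD oU Hrho Cb Up).
  rewrite (hessianZ _ oU (Csq _ Hrho) Up) (Hsq _ Hrho rho0) HS scalerA -rmorphM.
  by rewrite divfK ?pnatr_eq0// addrAC.
have psi_trace (W : 'M[C]_(q, n)) : frame W -> d <= qtrace (complex_hessian psi p) W.
  by move=> fW; rewrite HP qtraceD qtraceZ; exact: Hbd.
pose D x := mxsize (complex_hessian psi x - complex_hessian psi p).
have D0 : D p = 0.
  by rewrite /D subrr /mxsize big1// => j _; rewrite big1// => k _; rewrite mxE normr0 addr0.
(* The trace changes by at most [q D x]; the divisor [q + 1] avoids a separate case for [q = 0]. *)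
pose eps := d / 2 / q.+1%:R.
have eps0 : 0 < eps by rewrite !divr_gt0.
have nearD : \forall x \near p, U x /\ D x < eps.
  apply: filterI; first exact: (open_nbhs_nbhs (conj oU Up)).
  have cD : {for p, continuous D} by exact: (continuous_hessian_dist oU Cpsi Up).
  have /cvgrPdist_lt/(_ _ eps0) := cD; apply: filterS => x Dx.
  by move: Dx; rewrite D0 sub0r normrN; apply: le_lt_trans; exact: ler_norm.
have psi_trace_near x (W : 'M[C]_(q, n)) : D x < eps -> frame W ->
    d / 2 <= qtrace (complex_hessian psi x) W.
  move=> Dx fW.
  have -> : complex_hessian psi x = complex_hessian psi p +
     (complex_hessian psi x - complex_hessian psi p) by rewrite addrC subrK.
  rewrite qtraceD.
  have := qtrace_le (complex_hessian psi x - complex_hessian psi p) fW.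
  have dW := psi_trace W fW.
  have qD : q%:R * D x <= d / 2.
    apply: (@le_trans _ _ (q.+1%:R * eps)).
      apply: ler_pM => //; last exact: ltW.
      - by apply: sumr_ge0 => j _; apply: sumr_ge0 => k _; rewrite addr_ge0.
      - by rewrite ler_nat.
    by rewrite /eps mulrC divfK.
  by move=> le; exact: half_le dW (le_trans le qD).
have /nbhs_ballP[e /= e0 He] := nearD.
exists e => // K Ke K0 c c0.
have Kpsi x : K x -> psi x = 0.
  move=> /K0[r0 fk]; rewrite /psi r0 /S /sq expr0n mulr0 !add0r big_seq big1// => k ks.
  by rewrite fk// expr0n.
(* Gives [A d / 2 = c + 1], and [d / 2] bounds the traces of [psi] from below near [p]. *)
pose A := 2 * (c + 1) / d.
have A0 : 0 < A by rewrite divr_gt0// mulr_gt0// addr_gt0.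
pose l x := A * psi x + 1 / 2.
have oB : open (ball p e) by exact: ball_open.
have BU : ball p e `<=` U by move=> x /He[].
have CpsiB : Ck 2 (ball p e) psi by exact: Ck_sub BU Cpsi.
have CApsi : Ck 2 (ball p e) (fun x => A * psi x) by exact: (CkZ A oB CpsiB).
have Chalf : Ck 2 (ball p e) (fun=> 1 / 2 : R) by exact: Ck_cst.
have Cl : Ck 2 (ball p e) l by exact: CkD oB CApsi Chalf.
(* A neighbourhood of [K] however large [A] is, since [psi] vanishes on [K]. *)
pose V := ball p e `&` (fun x => A * psi x) @^-1` `](- (1 / 2)), (1 / 2)[%classic.
have oV : open V by apply: Ck_open_preimage oB CApsi _; exact: interval_open.
exists V, l; split.
- exact: oV.
- move=> x Kx; split; first exact: Ke.
  rewrite /= Kpsi// mulr0 in_itv /= oppr_lt0; apply/andP; split; exact: divr_gt0.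
- by apply: Ck_sub Cl; move=> x [].
- move=> x [_ /=]; rewrite in_itv /= => /andP[l1 l2]; rewrite /l.
  by move: (A * psi x) l1 l2 => y l1 l2; apply/andP; split; lra.
- move=> x [Bx _] W fW; rewrite (hessianD oB CApsi Chalf Bx) (hessianZ A oB CpsiB Bx).
  rewrite hessian_cst addr0 qtraceZ.
  have [_ Dx] := He x Bx.
  apply: (@lt_le_trans _ _ (A * (d / 2))); last by rewrite ler_pM2l// psi_trace_near.
  rewrite /A mulrA divfK ?gt_eqF// mulrC mulrA mulVf ?pnatr_eq0// mul1r.
  by rewrite ltrDl.
Qed.

End LocalPotential.

(** * Brackets and contact forms on a hypersurface *)

Section TangentSpaces.
Variables (R : realType) (n : nat).
Local Notation C := R[i].
Implicit Types (S U V : set (cspace R n)) (p x : cspace R n) (rho : cspace R n -> R)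
  (F : cspace R n -> C) (X Y : covec R n) (L : cspace R n -> covec R n).

Definition hypersurface S : Prop :=
  forall p, S p -> exists U rho, defining_function S U rho /\ U p.

Lemma smooth_fieldP U (X : cspace R n -> covec R n) :
  smooth_field U X <-> forall a, csmooth U (fun x => coef (X x) a).
Proof.
split=> [[H1 H2] [[] j]|H]; [exact: H1|exact: H2|].
by split=> k j; rewrite ord1; [exact: (H (true, j))|exact: (H (false, j))].
Qed.

Lemma vapply_linear p F (c : C) (X Y : covec R n) :
  vapply (c *: X.1 + Y.1, c *: X.2 + Y.2) F p = c * vapply X F p + vapply Y F p.
Proof.
rewrite !vapplyE mulr_sumr -big_split; apply: eq_bigr => a _ /=.
by case: a => [[] j]; rewrite /coef /= !mxE mulrDl mulrA.
Qed.

Lemma pairing_linear (w X Y : covec R n) (c : C) :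
  pairing w (c *: X.1 + Y.1, c *: X.2 + Y.2) = c * pairing w X + pairing w Y.
Proof.
rewrite !pairingE mulr_sumr -big_split; apply: eq_bigr => a _ /=.
by case: a => [[] j]; rewrite /coef /= !mxE mulrDr mulrCA.
Qed.

Lemma vapply_split p F (X : covec R n) :
  vapply X F p = vapply (X.1, 0) F p + vapply (0, X.2) F p.
Proof.
rewrite -{1}[vapply (X.1, 0) F p]mul1r -vapply_linear /= !scaler0 !scale1r addr0 add0r.
by case: X.
Qed.

Lemma pairing_split (w X : covec R n) : pairing w X = pairing w (X.1, 0) + pairing w (0, X.2).
Proof.
rewrite -{1}[pairing w (X.1, 0)]mul1r -pairing_linear /= !scaler0 !scale1r addr0 add0r.
by case: X.
Qed.

Section AtPoint.
Variables (S U : set (cspace R n)) (rho : cspace R n -> R) (p : cspace R n).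
Hypotheses (Srho : defining_function S U rho) (Sp : S p) (Up : U p).

Let oU : open U. Proof. by case: Srho. Qed.
Let rho1 : Ck 1 U rho. Proof. by case: Srho => _ H _ _; exact: H. Qed.

Lemma defining_derive0 V (f : cspace R n -> R) v : open V -> V p -> Ck 1 V f ->
  (forall x, S x -> V x -> f x = 0) -> 'D_v rho p = 0 -> 'D_v f p = 0.
Proof.
move=> oV Vp Hf f0 vrho; have [_ _ S0 dS] := Srho.
apply: (@Ck1_level_set_derive _ _ (U `&` V) f rho).
- exact: openI.
- by apply: Ck_sub Hf => x [].
- by apply: Ck_sub rho1 => x [].
- by [].
- exact/S0.
- exact: dS.
- exact: vrho.
- by move=> x [Ux Vx] /S0 => /(_ Ux) Sx; exact: f0.
Qed.

(** Two defining functions vanish on the same set near [p], so a direction killed by the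
    differential of one is killed by that of the other. *)
Lemma ctangentP X : ctangent S p X <-> vapply X (cplx rho) p = 0.
Proof.
split=> [H|H U' rho' Srho' Up']; first exact: H Srho Up.
have [oU' sm' S0' _] := Srho'; have rho1' : Ck 1 U' rho' := sm' 1%N.
move: H; rewrite (vapply_dir X oU rho1 Up) (vapply_dir X oU' rho1' Up') => -[dRe dIm].
have rho0' x : S x -> U' x -> rho' x = 0 by move=> Sx Ux; exact/S0'.
rewrite (defining_derive0 oU' Up' rho1' rho0' dRe).
by rewrite (defining_derive0 oU' Up' rho1' rho0' dIm).
Qed.

(** A tangent vector sees only values on S; this is what makes it legitimate to represent sections
    over S by smooth extensions. *)
Lemma ctangent_vapply0 X V F : ctangent S p X -> open V -> V p -> cCk 1 V F ->
  (forall x, S x -> V x -> F x = 0) -> vapply X F p = 0.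
Proof.
move=> /ctangentP tX oV Vp HF F0; have [HRe HIm] := HF.
rewrite (vapply_Re_Im X oV HF Vp) (vapply_dir X oV HRe Vp) (vapply_dir X oV HIm Vp).
move: tX; rewrite (vapply_dir X oU rho1 Up) => -[dRe dIm].
have Re0 x : S x -> V x -> complex.Re (F x) = 0 by move=> Sx Vx; rewrite F0.
have Im0 x : S x -> V x -> complex.Im (F x) = 0 by move=> Sx Vx; rewrite F0.
rewrite (defining_derive0 oV Vp HRe Re0 dRe) (defining_derive0 oV Vp HRe Re0 dIm).
rewrite (defining_derive0 oV Vp HIm Im0 dRe) (defining_derive0 oV Vp HIm Im0 dIm).
by rewrite mulr0 addr0.
Qed.

Lemma ctangent_linear (c : C) (X Y : covec R n) : ctangent S p X -> ctangent S p Y ->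
  ctangent S p (c *: X.1 + Y.1, c *: X.2 + Y.2).
Proof.
move=> /ctangentP HX /ctangentP HY; apply/ctangentP.
by rewrite vapply_linear HX HY mulr0 addr0.
Qed.

Lemma ctangent_conj X : ctangent S p X -> ctangent S p (conj_vec X).
Proof.
move=> /ctangentP HX; apply/ctangentP.
by rewrite (vapply_cplx_conj X oU rho1 Up) HX conjc0.
Qed.

Lemma H10P v : H10 S p v <-> vapply (v, 0) (cplx rho) p = 0.
Proof. exact: ctangentP. Qed.

Lemma H10_linear (c : C) u v : H10 S p u -> H10 S p v -> H10 S p (c *: u + v).
Proof.
move=> Hu Hv; have := ctangent_linear c Hu Hv; rewrite /= scaler0 addr0; exact.
Qed.

(** If every [d rho / dz_j] vanished, so would their conjugates, [rho] being real, and with them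
    every real derivative of [rho]. *)
Lemma exists_normal : exists w, vapply (w, 0) (cplx rho) p = 1.
Proof.
have [_ _ _ dS] := Srho; have [[a b] vN] := dS p Up Sp.
have [j gj] : exists j, gradz rho p 0 j != 0.
  apply: contrapT => /forallNP H; move/eqP: vN; apply.
  (* The real direction [(a, b)] as a complexified vector: its [dirRe] is [(a, b)]. *)
  pose X : covec R n := (\row_j (a 0 j +i* b 0 j)%C, \row_j (a 0 j -i* b 0 j)%C).
  have g0 : vapply (X.1, 0) (cplx rho) p = 0.
    rewrite vapply_gradz big1// => j _; have /negP/negPn/eqP -> := H j.
    by rewrite mulr0.
  have g0' : vapply (0, X.2) (cplx rho) p = 0.
    have -> : (0, X.2) = conj_vec (X.1, 0).
      rewrite /conj_vec /=; congr (_, _); apply/rowP => j; rewrite !mxE //.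
      by rewrite conjc0.
    by rewrite (vapply_cplx_conj _ oU rho1 Up) g0 conjc0.
  have : vapply X (cplx rho) p = 0 by rewrite vapply_split g0 g0' addr0.
  rewrite (vapply_dir X oU rho1 Up) => -[dRe _]; rewrite -dRe.
  congr ('D__ rho p); rewrite /dirRe /X /=.
  by congr (_, _); apply/rowP => j; rewrite !mxE /=; field.
exists ((gradz rho p 0 j)^-1 *: delta_mx 0 j); rewrite vapply_gradz (bigD1 j)//= big1.
  by rewrite [X in X * _]mxE [X in _ * X * _]mxE !eqxx mulr1 addr0 mulVf.
by move=> k kj; rewrite [X in X * _]mxE [X in _ * X * _]mxE (negbTE kj) andbF mulr0 mul0r.
Qed.

End AtPoint.

(** [Y rho] vanishes on S, hence so does its derivative along the tangent field [X], and
    symmetrically. *)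
Lemma bracket_tangent S V (X Y : cspace R n -> covec R n) p :
  hypersurface S -> open V -> V p -> S p ->
  smooth_field V X -> smooth_field V Y ->
  (forall x, S x -> V x -> ctangent S x (X x)) ->
  (forall x, S x -> V x -> ctangent S x (Y x)) -> ctangent S p (bracket X Y p).
Proof.
move=> hS oV Vp Sp /smooth_fieldP sX /smooth_fieldP sY tX tY.
have [U [rho [Srho Up]]] := hS p Sp; have [oU srho _ _] := Srho.
apply/(ctangentP Srho Sp Up).
have oW : open (U `&` V) by exact: openI.
have c k F : csmooth V F -> cCk k (U `&` V) F.
  by move=> /csmoothP/(_ k); apply: cCk_sub => x [].
have crho k : cCk k (U `&` V) (cplx rho).
  by apply: cCk_sub (cCk_cplx (srho k)) => x [].
rewrite (bracketE oW (fun a => c 1%N _ (sX a)) (fun a => c 1%N _ (sY a)) (crho 2%N)) //.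
have key Z W : (forall a, csmooth V (fun x => coef (W x) a)) ->
    (forall x, S x -> V x -> ctangent S x (Z x)) ->
    (forall x, S x -> V x -> ctangent S x (W x)) -> fapply Z (fapply W (cplx rho)) p = 0.
  move=> sW tZ tW; apply: (@ctangent_vapply0 _ _ _ _ Srho Sp Up _ (U `&` V)) => //.
  - exact: tZ.
  - by apply: cCk_vapply; [exact: oW|move=> a; exact: c|exact: crho].
  - by move=> x Sx [Ux Vx]; exact/(ctangentP Srho Sx Ux)/tW.
by rewrite (key _ _ sY tX tY) (key _ _ sX tY tX) subrr.
Qed.

(** On S the (1,0) part of the bracket has coefficients [- L1 (L_j)], those of [L1] being zero
    there. Differentiating [L rho = 0] along [L1] trades them for second derivatives of [rho], that
    is, for the Levi form. *)
Lemma bracket_levi S U rho V (L L1 : cspace R n -> covec R n) p :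
  defining_function S U rho -> open V ->
  V p -> U p -> S p -> smooth_field V L -> smooth_field V L1 ->
  (forall x, S x -> V x -> ctangent S x (L x) /\ (L x).2 = 0) ->
  (forall x, S x -> V x -> ctangent S x (L1 x) /\ (L1 x).1 = 0) ->
  vapply ((bracket L L1 p).1, 0) (cplx rho) p =
    sesq (complex_hessian rho p) (L p).1 (conjv (L1 p).2).
Proof.
move=> Srho oV Vp Up Sp /smooth_fieldP sL /smooth_fieldP sL1 tL tL1.
have [oU srho _ _] := Srho.
have oW : open (U `&` V) by exact: openI.
have c k F : csmooth V F -> cCk k (U `&` V) F.
  by move=> /csmoothP/(_ k); apply: cCk_sub => x [].
have crho k : cCk k (U `&` V) (cplx rho).
  by apply: cCk_sub (cCk_cplx (srho k)) => x [].
have Wp : (U `&` V) p by [].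
have [tLp L2p] := tL p Sp Vp; have [tL1p L11p] := tL1 p Sp Vp.
have cr a : cCk 1 (U `&` V) (wirtinger a (cplx rho)) by exact: cCk_wirtinger.
(* The derivative along [L1] of [L rho], which vanishes on S. *)
have E : \sum_a (coef (L p) a * vapply (L1 p) (wirtinger a (cplx rho)) p +
    vapply (L1 p) (fun x => coef (L x) a) p * wirtinger a (cplx rho) p) = 0.
  rewrite -[RHS](@ctangent_vapply0 _ _ _ _ Srho Sp Up (L1 p) (U `&` V)
    (fun x => \sum_a coef (L x) a * wirtinger a (cplx rho) x)) //.
  - rewrite (@vapply_sum _ _ (U `&` V))//; last by move=> a; apply: cCkM => //; exact: c.
    by apply: eq_bigr => a _; rewrite (vapplyM _ oW (c _ _ (sL a)) (cr a) Wp).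
  - by apply: cCk_sum => // a _; apply: cCkM => //; exact: c.
  - move=> x Sx [Ux Vx]; rewrite -vapplyE.
    by apply/(ctangentP Srho Sx Ux); have [] := tL x Sx Vx.
(* These coefficients vanish on S only; their derivatives vanish because they are taken along
   tangent fields. *)
have z2 j : vapply (L1 p) (fun x => coef (L x) (false, j)) p = 0.
  apply: (@ctangent_vapply0 _ _ _ _ Srho Sp Up _ (U `&` V)) => //; first exact: c.
  by move=> x Sx [Ux Vx]; have [_ L2] := tL x Sx Vx; rewrite /coef /= L2 mxE.
have z1 j : vapply (L p) (fun x => coef (L1 x) (true, j)) p = 0.
  apply: (@ctangent_vapply0 _ _ _ _ Srho Sp Up _ (U `&` V)) => //; first exact: c.
  by move=> x Sx [Ux Vx]; have [_ L2] := tL1 x Sx Vx; rewrite /coef /= L2 mxE.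
have pairE (G : bool * 'I_n -> C) : \sum_a G a = \sum_j G (true, j) + \sum_j G (false, j).
  by rewrite (eq_bigr (fun a => G (a.1, a.2))) => [|[] //];
    rewrite -(pair_bigA _ (fun b j => G (b, j))) /= big_bool.
move: E; rewrite pairE [X in _ + X]big1 ?addr0 => [|j _]; last first.
  by rewrite z2 mul0r addr0 /coef /= L2p mxE mul0r.
rewrite big_split /= => /eqP; rewrite addrC addr_eq0 => /eqP E.
rewrite /vapply.
transitivity (- \sum_j vapply (L1 p) (fun x => coef (L x) (true, j)) p *
    wirtinger (true, j) (cplx rho) p).
  rewrite -sumrN; apply: eq_bigr => j _; rewrite !mxE mul0r addr0.
  have := z1 j; rewrite /coef /fapply /= => ->; rewrite sub0r mulNr //.
rewrite E opprK /sesq; apply: eq_bigr => j _.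
rewrite vapplyE pairE big1 ?add0r => [|k _]; last by rewrite /coef /= L11p mxE mul0r.
rewrite mulr_sumr; apply: eq_bigr => k _.
rewrite (wirtinger_sym (false, k) (true, j) oW (crho 2%N) Wp) hessian_wirtinger.
have -> : (conjv (L1 p).2 0 k)^*%C = (L1 p).2 0 k by rewrite mxE conjcK.
have aux (a b h : C) : a * (b * h) = h * a * b by ring.
exact: aux.
Qed.

End TangentSpaces.

(** * Sections of subbundles and contact forms *)

Section Sections.
Variables (R : realType) (n : nat).
Local Notation C := R[i].
Local Notation field := (cspace R n -> covec R n).
Implicit Types (S U V : set (cspace R n)) (p x : cspace R n) (F : cspace R n -> C)
  (X Y L theta : field) (E : cspace R n -> set 'rV[C]_n) (Ls : seq field).

Lemma csmooth_sub U V F : V `<=` U -> csmooth U F -> csmooth V F.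
Proof. by move=> VU /csmoothP H; apply/csmoothP => k; exact: cCk_sub VU (H k). Qed.

Lemma csmooth_ext U F (G : cspace R n -> C) : open U -> (forall x, U x -> F x = G x) ->
  csmooth U F -> csmooth U G.
Proof. by move=> oU e /csmoothP H; apply/csmoothP => k; exact: cCk_ext oU e (H k). Qed.

Lemma smooth_field_sub U V X : V `<=` U -> smooth_field U X -> smooth_field V X.
Proof.
by move=> VU /smooth_fieldP H; apply/smooth_fieldP => a; exact: csmooth_sub VU (H a).
Qed.

Lemma csmooth_fapply U X F : open U -> smooth_field U X -> csmooth U F ->
  csmooth U (fapply X F).
Proof.
move=> oU /smooth_fieldP sX /csmoothP sF; apply/csmoothP => k.
by apply: (cCk_vapply oU _ (sF k.+1)) => a; have /csmoothP := sX a; exact.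
Qed.

Lemma csmooth_bracket U X Y : open U -> smooth_field U X -> smooth_field U Y ->
  smooth_field U (bracket X Y).
Proof.
move=> oU sX sY; apply/smooth_fieldP => a; apply/csmoothP => k.
have /smooth_fieldP/(_ a) sXa := sX; have /smooth_fieldP/(_ a) sYa := sY.
have /csmoothP c1 := csmooth_fapply oU sX sYa.
have /csmoothP c2 := csmooth_fapply oU sY sXa.
apply: (cCk_ext oU _ (cCkB oU (c1 k) (c2 k))) => x _.
by rewrite coef_bracket.
Qed.

Lemma csmooth_pairing U theta X : open U -> smooth_field U theta -> smooth_field U X ->
  csmooth U (fun x => pairing (theta x) (X x)).
Proof.
move=> oU /smooth_fieldP st /smooth_fieldP sX; apply/csmoothP => k.
apply: (cCk_ext oU) (_ : cCk k U (fun x => \sum_a coef (theta x) a * coef (X x) a)) => [x _|].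
  by rewrite pairingE.
apply: cCk_sum => [|a _]; first exact: oU.
apply: cCkM; first exact: oU.
  by have /csmoothP := st a; exact.
by have /csmoothP := sX a; exact.
Qed.

Lemma csmooth_cplx_Re U F : csmooth U F -> csmooth U (cplx (fun x => complex.Re (F x))).
Proof. by move=> [sR _]; apply/csmoothP => k; exact: cCk_cplx (sR k). Qed.

Definition is_section S U E X := section10 S U E X \/ section01 S U E X.

Definition sections S U E Ls := forall k, (k < size Ls)%N -> is_section S U E (nth (fun=> 0) Ls k).

Lemma sections_cons S U E X Ls :
  sections S U E (X :: Ls) <-> is_section S U E X /\ sections S U E Ls.
Proof.
split=> [H|[HX H] [|k]]; [split=> [|k kL]|by []|exact: H].
  exact: (H 0%N).
exact: (H k.+1).
Qed.

Lemma section_smooth S U E X : is_section S U E X -> smooth_field U X.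
Proof. by case=> -[]. Qed.

Lemma sections_sub S U V E Ls : V `<=` U -> sections S U E Ls -> sections S V E Ls.
Proof.
move=> VU H k /H[[sX HX]|[sX HX]]; [left|right]; split.
- exact: smooth_field_sub sX.
- by move=> p Sp /VU; exact: HX.
- exact: smooth_field_sub sX.
- by move=> p Sp /VU; exact: HX.
Qed.

Lemma csmooth_iter_contact S U E theta Ls : open U -> smooth_field U theta ->
  sections S U E Ls -> csmooth U (iter_contact theta Ls).
Proof.
move=> oU st; elim: Ls => [|X [|Y Ls] IH].
- by move=> _; apply/csmoothP => k; exact: cCk_cst.
- move=> /sections_cons[/section_smooth sX _]; apply: csmooth_fapply => //.
  by apply/csmoothP => k; exact: cCk_cst.
- move=> /sections_cons[/section_smooth sX sL].
  case: Ls IH sL => [|Z Ls] IH sL; last by apply: csmooth_fapply => //; exact: IH.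
  have /sections_cons[/section_smooth sY _] := sL.
  exact: csmooth_pairing oU st (csmooth_bracket oU sX sY).
Qed.

Lemma csmooth_dual_value S U E theta Ls L : open U -> smooth_field U theta ->
  sections S U E Ls -> smooth_field U L -> csmooth U (dual_value theta Ls L).
Proof.
move=> oU st sL HL; case: Ls sL => [|X [|Y Ls]] sL.
- by apply/csmoothP => k; exact: cCk_cst.
- have /sections_cons[/section_smooth sX _] := sL.
  exact: csmooth_pairing oU st (csmooth_bracket oU HL sX).
- apply: csmooth_fapply => //; apply: csmooth_cplx_Re.
  exact: csmooth_iter_contact st sL.
Qed.

Lemma section10_tangent S U E X x : section10 S U E X -> E x `<=` H10 S x -> S x -> U x ->
  ctangent S x (X x) /\ (X x).2 = 0.
Proof.
move=> [_ H] EH Sx Ux; have [X2 EX] := H x Sx Ux; split=> //.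
by have := EH _ EX; rewrite /H10 /= -X2 -surjective_pairing.
Qed.

Lemma conjvK (v : 'rV[C]_n) : conjv (conjv v) = v.
Proof. by apply/rowP => j; rewrite !mxE conjcK. Qed.

Lemma conjv0 : conjv (0 : 'rV[C]_n) = 0.
Proof. by apply/rowP => j; rewrite !mxE conjc0. Qed.

Lemma section01_tangent S U E X x : hypersurface S -> section01 S U E X ->
  E x `<=` H10 S x -> S x -> U x ->
  [/\ ctangent S x (X x), (X x).1 = 0 & H10 S x (conjv (X x).2)].
Proof.
move=> hS [_ H] EH Sx Ux; have [X1 EX] := H x Sx Ux; have hX := EH _ EX; split=> //.
have [W [rho [Srho Wx]]] := hS x Sx.
have := ctangent_conj Srho Sx Wx hX.
by rewrite /conj_vec [(_, _).1]/= [(_, _).2]/= conjv0 conjvK -X1 -surjective_pairing.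
Qed.

Lemma conj_section S U E X : open U -> section01 S U E X ->
  section10 S U E (fun x => conj_vec (X x)).
Proof.
move=> oU [/smooth_fieldP sX H]; split.
  apply/smooth_fieldP => a; apply/csmoothP => k.
  have /csmoothP/(_ k) c := sX (~~ a.1, a.2).
  by apply: (cCk_ext oU _ (cCk_conj oU c)) => x _; rewrite coef_conj_vec.
by move=> x Sx Ux; have [X1 EX] := H x Sx Ux; split; [rewrite /= X1 conjv0|].
Qed.

Section Contact.
Variables (S U : set (cspace R n)) (theta : field).
Hypotheses (hS : hypersurface S) (htheta : contact_form S U theta).

Lemma contact10 x (v : 'rV[C]_n) : S x -> U x -> H10 S x v -> pairing (theta x) (v, 0) = 0.
Proof. by move=> Sx Ux Hv; have [_ /(_ x Sx Ux)[_ /(_ v Hv)[]]] := htheta. Qed.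

Lemma contact01 x (v : 'rV[C]_n) : S x -> U x -> H10 S x (conjv v) ->
  pairing (theta x) (0, v) = 0.
Proof.
move=> Sx Ux Hv; have [_ /(_ x Sx Ux)[_ /(_ _ Hv)[_]]] := htheta.
by rewrite conjvK.
Qed.

Lemma fapply_coef0 V X Y x a : open V -> V x -> S x -> ctangent S x (X x) ->
  smooth_field V Y -> (forall y, S y -> V y -> coef (Y y) a = 0) ->
  fapply X (fun y => coef (Y y) a) x = 0.
Proof.
move=> oV Vx Sx tX /smooth_fieldP/(_ a)/csmoothP/(_ 1%N) sY Y0.
have [W [rho [Srho Wx]]] := hS Sx.
exact: (ctangent_vapply0 Srho Sx Wx tX oV Vx sY Y0).
Qed.

Lemma contact_bracket10 V L L1 x : open V -> V x -> V `<=` U -> S x ->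
  section10 S V (H10 S) L -> section10 S V (H10 S) L1 ->
  pairing (theta x) (bracket L L1 x) = 0.
Proof.
move=> oV Vx VU Sx sL sL1; have Ux := VU x Vx.
have tL y : S y -> V y -> ctangent S y (L y) /\ (L y).2 = 0.
  exact: section10_tangent sL (@subset_refl _ _).
have tL1 y : S y -> V y -> ctangent S y (L1 y) /\ (L1 y).2 = 0.
  exact: section10_tangent sL1 (@subset_refl _ _).
have B2 : (bracket L L1 x).2 = 0.
  apply/rowP => j; rewrite [RHS]mxE.
  have := coef_bracket L L1 x (false, j); rewrite /coef /= => ->.
  rewrite (@fapply_coef0 V L L1 x (false, j)) ?(@fapply_coef0 V L1 L x (false, j)) ?subrr//.
  - by have [] := tL1 x Sx Vx.
  - exact: (proj1 sL).
  - by move=> y Sy Vy; rewrite /coef /=; have [_ ->] := tL y Sy Vy; rewrite mxE.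
  - by have [] := tL x Sx Vx.
  - exact: (proj1 sL1).
  - by move=> y Sy Vy; rewrite /coef /=; have [_ ->] := tL1 y Sy Vy; rewrite mxE.
have tB : ctangent S x (bracket L L1 x).
  apply: (bracket_tangent hS oV Vx Sx (proj1 sL) (proj1 sL1)) => y Sy Vy.
    by have [] := tL y Sy Vy.
  by have [] := tL1 y Sy Vy.
have E : bracket L L1 x = ((bracket L L1 x).1, 0) by rewrite [LHS]surjective_pairing B2.
rewrite E in tB *; exact: contact10 Sx Ux tB.
Qed.

Lemma contact_bracket01 V L L1 x : open V -> V x -> V `<=` U -> S x ->
  section01 S V (H10 S) L -> section01 S V (H10 S) L1 ->
  pairing (theta x) (bracket L L1 x) = 0.
Proof.
move=> oV Vx VU Sx sL sL1; have Ux := VU x Vx.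
have tL y : S y -> V y -> [/\ ctangent S y (L y), (L y).1 = 0 & H10 S y (conjv (L y).2)].
  exact: section01_tangent hS sL (@subset_refl _ _).
have tL1 y : S y -> V y -> [/\ ctangent S y (L1 y), (L1 y).1 = 0 & H10 S y (conjv (L1 y).2)].
  exact: section01_tangent hS sL1 (@subset_refl _ _).
have B1 : (bracket L L1 x).1 = 0.
  apply/rowP => j; rewrite [RHS]mxE.
  have := coef_bracket L L1 x (true, j); rewrite /coef /= => ->.
  rewrite (@fapply_coef0 V L L1 x (true, j)) ?(@fapply_coef0 V L1 L x (true, j)) ?subrr//.
  - by have [] := tL1 x Sx Vx.
  - exact: (proj1 sL).
  - by move=> y Sy Vy; rewrite /coef /=; have [_ -> _] := tL y Sy Vy; rewrite mxE.
  - by have [] := tL x Sx Vx.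
  - exact: (proj1 sL1).
  - by move=> y Sy Vy; rewrite /coef /=; have [_ -> _] := tL1 y Sy Vy; rewrite mxE.
have tB : ctangent S x (bracket L L1 x).
  apply: (bracket_tangent hS oV Vx Sx (proj1 sL) (proj1 sL1)) => y Sy Vy.
    by have [] := tL y Sy Vy.
  by have [] := tL1 y Sy Vy.
have E : bracket L L1 x = (0, (bracket L L1 x).2) by rewrite [LHS]surjective_pairing B1.
rewrite E; apply: contact01 => //.
have [W [rho [Srho Wx]]] := hS Sx.
have := ctangent_conj Srho Sx Wx tB; rewrite /conj_vec B1 conjv0.
exact.
Qed.

(** Modulo vectors killed by [theta], the bracket is the Levi form times [w - conj w], where [w] is
    a (1,0) vector with [w rho = 1]. Hence [kappa] is the same for all fields. *)
Lemma contact_bracket_levi p W rho : S p -> U p -> defining_function S W rho -> W p ->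
  exists kappa : C, forall V L L1, open V -> V p -> V `<=` U ->
    section10 S V (H10 S) L -> section01 S V (H10 S) L1 ->
    pairing (theta p) (bracket L L1 p) =
      kappa * sesq (complex_hessian rho p) (L p).1 (conjv (L1 p).2).
Proof.
move=> Sp Up Srho Wp; have [w w1] := exists_normal Srho Sp Wp.
have [oW srho _ _] := Srho.
exists (pairing (theta p) (w, 0) - pairing (theta p) (0, conjv w)).
move=> V L L1 oV Vp VU sL sL1.
have tL y : S y -> V y -> ctangent S y (L y) /\ (L y).2 = 0.
  exact: section10_tangent sL (@subset_refl _ _).
have tL1 y : S y -> V y -> ctangent S y (L1 y) /\ (L1 y).1 = 0.
  by move=> Sy Vy; have [? ?] := section01_tangent hS sL1 (@subset_refl _ _) Sy Vy.
have B1 := bracket_levi Srho oV Vp Wp Sp (proj1 sL) (proj1 sL1) tL tL1.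
set lev := sesq _ _ _ in B1 *.
have tB : ctangent S p (bracket L L1 p).
  apply: (bracket_tangent hS oV Vp Sp (proj1 sL) (proj1 sL1)) => y Sy Vy.
    by have [] := tL y Sy Vy.
  by have [] := tL1 y Sy Vy.
set B := bracket L L1 p in B1 tB *.
have B2 : vapply (0, B.2) (cplx rho) p = - lev.
  have := (ctangentP Srho Sp Wp B).1 tB.
  by rewrite vapply_split B1 addrC => /eqP; rewrite addr_eq0 => /eqP.
have v1 : H10 S p ((- lev) *: w + B.1).
  apply/(H10P Srho Sp Wp).
  have := vapply_linear p (cplx rho) (- lev) (w, 0) (B.1, 0).
  by rewrite /= scaler0 addr0 => ->; rewrite w1 mulr1 B1 addNr.
have v2 : H10 S p (conjv (lev *: conjv w + B.2)).
  have tw : ctangent S p (0, lev *: conjv w + B.2).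
    apply/(ctangentP Srho Sp Wp).
    have := vapply_linear p (cplx rho) lev (0, conjv w) (0, B.2).
    rewrite /= scaler0 addr0 => ->; rewrite B2.
    have := vapply_cplx_conj (w, 0) oW (srho 1%N) Wp.
    by rewrite /conj_vec /= conjv0 w1 conjc1 => ->; rewrite mulr1 subrr.
  by have := ctangent_conj Srho Sp Wp tw; rewrite /conj_vec /= conjv0.
have := contact10 Sp Up v1; have := contact01 Sp Up v2.
have := pairing_linear (theta p) (w, 0) (B.1, 0) (- lev).
rewrite /= scaler0 addr0 => ->.
have := pairing_linear (theta p) (0, conjv w) (0, B.2) lev.
rewrite /= scaler0 addr0 => -> => /eqP; rewrite addrC addr_eq0 => /eqP E2.
move=> /eqP; rewrite addrC addr_eq0 => /eqP E1.
by rewrite pairing_split E1 E2; ring.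
Qed.

End Contact.

End Sections.

(** * Dual forms and towers *)

Section DualForms.
Variables (R : realType) (n : nat).
Local Notation C := R[i].
Local Notation field := (cspace R n -> covec R n).
Implicit Types (p x : cspace R n) (V : set (cspace R n)) (X Y L : field) (Ls : seq field).

Lemma subbundle_fiber S U (E : cspace R n -> set 'rV[C]_n) x :
  complex_subbundle S U E -> S x -> U x ->
  E x `<=` H10 S x /\ exists r (M : 'M[C]_(r, n)), row_free M /\ E x = [set v | (v <= M)%MS].
Proof.
move=> HE Sx Ux; have [V [r [e [_ Vx _ _ /(_ x Sx Vx)[EH fe eE]]]]] := HE x Sx Ux.
by split=> //; exists r, (e x).
Qed.

Lemma subbundle_sub S U V (E : cspace R n -> set 'rV[C]_n) : open V -> V `<=` U ->
  complex_subbundle S U E -> complex_subbundle S V E.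
Proof.
move=> oV VU HE p Sp Vp; have [W [r [e [oW Wp WU se He]]]] := HE p Sp (VU p Vp).
exists (W `&` V), r, e; split=> //.
- exact: openI.
- by move=> k l; apply: csmooth_sub (se k l) => x [].
- by move=> x Sx [Wx _]; exact: He.
Qed.

Variables (S U : set (cspace R n)) (theta : field) (E : cspace R n -> set 'rV[C]_n).
Hypotheses (hS : hypersurface S) (oU : open U) (htheta : contact_form S U theta).
Hypothesis HE : complex_subbundle S U E.

Let EH x : S x -> U x -> E x `<=` H10 S x.
Proof. by move=> Sx Ux; have [] := subbundle_fiber HE Sx Ux. Qed.

Lemma section10_H10 V X : V `<=` U -> section10 S U E X -> section10 S V (H10 S) X.
Proof.
move=> VU [sX H]; split; first exact: smooth_field_sub VU sX.
by move=> x Sx /VU Ux; have [X2 EX] := H x Sx Ux; split=> //; exact: EH EX.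
Qed.

Lemma section01_H10 V X : V `<=` U -> section01 S U E X -> section01 S V (H10 S) X.
Proof.
move=> VU [sX H]; split; first exact: smooth_field_sub VU sX.
by move=> x Sx /VU Ux; have [X1 EX] := H x Sx Ux; split=> //; exact: EH EX.
Qed.

(** Treats both types of [L1] alike: for a (1,0) field the bracket is again of type (1,0), and
    [kappa] is 0. *)
Lemma dual_value1 p W rho L1 : S p -> U p -> defining_function S W rho -> W p ->
  is_section S U E L1 -> exists (kappa : C) (w : 'rV[C]_n), H10 S p w /\
    forall V L, open V -> V `<=` U -> V p -> section10 S V (H10 S) L ->
      dual_value theta [:: L1] L p = kappa * sesq (complex_hessian rho p) (L p).1 w.
Proof.
move=> Sp Up Srho Wp [s10|s01].
  exists 0, 0; split; first by apply/(H10P Srho Sp Wp); rewrite vapply_gradz big1// => j _;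
    rewrite mxE mul0r.
  move=> V L oV VU Vp sL; rewrite mul0r /=.
  exact: (contact_bracket10 hS htheta oV Vp VU Sp sL (section10_H10 VU s10)).
have [kappa Hk] := contact_bracket_levi hS htheta Sp Up Srho Wp.
exists kappa, (conjv (L1 p).2); split.
  by have [_ H] := s01; have [_ EX] := H p Sp Up; exact: EH EX.
move=> V L oV VU Vp sL; exact: (Hk V L L1 oV Vp VU sL (section01_H10 VU s01)).
Qed.

Lemma dual_value_iter Ls L p : (1 < size Ls)%N -> (L p).2 = 0 ->
  dual_value theta Ls L p =
    vapply ((L p).1, 0) (cplx (fun x => complex.Re (iter_contact theta Ls x))) p.
Proof.
case: Ls => [|X [|Y Ls]] // _ L2; rewrite /dual_value /fapply.
by rewrite -[in RHS]L2 -surjective_pairing.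
Qed.

(** [is_dual_form] prescribes values only through sections. They come from a form because the value
    at [p] depends linearly on [L p] alone: through the Levi form for a single field, through the
    differential of a real function otherwise. *)
Lemma dual_form_exists Ls : Ls != [::] -> sections S U E Ls ->
  exists omega : cspace R n -> 'rV[C]_n -> C, is_dual_form S U theta Ls omega /\
    forall p, S p -> U p -> forall c u v, omega p (c *: u + v) = c * omega p u + omega p v.
Proof.
move=> Ls0 sLs.
have /choice[omega Ho] p : exists w : 'rV[C]_n -> C, S p -> U p ->
    (forall V L, open V -> V `<=` U -> V p -> section10 S V (H10 S) L ->
       w (L p).1 = dual_value theta Ls L p) /\
    forall c u v, w (c *: u + v) = c * w u + w v.
  have [Sp|] := pselect (S p); last by exists (fun=> 0).
  have [Up|] := pselect (U p); last by exists (fun=> 0).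
  have [one|two] := leqP (size Ls) 1; last first.
    exists (fun v => vapply (v, 0) (cplx (fun x => complex.Re (iter_contact theta Ls x))) p).
    move=> _ _; split=> [V L oV VU Vp sL|c u v].
      have [_ L2] := section10_tangent sL (@subset_refl _ _) Sp Vp.
      by rewrite dual_value_iter.
    set F := cplx _.
    by have := vapply_linear p F c (u, 0) (v, 0); rewrite /= scaler0 addr0.
  case: Ls Ls0 sLs one => [|L1 [|//]] // _ sLs _.
  have [W [rho [Srho Wp]]] := hS Sp.
  have /sections_cons[sL1 _] := sLs.
  have [kappa [w [_ H]]] := dual_value1 Sp Up Srho Wp sL1.
  exists (fun v => kappa * sesq (complex_hessian rho p) v w) => _ _; split.
    by move=> V L oV VU Vp sL; rewrite (H V L).
  by move=> c u v; rewrite sesq_linear mulrDr mulrCA.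
exists omega; split=> [V L oV VU sL p Sp Vp|p Sp Up].
  by have [H _] := Ho p Sp (VU p Vp); exact: H V L oV VU Vp sL.
by have [_] := Ho p Sp Up.
Qed.

Definition scale_field (c : C) X : field := fun x => (c *: (X x).1, c *: (X x).2).

Lemma coef_scale_field c X x a : coef (scale_field c X x) a = c * coef (X x) a.
Proof. by case: a => [[] j]; rewrite /coef /= !mxE. Qed.

Lemma scale_section c X : is_section S U E X -> is_section S U E (scale_field c X).
Proof.
have sm : smooth_field U X -> smooth_field U (scale_field c X).
  move=> /smooth_fieldP sX; apply/smooth_fieldP => a; apply/csmoothP => k.
  have /csmoothP/(_ k) H := sX a.
  by apply: (cCk_ext oU _ (cCkZ c oU H)) => x _; rewrite coef_scale_field.
have E0 x v b : S x -> U x -> E x v -> E x (b *: v).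
  move=> Sx Ux Ev; have [_ [r [M [_ EM]]]] := subbundle_fiber HE Sx Ux.
  by move: Ev; rewrite EM /= => Ev; exact: scalemx_sub.
case=> -[sX H]; [left|right]; split.
- exact: sm.
- by move=> x Sx Ux; have [X2 EX] := H x Sx Ux; rewrite /= X2 scaler0; split=> //; exact: E0.
- exact: sm.
- move=> x Sx Ux; have [X1 EX] := H x Sx Ux; rewrite /= X1 scaler0; split=> //.
  by rewrite map_mxZ; exact: E0.
Qed.

Lemma vapply_scale c X F x : vapply (scale_field c X x) F x = c * vapply (X x) F x.
Proof.
rewrite !vapplyE mulr_sumr; apply: eq_bigr => a _.
by rewrite coef_scale_field mulrA.
Qed.

Lemma fapply_ext F G X x : U x -> (forall y, U y -> F y = G y) ->
  fapply X F x = fapply X G x.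
Proof. by move=> Ux e; exact: vapply_ext oU Ux e. Qed.

(* Scale [L^2]: the constant passes through all the derivations. *)
Lemma iter_contact_scale c Ls : (1 < size Ls)%N -> sections S U E Ls ->
  exists Ls', [/\ size Ls' = size Ls, sections S U E Ls' &
    forall x, U x -> iter_contact theta Ls' x = c * iter_contact theta Ls x].
Proof.
elim: Ls => // X Ls IH; case: Ls IH => [|Y [|Z Ls]] // IH _ sLs.
  have /sections_cons[sX sY] := sLs; have /sections_cons[sY1 _] := sY.
  exists [:: scale_field c X; Y]; split=> //.
    by apply/sections_cons; split=> //; exact: scale_section.
  move=> x Ux; rewrite [LHS]pairingE [X in _ = c * X]pairingE mulr_sumr.
  apply: eq_bigr => a _; rewrite [RHS]mulrCA; congr (_ * _).
  rewrite [LHS]coef_bracket [X in _ = c * X]coef_bracket mulrBr; congr (_ - _).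
    by rewrite /fapply vapply_scale.
  have /smooth_fieldP/(_ a)/csmoothP/(_ 1%N) cX := section_smooth sX.
  rewrite /fapply -(vapplyZ (Y x) c oU cX Ux).
  by apply: (vapply_ext _ oU Ux) => y _; rewrite coef_scale_field.
have /sections_cons[sX sL] := sLs.
have [Ls' [sz sL' E']] := IH isT sL.
exists (X :: Ls'); split; first by rewrite /= sz.
  by apply/sections_cons.
move=> x Ux.
have -> : iter_contact theta (X :: Ls') x = fapply X (iter_contact theta Ls') x.
  by case: Ls' sz {sL' E'} => [|? [|? ?]].
have -> : iter_contact theta [:: X, Y, Z & Ls] x =
  fapply X (iter_contact theta [:: Y, Z & Ls]) x by [].
rewrite (fapply_ext X Ux E').
have /csmoothP/(_ 1%N) cI := csmooth_iter_contact oU (proj1 htheta) sL.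
exact: (vapplyZ (X x) c oU cI Ux).
Qed.

(* Contrapositively: the function [f] defining a dual form of order [t >= 3]
   vanishes wherever all dual forms of lower order do. *)
Lemma lower_order Ls x : (1 < size Ls)%N -> sections S U E Ls -> S x -> U x ->
  complex.Re (iter_contact theta Ls x) != 0 ->
  exists Ls' L0, [/\ (0 < size Ls' < size Ls)%N, sections S U E Ls',
    section10 S U E L0 & dual_value theta Ls' L0 x != 0].
Proof.
move=> sz sLs Sx Ux HRe.
have {}HRe : iter_contact theta Ls x != 0 by apply: contra HRe => /eqP ->.
case: Ls sz sLs HRe => [|X [|Y [|Z Ls]]] // _ sLs.
  have /sections_cons[sX sYs] := sLs; have /sections_cons[sY _] := sYs => nz.
  (* With two fields, one is of type (1,0), since contact forms kill brackets of (0,1) fields. It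
     serves as the argument of the order 2 form of the other, up to the sign of a swap. *)
  have [X10|X01] := sX; first by exists [:: Y], X.
  have [Y10|Y01] := sY; last first.
    move: nz; rewrite /= (contact_bracket01 hS htheta oU Ux (@subset_refl _ _) Sx) ?eqxx//.
      exact: section01_H10 X01.
    exact: section01_H10 Y01.
  exists [:: X], Y; split; [by []|by apply/sections_cons; split|exact: Y10|].
  have anti : pairing (theta x) (bracket Y X x) = - pairing (theta x) (bracket X Y x).
    rewrite [LHS]pairingE [X in - X]pairingE -sumrN; apply: eq_bigr => a _.
    rewrite [in LHS]coef_bracket [in RHS]coef_bracket -mulrN opprB; reflexivity.
  by rewrite [dual_value _ _ _ _]anti oppr_eq0.
have /sections_cons[sX sL] := sLs.
have -> : iter_contact theta [:: X, Y, Z & Ls] x =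
  fapply X (iter_contact theta [:: Y, Z & Ls]) x by [].
set Ls1 := [:: Y, Z & Ls] in sL *.
have HI := csmooth_iter_contact oU (proj1 htheta) sL.
(* On a real function a (0,1) field and its conjugate (1,0) field have conjugate derivatives, so
   either type of [X] yields a (1,0) argument. *)
have key Ls' : size Ls' = size Ls1 -> sections S U E Ls' ->
    vapply (X x) (cplx (fun y => complex.Re (iter_contact theta Ls' y))) x != 0 ->
    exists Ls'' L0, [/\ (0 < size Ls'' < size [:: X, Y, Z & Ls])%N, sections S U E Ls'',
      section10 S U E L0 & dual_value theta Ls'' L0 x != 0].
  move=> sz sL' nz; have HI' := csmooth_iter_contact oU (proj1 htheta) sL'.
  have dE L0 : dual_value theta Ls' L0 x =
      vapply (L0 x) (cplx (fun y => complex.Re (iter_contact theta Ls' y))) x.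
    by case: Ls' sz {sL' nz HI'} => [|? [|? ?]].
  have szE : (0 < size Ls' < size [:: X, Y, Z & Ls])%N by rewrite sz /= ltnSn.
  have [X10|X01] := sX; first by exists Ls', X; rewrite dE.
  exists Ls', (fun y => conj_vec (X y)); rewrite dE; split=> //.
    exact: conj_section.
  rewrite (vapply_cplx_conj (X x) oU (proj1 HI' 1%N) Ux) conjc_eq0 //.
have /csmoothP/(_ 1%N) cI := HI.
rewrite /fapply (vapply_Re_Im (X x) oU cI Ux) => nz.
have [Re0|ReN] := eqVneq (vapply (X x) (cplx (fun y => complex.Re (iter_contact theta Ls1 y))) x) 0;
  last exact: key ReN.
move: nz; rewrite Re0 add0r mulf_eq0 negb_or => /andP[_ ImN].
(* Dual forms only involve real parts; multiplication by [- i] turns the imaginary part into a real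
   part. *)
have [Ls' [sz sL' E']] := @iter_contact_scale (- 'i%C) Ls1 isT sL.
apply: (key Ls' sz sL'); apply: contra ImN => /eqP H; rewrite -H; apply/eqP.
apply: (vapply_ext _ oU Ux) => y Uy; rewrite /cplx E'//.
by case: (iter_contact _ _ _) => a b /=; congr (Complex _ _); ring.
Qed.

End DualForms.

(** * Frames of the kernel of a linear form *)

Section KernelFrame.
Variables (F : fieldType) (r n : nat) (phi : 'rV[F]_n -> F).
Hypothesis phi_linear : forall c u v, phi (c *: u + v) = c * phi u + phi v.

Let phi0 : phi 0 = 0.
Proof.
have := phi_linear 1 0 0; rewrite scaler0 addr0 mul1r => /eqP.
by rewrite addrC -subr_eq subrr eq_sym => /eqP.
Qed.

Let phi_sum (m : nat) (u : 'rV[F]_m) (A : 'M[F]_(m, n)) :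
  phi (u *m A) = \sum_l u 0 l * phi (row l A).
Proof.
rewrite mulmx_sum_row; elim/big_rec2: _ => // l y1 y2 _ <-.
exact: phi_linear.
Qed.

(** Elimination with pivot [i], kept free of division so that the entries are polynomial, hence
    smooth, in [e] and [a]. *)
Definition kernel_frame (e : 'M[F]_(r.+1, n)) (a : 'I_r.+1 -> F) (i : 'I_r.+1) : 'M[F]_(r, n) :=
  \matrix_j (a i *: row (lift i j) e - a (lift i j) *: row i e).

Lemma kernel_frameP (e : 'M[F]_(r.+1, n)) i (a := fun l => phi (row l e)) :
  a i != 0 -> row_free e ->
  row_free (kernel_frame e a i) /\
  forall v, (v <= kernel_frame e a i)%MS <-> (v <= e)%MS /\ phi v = 0.
Proof.
move=> ai fe; set e' := kernel_frame e a i.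
have row_e' j : row j e' = a i *: row (lift i j) e - a (lift i j) *: row i e.
  by rewrite rowK.
have phi_e' j : phi (row j e') = 0.
  have := phi_linear (a i) (row (lift i j) e) (- a (lift i j) *: row i e).
  rewrite row_e' scaleNr => ->; rewrite -scaleNr.
  have := phi_linear (- a (lift i j)) (row i e) 0; rewrite addr0 phi0 addr0 => ->.
  by rewrite -/(a (lift i j)) -/(a i) mulNr mulrC subrr.
split.
  pose M : 'M[F]_(r, r.+1) :=
    \matrix_j (a i *: delta_mx 0 (lift i j) - a (lift i j) *: delta_mx 0 i).
  have e'E : e' = M *m e.
    apply/row_matrixP => j; rewrite row_e' row_mul rowK mulmxBl -!scalemxAl.
    by rewrite -!rowE.
  apply: inj_row_free => u; rewrite e'E mulmxA => /eqP.
  rewrite mulmx_free_eq0// => /eqP uM; apply/rowP => j; rewrite mxE.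
  have := congr1 (fun w : 'rV[F]_r.+1 => w 0 (lift i j)) uM; rewrite !mxE (bigD1 j)//= big1.
    rewrite !mxE !eqxx /= eq_sym (negbTE (neq_lift i j)) mulr0 subr0 mulr1 addr0.
    by move/eqP; rewrite mulf_eq0 (negbTE ai) orbF => /eqP.
  move=> k kj; rewrite !mxE eqxx /= (inj_eq lift_inj) eq_sym (negbTE kj) mulr0.
  by rewrite eq_sym (negbTE (neq_lift i j)) mulr0 subr0 mulr0.
move=> v; split=> [/submxP[w ->]|[/submxP[u ->] phiu]].
  split; last by rewrite phi_sum big1// => j _; rewrite phi_e' mulr0.
  apply/mulmx_sub/row_subP => j; rewrite row_e' -scaleNr addmx_sub// scalemx_sub//; exact: row_sub.
(* The condition that [phi] kills [u e], solved for the pivot term. *)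
have Eu : \sum_j u 0 (lift i j) * a (lift i j) = - (u 0 i * a i).
  apply/eqP; rewrite -addr_eq0 addrC; apply/eqP; rewrite -[RHS]phiu phi_sum.
  by rewrite (bigD1_ord i).
have -> : u *m e = \sum_j (u 0 (lift i j) / a i) *: row j e'.
  rewrite mulmx_sum_row (bigD1_ord i)//=.
  under [RHS]eq_bigr do rewrite row_e' scalerBr !scalerA divfK// mulrAC.
  rewrite sumrB -scaler_suml -mulr_suml Eu mulNr mulfK// scaleNr opprK addrC //.
by apply: summx_sub => j _; rewrite scalemx_sub// row_sub.
Qed.

End KernelFrame.

(** * Towers of smaller multi-order *)

Section LowerTower.
Variables (R : realType) (n : nat).
Local Notation C := R[i].
Local Notation field := (cspace R n -> covec R n).
Implicit Types (p x : cspace R n) (V : set (cspace R n)) (X Y L : field) (Ls : seq field).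

Lemma contact_form_sub (S U V : set (cspace R n)) (theta : field) : V `<=` U ->
  contact_form S U theta -> contact_form S V theta.
Proof.
move=> VU [st H]; split; first exact: smooth_field_sub VU st.
by move=> p Sp /VU; exact: H.
Qed.

Lemma dual_of_order_sub (S U V : set (cspace R n)) (theta : field) E t omega : V `<=` U ->
  dual_of_order S U theta E t omega -> dual_of_order S V theta E t omega.
Proof.
move=> VU [t2 [Ls [sz sL dL]]]; split=> //; exists Ls; split=> //.
  exact: sections_sub VU sL.
by move=> W L oW WV; apply: dL => //; exact: subset_trans VU.
Qed.

(** On the rows of a local frame, completed by zero (0,1) parts to sections, [omega] is given by
    [dual_value] and is therefore smooth along S; elimination where a pivot is nonzero then gives a
    smooth frame of the kernel. *)
Lemma kernel_subbundle (S U : set (cspace R n)) (theta : field)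
    (E : cspace R n -> set 'rV[C]_n) Ls omega :
  contact_form S U theta -> complex_subbundle S U E -> sections S U E Ls ->
  is_dual_form S U theta Ls omega ->
  (forall p, S p -> U p -> forall c u v, omega p (c *: u + v) = c * omega p u + omega p v) ->
  (forall p, S p -> U p -> exists2 v, E p v & omega p v != 0) ->
  complex_subbundle S U (fun p => E p `&` [set v | omega p v = 0]).
Proof.
move=> htheta HE sL dL lin nz p Sp Up.
have [V [r [e [oV Vp VU se He]]]] := HE p Sp Up.
have [v0 Ev0 ov0] := nz p Sp Up.
pose Lf l : field := fun x => (row l (e x), 0).
have sLf l : section10 S V (H10 S) (Lf l).
  split.
    split=> [k j|k j].
      by apply: csmooth_ext (se l j) => // x _; rewrite mxE.
    apply: (csmooth_ext (F := fun=> 0)) => //; first by move=> x _; rewrite mxE.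
    by apply/csmoothP => m; exact: cCk_cst.
  move=> x Sx Vx; split=> //; have [EH _ eE] := He x Sx Vx.
  by apply: EH; rewrite eE /=; exact: row_sub.
pose al l x := dual_value theta Ls (Lf l) x.
have sal l : csmooth V (al l).
  apply: csmooth_dual_value => //.
  - exact: smooth_field_sub VU (proj1 htheta).
  - exact: sections_sub VU sL.
  - exact: (proj1 (sLf l)).
have alE l x : S x -> V x -> omega x (row l (e x)) = al l x.
  by move=> Sx Vx; exact: (dL V (Lf l) oV VU (sLf l) x Sx Vx).
(* A zero fibre is excluded because [omega] is nonzero on some vector of it. *)
case: r => [|r] in e se He Lf sLf al sal alE *.
  have v00 : v0 = 0.
    have [_ _ eE] := He p Sp Vp; move: Ev0; rewrite eE /= => /submxP[u ->].
    by rewrite [u]thinmx0 mul0mx.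
  have := lin p Sp Up 1 0 0; rewrite scaler0 addr0 mul1r => /eqP.
  rewrite addrC -subr_eq subrr => /eqP o0.
  by move: ov0; rewrite v00 -o0 eqxx.
have [i ali] : exists i, al i p != 0.
  apply: contrapT => /forallNP H; move/eqP: ov0; apply.
  have [_ _ eE] := He p Sp Vp; move: Ev0; rewrite eE /= => /submxP[u ->].
  rewrite mulmx_sum_row.
  have o0 : omega p 0 = 0.
    have := lin p Sp Up 1 0 0; rewrite scaler0 addr0 mul1r => /eqP.
    by rewrite addrC -subr_eq subrr eq_sym => /eqP.
  elim/big_rec: _ => // l y _ y0; rewrite (lin p Sp Up) y0 addr0 (alE l p Sp Vp).
  by have /negP/negPn/eqP -> := H l; rewrite mulr0.
pose N x := normsq (al i x).
have sN : Ck 0 V N.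
  have [a b] := sal i;
    apply: (Ck_ext oV _ (CkD oV (CkM oV (a 0%N) (a 0%N)) (CkM oV (b 0%N) (b 0%N)))).
  by move=> x _; rewrite /N /normsq !expr2.
exists (V `&` N @^-1` [set y | 0 < y]), r, (fun x => kernel_frame (e x) (fun l => al l x) i).
split.
- apply: Ck_open_preimage sN _ => //; exact: open_gt.
- by split=> //=; rewrite /N lt_def normsq_ge0 normsq_eq0 ali.
- by move=> x [/VU].
- move=> k j; apply: (@csmooth_sub _ _ V); first by move=> x [].
  apply: (csmooth_ext (F := fun x => al i x * e x (lift i k) j - al (lift i k) x * e x i j)) => //.
    by move=> x _; rewrite !mxE.
  apply/csmoothP => m; have /csmoothP ci := sal i; have /csmoothP ck := sal (lift i k).
  have /csmoothP e1 := se (lift i k) j; have /csmoothP e2 := se i j.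
  exact: cCkB oV (cCkM oV (ci m) (e1 m)) (cCkM oV (ck m) (e2 m)).
- move=> x Sx [Vx Nx]; have [EH fe eE] := He x Sx Vx.
  have aliN : omega x (row i (e x)) != 0.
    by rewrite (alE i x Sx Vx) -normsq_eq0 gt_eqF.
  have -> : kernel_frame (e x) (fun l => al l x) i =
    kernel_frame (e x) (fun l => omega x (row l (e x))) i.
    by congr (kernel_frame (e x) _ i); apply/funext => l; exact/esym/alE.
  have [f' H] := kernel_frameP (lin x Sx (VU x Vx)) aliN fe.
  split=> //; first by move=> v [/EH].
  by apply/seteqP; split=> v /=; rewrite eE /= => Hv; exact/H.
Qed.

(** The tower is cut at level [k], its form there is replaced by one of lower order, and all later
    entries become infinite: the lexicographic order is decided at the first difference. *)
Lemma lower_tower (S U : set (cspace R n)) (theta : field) (t : n.-1.-tuple (option nat)) m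
    (E : nat -> cspace R n -> set 'rV[C]_n)
    (omega : nat -> cspace R n -> 'rV[C]_n -> C) k x Ls L0 s0 :
  hypersurface S -> open U -> contact_form S U theta ->
  (m <= n.-1)%N -> (forall j, (j <= m)%N -> complex_subbundle S U (E j)) ->
  (forall p, S p -> U p -> E 0%N p = H10 S p) ->
  (forall j, (j < m)%N ->
          (exists2 s, nth None t j = Some s &
             dual_of_order S U theta (E j) s (omega j)) /\
          (forall p, S p -> U p ->
             (exists2 v, E j p v & omega j p v != 0) /\
             E j.+1 p = E j p `&` [set v | omega j p v = 0])) ->
  (k < m)%N -> S x -> U x -> nth None t k = Some s0 -> (0 < size Ls < s0.-1)%N ->
  sections S U (E k) Ls -> section10 S U (E k) L0 -> dual_value theta Ls L0 x != 0 ->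
  exists t' : n.-1.-tuple (option nat), tower_multiorder S x t' /\ lex_lt t' t.
Proof.
move=> hS oU htheta mn HE E0 Hom km Sx Ux tk /andP[sz0 szs] sLs sL0 nz.
(* A dual form of order [s] is built from [s - 1] fields. *)
pose s := (size Ls).+1.
pose f j := if (j < k)%N then nth None t j else if j == k then Some s else None.
have kn : (k < n.-1)%N by exact: leq_trans km mn.
exists [tuple of mkseq f n.-1]; split; last first.
  exists k => /=.
    by move=> j jk; rewrite nth_mkseq ?(ltn_trans jk kn)// /f jk.
  rewrite nth_mkseq// /f ltnn eqxx tk /= /s.
  by case: (s0) szs.
have EkH := HE k (ltnW km).
have [om [dom lin]] : exists om : cspace R n -> 'rV[C]_n -> C, is_dual_form S U theta Ls om /\
    forall p, S p -> U p -> forall c u v, om p (c *: u + v) = c * om p u + om p v.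
  apply: (dual_form_exists hS htheta EkH _ sLs).
  by rewrite -size_eq0 -lt0n.
have sd : csmooth U (dual_value theta Ls L0).
  exact: csmooth_dual_value oU (proj1 htheta) sLs (proj1 sL0).
pose N y := normsq (dual_value theta Ls L0 y).
have sN : Ck 0 U N.
  have [a b] := sd; apply: (Ck_ext oU _ (CkD oU (CkM oU (a 0%N) (a 0%N)) (CkM oU (b 0%N) (b 0%N)))).
  by move=> y _; rewrite /N /normsq !expr2.
(* The new form must be nonzero on every fibre of [E k], so the tower is restricted to where [L0]
   witnesses this. *)
pose V := U `&` N @^-1` [set y | 0 < y].
have oV : open V by apply: Ck_open_preimage sN _ => //; exact: open_gt.
have VU : V `<=` U by move=> y [].
have htV := contact_form_sub VU htheta.
have domV : is_dual_form S V theta Ls om.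
  by move=> W L oW WV; apply: dom => //; exact: subset_trans VU.
have sLH : section10 S U (H10 S) L0 by exact: section10_H10 EkH U L0 (@subset_refl _ _) sL0.
have nzV p : S p -> V p -> exists2 v, E k p v & om p v != 0.
  move=> Sp [Up Np]; exists (L0 p).1; first by have [_ /(_ p Sp Up)[]] := sL0.
  rewrite (dom U L0 oU (@subset_refl _ _) sLH p Sp Up) -normsq_eq0 gt_eqF//.
exists V, theta; split=> //.
  by split=> //=; rewrite /N lt_def normsq_ge0 normsq_eq0 nz.
exists k.+1, (fun j => if (j <= k)%N then E j else fun p => E k p `&` [set v | om p v = 0]),
  (fun j => if (j < k)%N then omega j else om).
split=> //.
- move=> j jk; case: ifPn => [jk'|_].
    apply: (subbundle_sub oV VU); apply: HE; exact: leq_trans jk' (ltnW km).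
  apply: (kernel_subbundle htV (subbundle_sub oV VU EkH) (sections_sub VU sLs) domV).
    by move=> p Sp Vp; exact: lin p Sp (VU p Vp).
  exact: nzV.
- by move=> p Sp Vp; rewrite leq0n; exact: E0 p Sp (VU p Vp).
- move=> j /andP[kj jn]; rewrite nth_mkseq// /f ltnNge ltnW//=.
  by rewrite gtn_eqF.
- move=> j jk; rewrite nth_mkseq ?(leq_trans jk kn)// /f.
  have [jlt|] := ltnP j k.
    have [[s' ts' ds'] Hj] := Hom j (ltn_trans jlt km).
    split; first by exists s' => //; rewrite ltnW//; exact: dual_of_order_sub VU ds'.
    by move=> p Sp Vp; rewrite ltnW//; exact: Hj p Sp (VU p Vp).
  move=> kj; have -> : j = k by apply/eqP; rewrite eqn_leq kj -ltnS jk.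
  rewrite eqxx leqnn; split; last by move=> p Sp Vp; split => //; exact: nzV.
  exists s => //; split=> //; exists Ls; split=> //.
  exact: sections_sub VU sLs.
Qed.

End LowerTower.

(** * Fibres of a tower at a point *)

Section TowerAtPoint.
Variables (R : realType) (n : nat).
Local Notation C := R[i].
Local Notation field := (cspace R n -> covec R n).

(** Dual forms are evaluated on sections only, so a vector at [p] has to be extended; constant
    coefficients in a local frame do this. *)
Lemma H10_frame S U (E : cspace R n -> set 'rV[C]_n) p (v : 'rV[C]_n) :
  open U -> complex_subbundle S U E -> (forall x, S x -> U x -> E x = H10 S x) ->
  S p -> U p -> H10 S p v ->
  exists V (L : field), [/\ open V, V p, V `<=` U, section10 S V (H10 S) L & (L p).1 = v].
Proof.
move=> oU HE EH Sp Up Hv; have [V [r [e [oV Vp VU se He]]]] := HE p Sp Up.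
have [_ _ eE] := He p Sp Vp.
have : E p v by rewrite EH.
rewrite eE /= => /submxP[u uE].
exists V, (fun x => (u *m e x, 0)); split=> //.
split.
  split=> [k j|k j].
    apply: (csmooth_ext (F := fun x => \sum_l u k l * e x l j)) => //.
      by move=> x _; rewrite mxE.
    apply/csmoothP => m; apply: cCk_sum => // l _.
    have /csmoothP c := se l j; exact: (cCkZ (u k l) oV (c m)).
  apply: (csmooth_ext (F := fun=> 0)) => //; first by move=> x _; rewrite mxE.
  by apply/csmoothP => m; exact: cCk_cst.
move=> x Sx Vx; split=> //; have [EHx _ eEx] := He x Sx Vx.
by apply: EHx; rewrite eEx /=; exact: submxMl.
Qed.

Variables (S U : set (cspace R n)) (theta : field) (m : nat)
  (E : nat -> cspace R n -> set 'rV[C]_n)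
  (omega : nat -> cspace R n -> 'rV[C]_n -> C) (Ls : nat -> seq field).
Hypotheses (hS : hypersurface S) (oU : open U) (htheta : contact_form S U theta).
Hypothesis HE : forall k, (k <= m)%N -> complex_subbundle S U (E k).
Hypothesis E0 : forall p, S p -> U p -> E 0%N p = H10 S p.
Hypothesis HL : forall k, (k < m)%N -> [/\ (0 < size (Ls k))%N, sections S U (E k) (Ls k) &
  is_dual_form S U theta (Ls k) (omega k)].
Hypothesis Hom : forall k, (k < m)%N -> forall p, S p -> U p ->
  (exists2 v, E k p v & omega k p v != 0) /\ E k.+1 p = E k p `&` [set v | omega k p v = 0].

Variables (W : set (cspace R n)) (rho : cspace R n -> R) (p : cspace R n).
Hypotheses (Srho : defining_function S W rho) (Sp : S p) (Up : U p) (Wp : W p).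

(** The first fibre is killed by the nonzero gradient of [rho], and each form, being nonzero on its
    fibre, lowers the rank by at least one. *)
Lemma tower_fiber_rank k : (k <= m)%N ->
  exists r (M : 'M[C]_(r, n)), E k p = [set v | (v <= M)%MS] /\ (\rank M + k <= n.-1)%N.
Proof.
elim: k => [|k IH] km.
  have [_ [r [M [fM EM]]]] := subbundle_fiber (HE km) Sp Up.
  exists r, M; split=> //; rewrite addn0.
  have [w w1] := exists_normal Srho Sp Wp.
  have g0 : gradz rho p != 0.
    apply/eqP => g0; move: w1; rewrite vapply_gradz g0 big1 => [/eqP|j _].
      by rewrite eq_sym oner_eq0.
    by rewrite mxE mulr0.
  have : M *m (gradz rho p)^T = 0.
    apply/row_matrixP => i; rewrite row_mul row0; apply/rowP => j; rewrite ord1 !mxE.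
    have : H10 S p (row i M) by rewrite -E0// EM /=; exact: row_sub.
    move=> /(H10P Srho Sp Wp); rewrite vapply_gradz => H; rewrite -[RHS]H.
    by apply: eq_bigr => l _; rewrite [(_^T) _ _]mxE.
  move=> /mulmx0_rank_max; rewrite mxrank_tr rank_rV g0 addn1 => H.
  by rewrite -ltnS; exact: leq_trans H (leqSpred n).
have [r [M [EM rM]]] := IH (ltnW km).
have [_ [r' [M' [_ EM']]]] := subbundle_fiber (HE km) Sp Up.
exists r', M'; split=> //; have [[v Ev ov] Ek] := Hom km Sp Up.
rewrite addnS -addSn (leq_trans _ rM)// leq_add2r.
have sub : (M' <= M)%MS.
  apply/row_subP => i; have : E k.+1 p (row i M') by rewrite EM' /=; exact: row_sub.
  by rewrite Ek EM => -[].
have nsub : ~~ (M <= M')%MS.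
  apply/negP => MM'; move/eqP: ov; apply.
  have : E k.+1 p v by rewrite EM' /=; move: Ev; rewrite EM /= => /submx_trans; exact.
  by rewrite Ek => -[].
by apply: rank_ltmx; rewrite /ltmx sub nsub.
Qed.

Hypothesis psc : forall v, H10 S p v -> 0 <= hform (complex_hessian rho p) v.

(* A null vector of a semipositive form lies in its kernel, hence is killed by the
   dual forms of order 2, which are values of the Levi form. *)
Lemma tower_null v : H10 S p v -> hform (complex_hessian rho p) v = 0 ->
  (forall k, (k < m)%N -> (1 < size (Ls k))%N ->
     vapply (v, 0) (cplx (fun x => complex.Re (iter_contact theta (Ls k) x))) p = 0) ->
  forall k, (k <= m)%N -> E k p v.
Proof.
move=> Hv v0 fv; have [oW srho _ _] := Srho; elim=> [|k IH] km; first by rewrite E0.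
have [_ ->] := Hom km Sp Up; split; first exact: IH (ltnW km).
have [sz sL dL] := HL km.
have [V [L [oV Vp VU sLH Lv]]] := H10_frame oU (HE (leq0n m)) E0 Sp Up Hv.
rewrite /= -Lv (dL V L oV VU sLH p Sp Vp).
have [_ L2] := section10_tangent sLH (@subset_refl _ _) Sp Vp.
(* A list of two or more fields gives the derivative of a function, covered by [fv]; a single field
   gives a value of the Levi form. *)
have [one|two] := leqP (size (Ls k)) 1; last first.
  rewrite (dual_value_iter theta two L2) Lv; exact: fv.
case: (Ls k) sz sL one => [|L1 [|//]] // _ /sections_cons[sL1 _] _.
have [kappa [w [Hw H]]] := dual_value1 hS htheta (HE (ltnW km)) Sp Up Srho Wp sL1.
rewrite (H V L oV VU Vp sLH) Lv.
rewrite (semipositive_null (hessian_hermitian oW (srho 2%N) Wp) _ psc Hv v0 Hw) ?mulr0//.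
by move=> c u1 u2; exact: (H10_linear Srho Sp Wp).
Qed.

End TowerAtPoint.

(** * Induction on the multitype *)

Section LexicographicOrder.

Lemma order_lt_trans a b c : order_lt a b -> order_lt b c -> order_lt a c.
Proof. by case: a b c => [a|] [b|] [c|] //=; exact: ltn_trans. Qed.

Lemma order_lt_irr a : order_lt a a = false.
Proof. by case: a => //= a; rewrite ltnn. Qed.

Lemma order_lt_ind (Q : option nat -> Prop) :
  (forall a, (forall b, order_lt b a -> Q b) -> Q a) -> forall a, Q a.
Proof.
move=> H; have HS k : Q (Some k).
  have [l] := ubnP k; elim: l k => // l IH k kl; apply: H => -[b|] //= bk.
  by apply: IH; exact: leq_trans bk kl.
by case=> // ; apply: H => -[b|].
Qed.

Lemma lex_lt_irr s : ~ lex_lt s s.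
Proof. by case=> k _; rewrite order_lt_irr. Qed.

Lemma lex_lt_trans s t u : lex_lt s t -> lex_lt t u -> lex_lt s u.
Proof.
move=> [k Hk lk] [l Hl ll]; have [kl|lk'|kl] := ltngtP k l.
- exists k; last by rewrite -(Hl _ kl).
  by move=> j jk; rewrite Hk// Hl// (ltn_trans jk).
- exists l; last by rewrite (Hk _ lk').
  by move=> j jl; rewrite Hk ?Hl// (ltn_trans jl).
- exists k; last by apply: order_lt_trans lk _; rewrite kl.
  by move=> j jk; rewrite Hk// Hl// -kl.
Qed.

(** Fixing the length is what makes the order well founded. The induction is on the length, with
    [order_lt] on the head and, for a given head, the hypothesis for shorter sequences on the
    tail. *)
Lemma lex_lt_ind N (Q : seq (option nat) -> Prop) :
  (forall t, size t = N -> (forall s, size s = N -> lex_lt s t -> Q s) -> Q t) ->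
  forall t, size t = N -> Q t.
Proof.
elim: N Q => [|N IH] Q H.
  move=> t /size0nil ->; apply: H => // s /size0nil -> [k _].
  by rewrite nth_nil.
have key : forall a t, size t = N -> Q (a :: t).
  elim/order_lt_ind => a IHa; apply: (IH (fun t => Q (a :: t))) => t tN IHt.
  apply: H; first by rewrite /= tN.
  move=> [|b s] //= [sN] [[|k] Hk lt]; first exact: IHa.
  have -> : b = a by exact: (Hk 0%N).
  by apply: IHt => //; exists k => // j jk; exact: (Hk j.+1).
by case=> // a t [tN]; exact: key.
Qed.

End LexicographicOrder.

(** * Compactness of the boundary *)

Section Boundary.
Variables (R : realType) (n : nat).

Lemma hausdorff_cspace : hausdorff_space (cspace R n).
Proof. exact: norm_hausdorff. Qed.

Lemma bounded_boundary_compact (D : set (cspace R n)) : bounded_set D -> compact (boundary D).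
Proof.
move=> [M [_ HM]]; pose N := M + 1.
have DN x : D x -> `|x| <= N by move=> Dx; apply: (HM N _ x Dx); rewrite /N ltrDl.
pose box := [set v : 'rV[R]_n | forall i, `[(- N), N]%classic (v ord0 i)].
have cB : compact box := @rV_compact R n (fun=> `[(- N), N]%classic)
  (fun=> @segment_compact R (- N) N).
have cBB := compact_setX cB cB.
have clB : closed (box `*` box) by apply: compact_closed cBB; exact: hausdorff_cspace.
have coord (v : 'rV[R]_n) : `|v| <= N -> box v.
  move=> vN i; rewrite /= in_itv /= -ler_norml (le_trans _ vN)//.
  by rewrite [leRHS]/Num.norm /= mx_normrE; apply/bigmax_geP; right => /=; exists (ord0, i).
have DB : D `<=` box `*` box.
  move=> x /DN xN; split; apply: coord; apply: le_trans xN;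
    by rewrite prod_normE le_max lexx ?orbT.
apply: (@subclosed_compact _ _ _ _ cBB).
  rewrite /boundary setDE; apply: closedI; first exact: closed_closure.
  by apply: open_closedC; exact: open_interior.
by move=> x [cx _]; rewrite ((closure_id _).1 clB); exact: closureS DB x cx.
Qed.

End Boundary.

(** * The inductive step at a point *)

Section Stratification.
Variables (R : realType) (n q : nat).
Local Notation C := R[i].
Local Notation field := (cspace R n -> covec R n).

Definition locally_trace (S : set (cspace R n)) x := exists2 r : R, 0 < r &
  exists2 B, compact B & trace_property q B /\ S `&` ball x r `<=` B.

Lemma nth_Some_count (t : seq (option nat)) m :
  (forall k, (m <= k < size t)%N -> nth None t k = None) ->
  (size t - m <= count (pred1 None) t)%N.
Proof.
move=> H; rewrite -{2}(cat_take_drop m t) count_cat -size_drop.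
rewrite (_ : count _ (drop m t) = size (drop m t)) ?leq_addl//.
apply/eqP; rewrite -all_count; apply/(all_nthP None) => i.
rewrite size_drop nth_drop => im /=; apply/eqP; apply: H.
by rewrite leq_addr /= -ltn_subRL.
Qed.

(** Minimality at [p] enters as the absence of a smaller multi-order, and the induction hypothesis
    concerns the points that admit one; a nonzero [f k] produces such a multi-order in both
    situations. *)
Lemma stratum_locally_trace (S : set (cspace R n)) p (t : n.-1.-tuple (option nat)) :
  hypersurface S -> compact S -> S p ->
  (exists W rho, [/\ defining_function S W rho, W p &
     forall v, H10 S p v -> 0 <= hform (complex_hessian rho p) v]) ->
  tower_multiorder S p t -> (count (pred1 None) t < q)%N ->
  ~ (exists t', tower_multiorder S p t' /\ lex_lt t' t) ->
  (forall x, S x -> (exists t' : n.-1.-tuple (option nat),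
     tower_multiorder S x t' /\ lex_lt t' t) -> locally_trace S x) ->
  locally_trace S p.
Proof.
move=> hS cS Sp [W [rho [Srho Wp psc]]] [U [theta [oU Up htheta Ht]]] cq minp IH.
have [m [E [omega [mn HE E0 tN Hom]]]] := Ht.
have [oW srho S0 _] := Srho.
have /choice[Ls HLs] k : exists L : seq field, (k < m)%N -> exists s,
    [/\ nth None t k = Some s, size L = s.-1, (1 < s)%N, sections S U (E k) L &
        is_dual_form S U theta L (omega k)].
  have [km|] := ltnP k m; last by exists [::].
  have [[s ts [s2 [L [szL sL dL]]]] _] := Hom k km.
  by exists L => _; exists s.
have HL k : (k < m)%N -> [/\ (0 < size (Ls k))%N, sections S U (E k) (Ls k) &
    is_dual_form S U theta (Ls k) (omega k)].
  by move=> /HLs[s [_ szL s2 sL dL]]; split=> //; rewrite szL; case: s s2 {szL} => [|[]].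
have Hom' k (km : (k < m)%N) := proj2 (Hom k km).
pose f k x := complex.Re (iter_contact theta (Ls k) x).
(* The levels of order at least 3, which are those that define a function. *)
pose I := [seq k <- iota 0 m | (1 < size (Ls k))%N].
have memI k : (k \in I) = (k < m)%N && (1 < size (Ls k))%N.
  by rewrite mem_filter mem_iota add0n andbC.
have Cf k : k \in I -> forall l, Ck l U (f k).
  rewrite memI => /andP[km _]; have [_ sL _] := HL k km.
  exact: (proj1 (csmooth_iter_contact oU (proj1 htheta) sL)).
have lower x k : S x -> U x -> k \in I -> f k x != 0 ->
    exists t' : n.-1.-tuple (option nat), tower_multiorder S x t' /\ lex_lt t' t.
  rewrite memI => Sx Ux /andP[km sz2] fx.
  have [s [ts szL s2 sL dL]] := HLs k km.
  have [L' [L0 [sz' sL' sL0 nz]]] :=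
    lower_order hS oU htheta (HE k (ltnW km)) sz2 sL Sx Ux fx.
  rewrite szL in sz'.
  exact: (lower_tower hS oU htheta mn HE E0 Hom km Sx Ux ts sz' sL' sL0 nz).
have fp k : k \in I -> f k p = 0.
  move=> kI; apply/eqP; apply: contrapT => /negP fN; apply: minp.
  exact: lower Sp Up kI fN.
have [r [M [EM rM]]] := tower_fiber_rank HE E0 Hom' Srho Sp Up Wp (leqnn m).
have oV : open (U `&` W) by exact: openI.
have rhop : rho p = 0 by apply/S0.
have [|||||e e0 He] := @local_potential _ _ q (U `&` W) p rho I f r M oV (conj Up Wp) _ _ rhop fp.
- by apply: Ck_sub (srho 2%N) => x [].
- by move=> k kI; apply: Ck_sub (Cf k kI 2%N) => x [].
- by move=> v /(H10P Srho Sp Wp); exact: psc.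
- move=> v /(H10P Srho Sp Wp) Hv v0 fv.
  have : E m p v.
    apply: (tower_null hS oU htheta HE E0 HL Hom' Srho Sp Up Wp psc Hv v0 _ (leqnn m)).
    by move=> k km sz2; apply: fv; rewrite memI km.
  by rewrite EM.
(* The entries from index [m] on are infinite, so the rank of [E m], at most [n - 1 - m], does not
   exceed the number of infinite entries. *)
- apply: leq_ltn_trans cq; apply: leq_trans (nth_Some_count (m := m) _).
    by rewrite size_tuple leq_subRL// addnC.
  by move=> k; rewrite size_tuple; exact: tN.
have /nbhs_ballP[d /= d0 Hd] : nbhs p (ball p e `&` (U `&` W)).
  apply: filterI; first exact: nbhsx_ballx.
  exact: open_nbhs_nbhs.
(* Half the radius keeps the closed ball inside the ball of radius [d], where all the data are
   defined. *)
pose K := S `&` closed_ball p (d / 2).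
have clS : closed S by apply: compact_closed cS; exact: hausdorff_cspace.
have d2 : 0 < d / 2 by rewrite divr_gt0.
have subK x : K x -> ball p e x /\ (U x /\ W x).
  move=> [_ cx]; apply: Hd; exact: (subset_closure_half d0 cx).
have cK : compact K by apply: compact_closedI => //; exact: closed_ball_closed.
(* A single function whose zero set is the common zero set of the [f k]. *)
pose F x := \sum_(k <- I) f k x ^+ 2.
have F0 x : F x = 0 <-> forall k, k \in I -> f k x = 0.
  rewrite /F; split=> [/eqP|H]; last by rewrite big_seq big1// => k kI; rewrite H// expr0n.
  rewrite psumr_eq0 => [/allP H k kI|k _]; last exact: sqr_ge0.
  by have := H k kI; rewrite /= sqrf_eq0 => /eqP.
have CF : Ck 0 U F.
  apply: (Ck_ext (f := fun x => \sum_(k <- I | k \in I) f k x * f k x) oU).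
    by move=> x _; rewrite -big_seq; apply: eq_bigr => k _; rewrite expr2.
  apply: Ck_sum => // k kI; exact: CkM oU (Cf k kI 0%N) (Cf k kI 0%N).
pose O := U `&` F @^-1` [set y | y != 0].
have oO : open O.
  apply: Ck_open_preimage oU CF _; rewrite (_ : [set y | _] = ~` [set 0]).
    by apply: closed_openC; exact: closed_eq.
  by apply/seteqP; split=> y /eqP.
pose K1 := K `&` ~` O.
have cK1 : compact K1.
  by apply: compact_closedI => //; apply: open_closedC.
have K1F x : K1 x -> F x = 0.
  move=> [Kx nO]; apply: contrapT => /eqP Fx; apply: nO; split=> //.
  by have [_ []] := subK x Kx.
have tK1 : trace_property q K1.
  apply: He => [x [Kx _]|x K1x]; first by have [] := subK x Kx.
  have [Kx _] := K1x; have [_ [Ux Wx]] := subK x Kx.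
  by split; [apply/S0 => //; have [] := Kx|apply/F0; exact: K1F].
exists (d / 2) => //; exists K => //; split; last first.
  by move=> x [Sx bx]; split=> //; exact: subset_closed_ball.
(* At each point of a compact part of [K] avoiding [K1] some [f k] is nonzero, so the induction
   hypothesis applies there. *)
apply: (trace_property_glue cK cK1 tK1) => B cB BK nB.
apply: trace_property_local cB _ => x Bx.
have Kx := BK x Bx; have [_ [Ux Wx]] := subK x Kx; have Sx : S x by have [] := Kx.
have FN : F x <> 0.
  by move=> Fx; apply: (nB x Bx); split=> // -[_ /=]; rewrite Fx eqxx.
have [k [kI fk]] : exists k, k \in I /\ f k x != 0.
  apply: contrapT => H; apply: FN; apply/F0 => k kI; apply/eqP.
  by apply: contrapT => /negP fN; apply: H; exists k.
have [r' r'0 [B' cB' [tB' sub]]] := IH x Sx (lower x k Sx Ux kI fk).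
exists r' => //; exists B' => //; split=> // y [By yr].
by apply: sub; split=> //; have [] := BK y By.
Qed.

End Stratification.

Theorem theorem1p11 (R : realType) (n q : nat) (D : set (cspace R n))
    (hn : (2 <= n)%N) (hq : (1 <= q <= n - 1)%N)
    (hD : bounded_domain D) (hsmooth : smooth_boundary D)
    (hpsc : pseudoconvex D)
    (htype : forall p, boundary D p ->
       exists2 t : n.-1.-tuple (option nat),
         is_tower_multitype (boundary D) p t & (count (pred1 None) t < q)%N) :
  property_P q (boundary D).
Proof.
have hS : hypersurface (boundary D).
  by move=> p /hsmooth[U [rho [[Srho _] Up]]]; exists U, rho.
have cS : compact (boundary D) by case: hD => _ _ _; exact: bounded_boundary_compact.
apply: trace_property_P; apply: trace_property_local => // p Sp.
(* The induction runs over plain sequences; the equation [t = t'] lets the point vary together with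
   its multitype. *)
suff H (t : seq (option nat)) : size t = n.-1 -> forall x, boundary D x ->
    forall t' : n.-1.-tuple (option nat), t = t' -> is_tower_multitype (boundary D) x t' ->
    (count (pred1 None) t' < q)%N -> locally_trace q (boundary D) x.
  have [t Ht cq] := htype p Sp; exact: H (size_tuple t) p Sp t erefl Ht cq.
move: t; apply: lex_lt_ind => u _ IH x Sx t uE [Ht mint] cq; subst u.
have [U [rho [Drho Ux]]] := hsmooth x Sx; have [Srho _] := Drho.
apply: (stratum_locally_trace hS cS Sx _ Ht cq).
- exists U, rho; split=> // v Hv.
  (* An inequality in [R[i]] includes the one between real parts, and the real part here is
     [hform]. *)
  have := hpsc x Sx U rho Drho Ux v Hv; rewrite lecE => /andP[_].
  exact.
- move=> [t' [Ht' lt]]; have [tE|lt'] := mint t' Ht'.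
    by move: lt; rewrite -tE; exact: lex_lt_irr.
  exact: lex_lt_irr (lex_lt_trans lt lt').
(* The multitype at [y] is at most [t'], hence smaller than the one at [x]. *)
- move=> y Sy [t' [Ht' lt]]; have [s [Hs mins] cs] := htype y Sy.
  apply: (IH s (size_tuple s) _ y Sy s erefl (conj Hs mins) cs).
  by have [E|lt'] := mins t' Ht'; [rewrite E|exact: lex_lt_trans lt' lt].
Qed.
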